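(* Let $d=1$, let $(\Omega,\mathcal F,\mathbb P)$ carry a measure-preserving ergodic action $(\tau_k)_{k\in\mathbb Z}$ of $\mathbb Z$, let $a_{per},c_{per}$ be $1$-periodic measurable real functions, and for $\eta>0$ let $b_\eta$ be a stationary scalar random field with $a_\eta=a_{per}+b_\eta c_{per}$. Assume there is $M>0$ with $\|b_\eta\|_{L^\infty([-\frac12,\frac12]\times\Omega)}\le M$ for all $\eta$, and $0<\alpha\le\beta$ with $\alpha\le a_{per}(x)\le\beta$ and $\alpha\le a_{per}(x)+sc_{per}(x)\le\beta$ for a.e. $x$ and all $s\in[-M,M]$. Assume that for some $p>1$, $m_\eta:=\|b_\eta\|_{L^\infty([-\frac12,\frac12];L^p(\Omega))}\to0$ as $\eta\to0$. Then there is a subsequence of $\eta$ (still denoted $\eta$) such that $b_\eta/m_\eta$ converges weakly-$*$ in $L^\infty([-\frac12,\frac12];L^p(\Omega))$ to a limit $\bar b_0$, and along it: - $\frac{d}{dx}w^\eta=\frac{d}{dx}w^0+m_\eta\frac{d}{dx}v^0+o(m_\eta)$ weakly in $L^2([-\frac12,\frac12];L^p(\Omega))$, where $w^0$ is the periodic corrector and $v^0$ solves $-\frac{d}{dx}(a_{per}\frac{d}{dx}v^0)=\frac{d}{dx}\big(\bar b_0c_{per}(\frac{d}{dx}w^0+1)\big)$ in $\mathbb R$, $\frac{d}{dx}v^0$ stationary, $\mathbb E\int_{-1/2}^{1/2}\frac{d}{dx}v^0=0$; - $a_\eta^*=a_{per}^*+m_\eta\int_{-1/2}^{1/2}\mathbb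 E(\bar b_0)c_{per}(\frac{d}{dx}w^0+1)+m_\eta\int_{-1/2}^{1/2}a_{per}\frac{d}{dx}\mathbb E(v^0)+o(m_\eta)$.
   Context: Stationary means $F(x+k,\omega)=F(x,\tau_k\omega)$ for $k\in\mathbb Z$. The stochastic corrector $w^\eta$ solves $-\frac{d}{dx}(a_\eta(\frac{d}{dx}w^\eta+1))=0$ in $\mathbb R$ with $\frac{d}{dx}w^\eta$ stationary and $\mathbb E\int_{-1/2}^{1/2}\frac{d}{dx}w^\eta=0$; $a_\eta^*=\mathbb E\int_{-1/2}^{1/2}a_\eta(\frac{d}{dx}w^\eta+1)$. The periodic corrector $w^0$ is the $1$-periodic solution of $-\frac{d}{dx}(a_{per}(\frac{d}{dx}w^0+1))=0$, and $a_{per}^*=\int_{-1/2}^{1/2}a_{per}(\frac{d}{dx}w^0+1)$. *)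

(* Defs.v *)
From HB Require Import structures.
From mathcomp Require Import all_boot all_order all_algebra.
From mathcomp Require Import all_classical all_reals all_analysis ess_sup_inf hoelder lebesgue_integral_fubini.
Set Implicit Arguments. Unset Strict Implicit. Unset Printing Implicit Defensive.
Import Order.TTheory GRing.Theory Num.Theory.
Import numFieldNormedType.Exports.
Local Open Scope classical_set_scope.
Local Open Scope ring_scope.

Section Defs.
Context {R : realType} {d : measure_display} {T : measurableType d}.

Definition cell : set R := `[-(2^-1), 2^-1]%classic.

Definition Xint (D : set R) (f : R -> R) : R := Rintegral lebesgue_measure D f.
Definition Eint (P : probability T R) (f : T -> R) : R := Rintegral P setT f.

Definition ergodic_action (P : probability T R) (tau : int -> T -> T) : Prop :=
  [/\ (forall k, measurable_fun setT (tau k)),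
      (forall k A, measurable A -> P (tau k @^-1` A) = P A),
      (forall w, tau 0 w = w),
      (forall k l w, tau (k + l)%R w = tau k (tau l w)) &
      (forall A, measurable A -> (forall k, tau k @^-1` A = A) ->
         P A = 0%E \/ P A = 1%E)].

Definition stationary (tau : int -> T -> T) (F : R -> T -> R) : Prop :=
  forall (x : R) (k : int) (w : T), F (x + k%:~R) w = F x (tau k w).

Definition periodic1 (f : R -> R) : Prop := forall x, f (x + 1) = f x.

Definition jmeas (F : R -> T -> R) : Prop :=
  measurable_fun setT (fun z : R * T => F z.1 z.2).

Definition test_fun (phi : R -> R) : Prop :=
  (forall (n : nat) (x : R), derivable (derive1n n phi) x 1) /\
  exists r : R, forall x, r < `|x| -> phi x = 0.

Definition loc_int (f : R -> R) : Prop :=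
  forall r : R, lebesgue_measure.-integrable `[-r, r] (EFin \o f).

Definition LpO (P : probability T R) (p : R) (F : R -> T -> R) (x : R) : \bar R :=
  Lnorm P p%:E (EFin \o F x).

Definition LooLp (P : probability T R) (p : R) (F : R -> T -> R) : \bar R :=
  ess_sup lebesgue_measure (fun x => if `[< cell x >] then LpO P p F x else 0%E).

Definition in_L1Lq (P : probability T R) (q : R) (F : R -> T -> R) : Prop :=
  jmeas F /\ (\int[lebesgue_measure]_(x in cell) LpO P q F x < +oo)%E.

Definition in_L2Lq (P : probability T R) (q : R) (F : R -> T -> R) : Prop :=
  jmeas F /\ (\int[lebesgue_measure]_(x in cell) (LpO P q F x * LpO P q F x) < +oo)%E.

Definition Linf_cell_le (P : probability T R) (F : R -> T -> R) (M : R) : Prop :=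
  \forall z \ae (lebesgue_measure \x P)%E, cell z.1 -> `|F z.1 z.2| <= M.

Definition pairing (P : probability T R) (F phi : R -> T -> R) : R :=
  Xint cell (fun x => Eint P (fun w => F x w * phi x w)).

Definition in_L2cell (P : probability T R) (F : R -> T -> R) : Prop :=
  jmeas F /\
  (\int[(lebesgue_measure \x P)%E]_(z in cell `*` setT) ((F z.1 z.2) ^+ 2)%:E < +oo)%E.

(* g = d/dx w^eta is the derivative of the stochastic corrector of the
   coefficient A :  -(A (w' + 1))' = 0 in R (distributionally, P-a.s.),
   w' stationary, E int_cell w' = 0. *)
Definition stoch_corrector_deriv (P : probability T R) (tau : int -> T -> T)
    (A g : R -> T -> R) : Prop :=
  [/\ in_L2cell P g, stationary tau g,
      (\forall w \ae P, loc_int (g^~ w) /\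
          forall phi, test_fun phi ->
            Xint setT (fun x => A x w * (g x w + 1) * derive1 phi x) = 0) &
      Eint P (fun w => Xint cell (fun x => g x w)) = 0].

(* g0 = d/dx w^0 for the 1-periodic corrector w^0 of a_per:
   -(a_per (w0' + 1))' = 0 in R, w0 1-periodic (i.e. w0' 1-periodic with
   zero mean over a period). *)
Definition per_corrector_deriv (aper g0 : R -> R) : Prop :=
  [/\ measurable_fun setT g0, periodic1 g0, loc_int g0,
      Xint cell g0 = 0 &
      forall phi, test_fun phi ->
        Xint setT (fun x => aper x * (g0 x + 1) * derive1 phi x) = 0].

Definition v0_deriv (P : probability T R) (tau : int -> T -> T) (p : R)
    (aper cper g0 : R -> R) (b0 dv : R -> T -> R) : Prop :=
  [/\ in_L2Lq P p dv, stationary tau dv,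
      (\forall w \ae P, loc_int (dv^~ w) /\
          forall phi, test_fun phi ->
            Xint setT (fun x => aper x * dv x w * derive1 phi x) =
            - Xint setT (fun x => b0 x w * cper x * (g0 x + 1) * derive1 phi x)) &
      Eint P (fun w => Xint cell (fun x => dv x w)) = 0].

Definition a_eta (aper cper : R -> R) (b : R -> T -> R) : R -> T -> R :=
  fun x w => aper x + b x w * cper x.

Definition astar_stoch (P : probability T R) (A g : R -> T -> R) : R :=
  Eint P (fun w => Xint cell (fun x => A x w * (g x w + 1))).

Definition astar_per (aper g0 : R -> R) : R :=
  Xint cell (fun x => aper x * (g0 x + 1)).

Definition m_of (P : probability T R) (p : R) (b : R -> T -> R) : R :=
  fine (LooLp P p b).

End Defs.

(* Main.v *)
Require Import Defs.
From HB Require Import structures.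
From mathcomp Require Import all_boot all_order all_algebra.
From mathcomp Require Import all_classical all_reals all_analysis ess_sup_inf hoelder lebesgue_integral_fubini.
From mathcomp Require Import measurable_realfun ring lra.
Set Implicit Arguments. Unset Strict Implicit. Unset Printing Implicit Defensive.
Import Order.TTheory GRing.Theory Num.Theory.
Import numFieldNormedType.Exports.
Local Open Scope classical_set_scope.
Local Open Scope ring_scope.

(** In dimension one the flux [A_n (g_n + 1)] of the stochastic corrector is, for
    almost every realization, constant in space (du Bois-Reymond); stationarity and
    ergodicity make the constant deterministic, and the zero mean of [g_n] identifies
    it as the harmonic mean [H_n = 1 / \int E (1 / A_n)].  So [g_n + 1 = H_n / A_n],
    and likewise [g_0 + 1 = H_0 / a] for the periodic corrector.  Everything then
    follows from the exact expansion
      [1 / A_n = 1 / a - m_n f_n c / (a A_n)],  [f_n = b_n / m_n],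
    where [f_n] lies in the unit ball of [L^oo(cell; L^p)].  The second order term
    [m_n f_n^2] need not be bounded in [L^1] for [p < 2]; it vanishes because
    [m_n |f_n| <= M], so that it is at most [|f_n| min(M, m_n |f_n|)], and the [f_n]
    are uniformly integrable.

    The weakly convergent subsequence is found first against bounded functions: along
    an ultrafilter the integrals of [f_n] over measurable sets define a countably
    additive set function, which has a Radon-Nikodym density.  The limit stays in the
    unit ball by duality, and Young's inequality controls the tails of test functions
    in [L^1(cell; L^q)] uniformly in [n], which extends the convergence to them.
    Finally the limit on the cell is extended to the line by stationarity. *)

(** * Integrals of real functions *)

(** An ultrafilter supplies all limits at once, but only along a filter. The way back to a sequence
    is to make the countably many mutual pairings of the truncated [f_n] converge: these numbers
    already determine the weak limit. Truncation places the terms in a Hilbert space even when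
    [p < 2].

    The hypotheses bound the coefficients and fields only almost everywhere, whereas the algebra
    with [1 / A_n] wants bounds at every point. Hence the couples [aper], [amod] and [b],
    [clip M b]: all estimates are made on the second member, and almost everywhere equality carries
    the integrals over to the first.

    Nothing excludes [m_n = 0]. Since [0^-1 = 0], such indices contribute [0] to every quotient by
    [m_n], and the expansions are arranged so that this value is consistent. *)

Section real_integral.
Context d (T : measurableType d) (R : realType).
Context (mu : {measure set T -> \bar R}) (D : set T) (mD : measurable D).
Implicit Types f g h : T -> R.

Let intg f := mu.-integrable D (EFin \o f).

Lemma intg_meas f : intg f -> measurable_fun D f.
Proof. by move=> /integrableP[/measurable_EFinP]. Qed.

Lemma intgD f g : intg f -> intg g -> intg (fun x => f x + g x).
Proof. by move=> hf hg; exact: (integrableD mD hf hg). Qed.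

Lemma intgB f g : intg f -> intg g -> intg (fun x => f x - g x).
Proof. by move=> hf hg; exact: (integrableB mD hf hg). Qed.

Lemma intgZ f k : intg f -> intg (fun x => k * f x).
Proof. by move=> hf; exact: (integrableZl mD k hf). Qed.

Lemma intg_norm f : intg f -> intg (fun x => `|f x|).
Proof. exact: integrable_norm. Qed.

Lemma intg_le f g : measurable_fun D g -> intg f ->
  (forall x, D x -> `|g x| <= f x) -> intg g.
Proof.
move=> mg hf gf; apply: (@le_integrable _ _ _ mu _ mD _ (EFin \o f)) => //.
  exact/measurable_EFinP.
by move=> x Dx /=; rewrite lee_fin (le_trans (gf _ Dx))// ler_norm.
Qed.

Lemma intgM f g C : intg f -> measurable_fun D g ->
  (forall x, D x -> `|g x| <= C) -> intg (fun x => f x * g x).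
Proof.
move=> hf mg gC; apply: (@intg_le (fun x => C * `|f x|)).
- by apply: measurable_funM => //; exact: intg_meas.
- exact/intgZ/intg_norm.
- by move=> x Dx; rewrite normrM mulrC ler_wpM2r// gC.
Qed.

Lemma intg_bounded f C : (mu D < +oo)%E -> measurable_fun D f ->
  (forall x, D x -> `|f x| <= C) -> intg f.
Proof.
move=> muD mf fC; apply: measurable_bounded_integrable => //.
exists C; split; first exact: num_real.
by move=> M CM x /fC /le_trans; apply; exact: ltW.
Qed.

Lemma Rint_ae f g : measurable_fun D f -> measurable_fun D g ->
  {ae mu, forall x, D x -> f x = g x} ->
  \int[mu]_(x in D) f x = \int[mu]_(x in D) g x.
Proof.
move=> mf mg fg; congr fine; apply: ae_eq_integral => //.
- exact/measurable_EFinP.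
- exact/measurable_EFinP.
- by apply: filterS fg => x fg Dx; rewrite /= fg.
Qed.

Lemma intg_ae f g : intg f -> measurable_fun D g ->
  {ae mu, forall x, D x -> f x = g x} -> intg g.
Proof.
move=> hf mg fg; apply/integrableP; split; first exact/measurable_EFinP.
have /integrableP[mf] := hf; apply: le_lt_trans.
rewrite le_eqVlt; apply/orP; left; apply/eqP; apply: ae_eq_integral => //.
- by apply: measurableT_comp => //; exact/measurable_EFinP.
- exact: measurableT_comp.
- by apply: filterS fg => x fg Dx; rewrite /= fg.
Qed.

Lemma Rint_dct (f_ : nat -> T -> R) f g :
  (forall n, measurable_fun D (f_ n)) -> measurable_fun D f ->
  {ae mu, forall x, D x -> f_ n x @[n --> \oo] --> f x} ->
  intg g -> (forall n x, D x -> `|f_ n x| <= g x) ->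
  \int[mu]_(x in D) f_ n x @[n --> \oo] --> \int[mu]_(x in D) f x.
Proof.
move=> mf_ mf f_f ig f_g.
have [] := @dominated_convergence _ _ _ mu D mD (fun n => EFin \o f_ n) (EFin \o f) (EFin \o g).
- by move=> n; exact/measurable_EFinP.
- exact/measurable_EFinP.
- apply: filterS f_f => x h Dx; apply: cvg_EFin; last exact: h.
  by near=> n.
- exact: ig.
- by apply: aeW => x n Dx; rewrite /= lee_fin f_g.
move=> i_f _ h; apply: fine_cvg; rewrite fineK//.
exact: integrable_fin_num.
Unshelve. all: by end_near. Qed.

Lemma norm_Rint_le f g : measurable_fun D f -> intg g ->
  (forall x, D x -> `|f x| <= g x) ->
  `|\int[mu]_(x in D) f x| <= \int[mu]_(x in D) g x.
Proof.
move=> mf hg fg; have hf := intg_le mf hg fg.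
by apply: (le_trans (le_normr_Rintegral mD hf)); apply: le_Rintegral => //; exact: intg_norm.
Qed.

Lemma Rint0_ae f : intg f -> (forall x, D x -> 0 <= f x) ->
  \int[mu]_(x in D) f x <= 0 -> {ae mu, forall x, D x -> f x = 0}.
Proof.
move=> hf f0 If0.
have mf := intg_meas hf.
have : (\int[mu]_(x in D) `|(f x)%:E| = 0)%E.
  have -> : (\int[mu]_(x in D) `|(f x)%:E| = \int[mu]_(x in D) (f x)%:E)%E.
    by apply: eq_integral => x /set_mem Dx; rewrite gee0_abs// lee_fin f0.
  rewrite -[LHS]fineK; last exact: integrable_fin_num.
  by congr EFin; apply/eqP; rewrite eq_le If0 Rintegral_ge0.
move=> /(ae_eq_integral_abs mu mD) => /(_ (proj2 (measurable_EFinP _ _) mf)).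
by apply: filterS => x h Dx; have := h Dx => -[].
Qed.

End real_integral.

Lemma integrable_zero_ext d (T : measurableType d) (R : realType)
  (mu : {measure set T -> \bar R}) (D : set T) (f : T -> R) :
  measurable D -> (forall x, ~ D x -> f x = 0) ->
  mu.-integrable D (EFin \o f) -> mu.-integrable setT (EFin \o f).
Proof.
move=> mD f0 /(integrable_mkcond _ mD); congr (_.-integrable _ _).
apply/funext => x; rewrite patchE; case: ifPn => // /negP; rewrite inE => /f0 /= ->//.
Qed.

(** * Test functions and the du Bois-Reymond lemma *)

Section flat.
Context {R : realType}.
Implicit Types (P : {poly R}) (x y : R).

(* Derivatives of [flat P] are again of this form, whence smoothness by induction. *)
Definition flat P x : R := if 0 < x then P.[x^-1] * expR (- x^-1) else 0.

(** The power [y ^+ n] is carried along so that the induction on [P] closes: passing to [P * 'X + c]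
    trades one factor [y] for a larger [n]. *)
Lemma poly_le_expR P n : exists C : R, forall y, 0 <= y -> `|P.[y]| * y ^+ n <= C * expR y.
Proof.
elim/poly_ind: P n => [|P c IH] n.
  by exists 0 => y y0; rewrite horner0 normr0 !mul0r.
have [C1 H1] := IH n.+1.
have [C2 H2] : exists C : R, forall y, 0 <= y -> y ^+ n <= C * expR y.
  case: n {H1} => [|n].
    by exists 1 => y y0; rewrite expr0 mul1r -expR0 ler_expR.
  exists (n.+1`!%:R) => y y0; rewrite mulrC -ler_pdivrMr ?ltr0n ?fact_gt0//.
  by apply: le_trans (expR_ge1Dxn n y0); rewrite lerDr.
exists (C1 + `|c| * C2) => y y0; rewrite hornerMXaddC.
apply: (@le_trans _ _ (`|P.[y]| * y ^+ n.+1 + `|c| * y ^+ n)).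
  rewrite exprS mulrA -mulrDl ler_wpM2r ?exprn_ge0//.
  by rewrite (le_trans (ler_normD _ _))// normrM (ger0_norm y0).
by rewrite mulrDl lerD ?H1// -mulrA ler_wpM2l// H2.
Qed.

Lemma flat0 P x : x <= 0 -> flat P x = 0.
Proof. by move=> x0; rewrite /flat ltNge x0. Qed.

(** Apply [poly_le_expR] at [y = x^-1]: one spare power of [y] becomes the factor [|x|]. Order one
    suffices, because higher flatness at the origin is reached by changing [P]. *)
Lemma flat_le P : exists2 C : R, 0 <= C & forall x, `|flat P x| <= C * `|x|.
Proof.
have [C HC] := poly_le_expR P 1.
exists `|C| => // x; rewrite /flat; case: ifPn => [x0|_]; last first.
  by rewrite normr0 mulr_ge0.
rewrite normrM (ger0_norm (expR_ge0 _)) expRN ler_pdivrMr ?expR_gt0//.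
have := HC _ (ltW (_ : 0 < x^-1)); rewrite invr_gt0 => /(_ x0).
rewrite expr1 ler_pdivrMr// => /le_trans; apply.
rewrite (gtr0_norm x0) mulrAC ler_wpM2r ?expR_ge0//.
by rewrite ler_wpM2r ?(ltW x0)// ler_norm.
Qed.

Lemma flat_cvg0 P : flat P x @[x --> 0] --> (0 : R).
Proof.
have [C C0 HC] := flat_le P.
apply/norm_cvg0P.
apply: (@squeeze_cvgr _ _ _ _ (fun=> 0) (fun x => C * `|x|)).
- by near=> x; rewrite normr_ge0 HC.
- exact: cvg_cst.
- have : C * `|x| @[x --> (0 : R)] --> C * `|0 : R|.
    by apply: cvgM; [exact: cvg_cst|exact: (@norm_continuous _ R)].
  by rewrite normr0 mulr0.
Unshelve. all: by end_near. Qed.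

Lemma is_derive_flat P x :
  is_derive x (1 : R) (flat P) (flat ('X^2 * (P - P^`())) x).
Proof.
have [x0|x0|->] := ltgtP x 0.
- rewrite flat0 ?ltW//; apply: (@near_eq_is_derive _ _ _ (cst 0)).
  by near=> z; rewrite flat0//=; apply: ltW; near: z; exact: lt_nbhsl.
- apply: (@near_eq_is_derive _ _ _
    ((horner P \o (fun y => y^-1)) * (expR \o (fun y => - y^-1)))).
    by near=> z; rewrite /flat ifT//; near: z; exact: lt_nbhsr.
  have dV : is_derive x (1 : R) (fun y : R => y^-1) (- x ^- 2 *: 1).
    by apply: (@is_deriveV _ id); rewrite ?gt_eqF//; exact: is_derive_id.
  have dN : is_derive x (1 : R) (fun y : R => - y^-1) (- (- x ^- 2 *: 1)).
    exact: is_deriveN.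
  have d1 := @is_derive1_comp _ _ _ _ _ _ (is_derive_poly P x^-1) dV.
  have d2 := @is_derive1_comp _ expR (fun y => - y^-1) x _ _ (is_derive_expR (- x^-1)) dN.
  refine (is_derive_eq (is_deriveM d1 d2) _).
  rewrite /flat x0 /= !hornerE/= ![_%:A]mulr1 /GRing.scale/=.
  by rewrite exprVn; ring.
- rewrite flat0//.
  suff H : h^-1 *: ((flat P \o shift 0) (h *: 1) - flat P 0) @[h --> (0:R)^'] --> (0 : R).
    apply: DeriveDef; first by apply/cvg_ex; exists 0.
    exact/cvg_lim.
  (* Dividing by [h] multiplies the polynomial in [h^-1] by ['X], so the difference quotient at the
     origin is again a flat function and tends to [0]. *)
  apply: (@cvg_trans _ (flat ('X * P) h @[h --> (0:R)^'])).
    apply: near_eq_cvg; near=> h.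
    rewrite /= addr0 (flat0 _ (lexx 0)) subr0 /flat /GRing.scale/= mulr1.
    by case: ifPn; rewrite ?mulr0// hornerM hornerX mulrA.
  exact: cvg_within_filter (flat_cvg0 _).
Unshelve. all: by end_near. Qed.

(** Recursion through the first derivative, rather than through iterated derivatives, lets the
    product rule be used inductively without the Leibniz formula. *)
Fixpoint Ck (n : nat) (f : R -> R) : Prop :=
  (forall x, derivable f x 1) /\ (if n is m.+1 then Ck m f^`()%classic else True).

Definition smooth (f : R -> R) := forall n x, derivable (f^`(n))%classic x 1.

Lemma smoothP f : smooth f <-> forall n, Ck n f.
Proof.
split=> [sf n|sf n].
  elim: n f sf => [|n IH] f sf /=; split=> //; try exact: (sf 0%N).
  by apply: IH => m x; rewrite -derive1Sn; exact: sf.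
elim: n f sf => [|n IH] f sf x; first by case: (sf 0%N) => /(_ x).
rewrite derive1Sn; apply: IH => m.
by case: (sf m.+1).
Qed.

Lemma CkS n f : Ck n.+1 f -> Ck n f.
Proof. by elim: n f => [|n IH] f [df Hf]; split=> //; exact: IH. Qed.

Lemma CkD n f g : Ck n f -> Ck n g -> Ck n (f \+ g).
Proof.
elim: n f g => [|n IH] f g [df Hf] [dg Hg]; (split; first by move=> x; exact: derivableD) => //.
have -> : ((f \+ g)^`())%classic = (f^`()%classic \+ g^`()%classic).
  by apply/funext => x /=; rewrite !derive1E deriveD.
exact: IH.
Qed.

Lemma CkM n f g : Ck n f -> Ck n g -> Ck n (f \* g).
Proof.
elim: n f g => [|n IH] f g Cf Cg.
  by split=> // x; apply: derivableM; [case: Cf|case: Cg].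
have [df Hf] := Cf; have [dg Hg] := Cg; split; first by move=> x; exact: derivableM.
have -> : ((f \* g)^`())%classic = ((f \* g^`()%classic) \+ (g \* f^`()%classic)).
  by apply/funext => x /=; rewrite !derive1E deriveM.
by apply: CkD; apply: IH => //; exact: CkS.
Qed.

Lemma CkC n (c : R) : Ck n (cst c).
Proof.
elim: n c => [|n IH] c /=; split=> //; try by move=> x; exact: derivable_cst.
have -> : ((cst c)^`())%classic = cst 0 :> (R -> R) by apply/funext => x; rewrite derive1_cst.
exact: IH.
Qed.

Lemma Ck_affine n f (k c : R) : Ck n f -> Ck n (fun x => f (k * x + c)).
Proof.
elim: n f => [|n IH] f Cf.
  split=> // x; have [df _] := Cf.
  have da : is_derive x (1 : R) (fun x => k * x + c) (k *: 1 + 0).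
    exact: is_deriveD.
  by have [] := @is_derive1_comp _ f (fun x => k * x + c) x _ _ (derivableP (df (k * x + c))) da.
have [df Hf] := Cf.
have da x : is_derive x (1 : R) (fun x => k * x + c) (k *: 1 + 0).
  exact: is_deriveD.
have dc x := @is_derive1_comp _ f (fun x => k * x + c) x _ _ (derivableP (df (k * x + c))) (da x).
split; first by move=> x; case: (dc x).
have -> : ((fun x => f (k * x + c))^`())%classic =
    (cst k \* (fun x => f^`()%classic (k * x + c))).
  apply/funext => x /=; rewrite derive1E.
  have -> := @derive_val _ _ _ _ _ _ _ (dc x).
  by rewrite derive1E addr0 /GRing.scale/= mulr1 mulrC.
by apply: CkM; [exact: CkC|exact: IH].
Qed.

Lemma Ck_flat n P : Ck n (flat P).
Proof.
elim: n P => [|n IH] P; split=> //; try by move=> x; case: (is_derive_flat P x).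
have -> : ((flat P)^`())%classic = flat ('X^2 * (P - P^`())).
  apply/funext => x; rewrite derive1E.
  exact: (@derive_val _ _ _ _ _ _ _ (is_derive_flat P x)).
exact: IH.
Qed.

Lemma smooth_continuous f : smooth f -> continuous f.
Proof.
move=> sf x; apply: differentiable_continuous; apply/derivable1_diffP.
exact: (sf 0%N).
Qed.

End flat.

(** * Functions with vanishing distributional derivative *)

Section du_bois_reymond.
Context {R : realType}.
Implicit Types (f F chi : R -> R) (r a b x c : R).
Notation leb := (@lebesgue_measure R).

Definition supp_in r chi := forall x, r < `|x| -> chi x = 0.

Lemma itvNr_norm (r x : R) : `[- r, r]%classic x = (`|x| <= r) :> Prop.
Proof. by rewrite /= in_itv/= ler_norml. Qed.

Lemma Rint_supp f r A : supp_in r f -> `[- r, r]%classic `<=` A ->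
  \int[leb]_(x in A) f x = \int[leb]_(x in `[- r, r]) f x.
Proof.
move=> fr rA; rewrite Rintegral_mkcond [RHS]Rintegral_mkcond; congr (Rintegral _ _ _).
apply/funext => x; rewrite !patchE.
have [xr|xr] := leP `|x| r.
  have h : `[- r, r]%classic x by rewrite itvNr_norm.
  by rewrite !mem_set//; exact: rA.
by rewrite (fr _ xr); do 2 case: ifP.
Qed.

Lemma supp_integrable f r A : measurable A -> continuous f -> supp_in r f ->
  leb.-integrable A (EFin \o f).
Proof.
move=> mA cf fr; apply: (integrableS measurableT mA) => //.
apply: (@integrable_zero_ext _ _ _ leb `[- r, r]%classic) => //.
  by move=> x; rewrite itvNr_norm => /negP; rewrite -ltNge => /fr.
apply: (@continuous_compact_integrable _ f); first exact: segment_compact.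
exact: continuous_subspaceT.
Qed.

(** The primitive from [-oo] vanishes to the left of the support of [chi]; to the right of it, it
    equals the total integral, which is zero. *)
Lemma antiderivative_test_fun chi r : smooth chi -> supp_in r chi ->
  \int[leb]_x chi x = 0 ->
  exists2 phi, test_fun phi & (phi^`())%classic = chi.
Proof.
move=> schi rchi chi0; have cchi := smooth_continuous schi.
pose phi x := \int[leb]_(t in `]-oo, x]) chi t.
have dphi x : derivable phi x 1 /\ (phi^`())%classic x = chi x.
  apply: (@continuous_FTC1 _ chi -oo%O x (x + 1)); rewrite ?ltrDl//.
  - exact: supp_integrable rchi.
  - exact: ltNyr.
  - exact: cchi.
have phiE : (phi^`())%classic = chi by apply/funext => x; case: (dphi x).
exists phi => //; split.
  case=> [|n] x; first by case: (dphi x).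
  by rewrite derive1Sn phiE; exact: schi.
exists `|r| => x xr; rewrite /phi.
have [x0|x0] := ltP x 0.
  rewrite Rintegral_mkcond (_ : _ \_ _ = cst 0) ?/Rintegral ?integral0//.
  apply/funext => y; rewrite patchE; case: ifPn => //; rewrite inE/= in_itv/= => yx.
  apply: rchi; rewrite (le_lt_trans (ler_norm r))// (lt_le_trans xr)//.
  by rewrite !ler0_norm ?lerN2// ltW// (le_lt_trans yx).
rewrite -chi0 (@Rint_supp _ r)//; first by rewrite (@Rint_supp _ r setT).
move=> y; rewrite itvNr_norm /= in_itv/= => /(le_trans (ler_norm _)) /le_trans; apply.
by rewrite -(ger0_norm x0) ltW// (le_lt_trans (ler_norm r)).
Qed.

(** Scaling by [k.+1] sends [exp (- 1 / (k.+1 * y))] to [1] for [y > 0], so the bumps tend to the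
    indicator of the open interval. The arguments are expanded to the form [k * x + c] expected by
    [Ck_affine]. *)
Definition bump (a b : R) (k : nat) (x : R) : R :=
  flat 1 (k.+1%:R * x + - (k.+1%:R * a)) * flat 1 (- k.+1%:R * x + k.+1%:R * b).

Lemma smooth_bump a b k : smooth (bump a b k).
Proof. by apply/smoothP => n; apply: CkM; apply: Ck_affine; exact: Ck_flat. Qed.

Lemma flat1_itv (x : R) : 0 <= flat 1 x <= 1.
Proof.
rewrite /flat; case: ifPn => [x0|_]; last by rewrite lexx ler01.
rewrite hornerC mul1r expR_ge0/= -expR0 ler_expR oppr_le0 invr_ge0; exact: ltW.
Qed.

Lemma bump_itv a b k x : 0 <= bump a b k x <= 1.
Proof.
have /andP[h1 h2] := flat1_itv (k.+1%:R * x + - (k.+1%:R * a)).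
have /andP[h3 h4] := flat1_itv (- k.+1%:R * x + k.+1%:R * b).
by rewrite mulr_ge0//= mulr_ile1.
Qed.

Lemma bump0 a b k x : ~~ (a < x < b) -> bump a b k x = 0.
Proof.
rewrite negb_and -!leNgt => /orP[xa|xb]; rewrite /bump.
  by rewrite flat0 ?mul0r// -mulrBr mulr_ge0_le0// subr_le0.
by rewrite [X in _ * X]flat0 ?mulr0// mulNr addrC -mulrBr mulr_ge0_le0// subr_le0.
Qed.

Lemma flat1_cvg (y : R) : 0 < y -> flat 1 (k.+1%:R * y) @[k --> \oo] --> (1 : R).
Proof.
move=> y0.
rewrite (_ : (fun k : nat => _) = (fun k => expR (- (y^-1 * harmonic k)))); last first.
  apply/funext => k; rewrite /flat mulr_gt0// hornerC mul1r /harmonic.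
  by rewrite invfM mulrC.
rewrite -expR0; apply: continuous_cvg; first exact: continuous_expR.
rewrite -oppr0; apply: cvgN; rewrite -(mulr0 y^-1).
by apply: cvgM; [exact: cvg_cst|exact: cvg_harmonic].
Qed.

Lemma bump_cvg a b x : bump a b k x @[k --> \oo] --> (\1_(`]a, b[%classic) x : R).
Proof.
rewrite indicE; have [xab|xab] := boolP (a < x < b).
  rewrite mem_set ?/= ?in_itv//=.
  move: xab => /andP[ax xb].
  rewrite (_ : (fun k : nat => _) =
    (fun k => flat 1 (k.+1%:R * (x - a)) * flat 1 (k.+1%:R * (b - x)))); last first.
    by apply/funext => k; rewrite /bump; congr (flat _ _ * flat _ _); ring.
  rewrite -[X in _ --> X](mulr1 1); apply: cvgM; apply: flat1_cvg; by rewrite subr_gt0.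
rewrite memNset/= ?in_itv/=; last exact/negP.
by under eq_cvg do rewrite bump0//; exact: cvg_cst.
Qed.

Lemma bump_supp a b k : supp_in (Num.max `|a| `|b|) (bump a b k).
Proof.
move=> x; rewrite gt_max => /andP[ax bx]; apply: bump0; apply/negP => /andP[h1 h2].
have [x0|x0] := leP 0 x.
  by move: bx; rewrite (ger0_norm x0) ltNge (le_trans (ltW h2))// ler_norm.
move: ax; rewrite ltNge (ltr0_norm x0) => /negP; apply.
by rewrite (@le_trans _ _ (- a)) ?lerN2 ?(ltW h1)// -normrN ler_norm.
Qed.

Lemma Rint_bump_cvg F a b : a < b -> leb.-integrable `[a, b] (EFin \o F) ->
  measurable_fun setT F ->
  \int[leb]_x (F x * bump a b k x) @[k --> \oo] --> \int[leb]_(x in `]a, b[) F x.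
Proof.
move=> ab iF mF.
rewrite (_ : \int[leb]_(x in `]a, b[) F x = \int[leb]_x (F x * \1_(`]a, b[%classic) x)); last first.
  rewrite Rintegral_mkcond; congr (Rintegral _ _ _); apply/funext => x.
  by rewrite patchE indicE; case: ifP; rewrite ?mulr1 ?mulr0.
have mb k : measurable_fun setT (bump a b k).
  by apply: continuous_measurable_fun; exact/smooth_continuous/smooth_bump.
apply: (@Rint_dct _ _ _ leb setT measurableT (fun k x => F x * bump a b k x) _
   (fun x => `|(F \_ `[a, b]) x|)).
- by move=> k; exact: (measurable_funM mF (mb k)).
- by apply: (measurable_funM mF); exact: measurable_indic.
- by apply: aeW => x _; apply: cvgM; [exact: cvg_cst|exact: bump_cvg].
- apply: intg_norm => //; rewrite -restrict_EFin.
  exact: (iffLR (@integrable_mkcond _ _ _ leb `[a, b]%classic (EFin \o F) _)).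
- move=> k x _; rewrite patchE; case: ifPn => [_|/negP xab].
    have /andP[h1 h2] := bump_itv a b k x.
    by rewrite normrM (ger0_norm h1) ler_piMr.
  rewrite bump0 ?mulr0//; apply/negP => /andP[ax xb]; apply: xab.
  by rewrite inE/= in_itv/= !ltW.
Qed.

Lemma loc_int_itv F (a b : R) : loc_int F -> leb.-integrable `[a, b] (EFin \o F).
Proof.
move=> lF; apply: (integrableS _ _ _ (lF (Num.max `|a| `|b|))) => // x /=.
rewrite !in_itv/= => /andP[ax xb]; rewrite -ler_norml.
have [x0|x0] := leP 0 x.
  by rewrite (ger0_norm x0) le_max (le_trans xb (ler_norm b)) orbT.
rewrite (ltr0_norm x0) le_max (@le_trans _ _ (- a))// ?lerN2//.
by rewrite -normrN ler_norm.
Qed.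

Lemma loc_int_measurable F : loc_int F -> measurable_fun setT F.
Proof.
move=> lF.
have -> : [set: R] = \bigcup_(n : nat) `[- n%:R, n%:R]%classic.
  apply/seteqP; split=> // x _; exists (Num.truncn `|x|).+1 => //.
  by rewrite itvNr_norm ltW// truncnS_gt.
apply/measurable_fun_bigcup => // n.
by have /integrableP[/measurable_EFinP] := lF n%:R.
Qed.

Lemma loc_int_mul_supp F g t : loc_int F -> continuous g -> supp_in t g ->
  leb.-integrable setT (EFin \o (fun x => F x * g x)).
Proof.
move=> lF cg tg; have mF := loc_int_measurable lF.
apply: (@integrable_zero_ext _ _ _ leb `[- t, t]%classic) => //.
  by move=> x; rewrite itvNr_norm => /negP; rewrite -ltNge => /tg ->; rewrite mulr0.
have [C HC] : exists C, forall x, `[- t, t]%classic x -> `|g x| <= C.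
  have : compact (g @` `[- t, t]%classic).
    by apply: continuous_compact; [exact: continuous_subspaceT|exact: segment_compact].
  move=> /compact_bounded [C [_ HC]]; exists (C + 1) => x tx.
  by apply: (HC (C + 1)); [rewrite ltrDl|exists x].
apply: (@intgM _ _ _ leb `[- t, t]%classic _ F g C) => //.
exact: (measurable_funS _ _ (continuous_measurable_fun cg)).
Qed.

Lemma test_fun_derive phi : test_fun phi ->
  continuous (phi^`())%classic /\ exists t, supp_in t (phi^`())%classic.
Proof.
move=> [sphi [r rphi]]; split.
  by move=> x; have := sphi 1%N x; rewrite derive1n1 => /derivable1_diffP/differentiable_continuous.
exists r => x rx; rewrite derive1E.
have -> : 'D_1 phi x = 'D_1 (cst 0) x; last by rewrite derive_cst.
apply: near_eq_derive.
have : open [set y : R | r < `|y|].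
  apply: (@open_comp _ _ (fun y : R => `|y|) [set y | r < y]) => [y _|]; last exact: open_gt.
  exact: norm_continuous.
by move=> /(_ x rx); apply: filterS => y /= /rphi.
Qed.

(** This makes a constant flux invisible in a weak equation; it removes the constant part of
    [aper * dv] in the equation of the first order corrector. *)
Lemma Rint_test_fun_derive phi : test_fun phi -> \int[leb]_x (phi^`())%classic x = 0.
Proof.
move=> tphi; have [cphi' [t tphi']] := test_fun_derive tphi.
have [sphi [r rphi]] := tphi; pose s := Num.max `|r| `|t| + 1.
have s0 : 0 < s by rewrite ltr_wpDl// le_max normr_ge0.
have rs : r < s by rewrite (le_lt_trans (ler_norm r))// ltr_pwDr// le_max lexx.
have ts : t < s by rewrite (le_lt_trans (ler_norm t))// ltr_pwDr// le_max lexx orbT.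
have Ns : - s < s by rewrite gtrN.
have dphi x : derivable phi x 1 by exact: (sphi 0%N x).
have cphi : continuous phi by move=> x; apply: differentiable_continuous; exact/derivable1_diffP.
rewrite (@Rint_supp _ s)//; last by move=> x sx; apply: tphi'; exact: lt_trans sx.
rewrite /Rintegral (continuous_FTC2 Ns (F := phi)).
- by rewrite !rphi ?subee// ?normrN gtr0_norm.
- by apply: continuous_subspaceT; exact: cphi'.
- split=> [x _||]; first exact: dphi.
  + by apply: cvg_at_right_filter; exact: cphi.
  + by apply: cvg_at_left_filter; exact: cphi.
- by [].
Qed.

Lemma loc_int_locally F : loc_int F -> locally_integrable setT F.
Proof.
move=> lF; split; [exact: loc_int_measurable|exact: openT|].
move=> K _ /[dup] cK /compact_bounded [M [_ HM]].
have KM : K `<=` `[- (M + 1), M + 1]%classic.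
  by move=> x Kx; rewrite itvNr_norm; apply: (HM (M + 1)) => //; rewrite ltrDl.
have mK : measurable K by exact: compact_measurable.
have /integrableP[_] : leb.-integrable K (EFin \o F).
  by apply: (@integrableS _ _ _ leb `[- (M + 1), M + 1]%classic).
by [].
Qed.

(** At a Lebesgue point, [F x] is the limit of averages over balls shrinking to [x], and each of
    these averages is [c]. *)
Lemma intvl_avg_ae F c : loc_int F ->
  (forall a b, a < b -> \int[leb]_(x in `]a, b[) F x = c * (b - a)) ->
  {ae leb, forall x, F x = c}.
Proof.
move=> lF Fc; have locF := loc_int_locally lF.
pose E (x : R) (n : nat) := ball x (@harmonic R n).
have hE x : nicely_shrinking x (E x).
  split; first by move=> n; exact: measurable_ball.
  exists (1, fun n => PosNum (@harmonic_gt0 R n)); split => //=.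
  - exact: cvg_harmonic.
  - by move=> n.
  - by move=> n; rewrite mul1e.
apply: (filterS _ (lebesgue_differentiation locF)) => [|x lx]; first exact: (ae_filter_ringOfSetsType leb).
have := nice_lebesgue_differentiation hE locF lx.
rewrite (_ : (fun n => _) = cst c%:E).
  by move=> /(cvg_unique _ (cvg_cst _)) => /(_ (@ereal_hausdorff R)) [].
apply/funext => n /=.
have h0 : 0 < @harmonic R n by exact: harmonic_gt0.
have ab : x - harmonic n < x + harmonic n by rewrite ltrBlDr -addrA ltrDl addr_gt0.
have := Fc _ _ ab; rewrite -ball_itv.
have iE : leb.-integrable (E x n) (EFin \o F).
  apply: (integrableS _ _ _ (loc_int_itv (x - harmonic n) (x + harmonic n) lF)) => //.
    exact: measurable_ball.
  rewrite /E ball_itv; exact: subset_itv_oo_cc.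
rewrite /Rintegral => h.
have fE : (\int[leb]_(y in E x n) (F y)%:E)%E \is a fin_num.
  by apply: (@integrable_fin_num _ _ _ leb) => //; exact: measurable_ball.
rewrite -[X in (_ * X)%E](fineK fE) /E h.
rewrite lebesgue_measure_ball ?ltW// inver.
have -> : x + harmonic n - (x - harmonic n) = harmonic n *+ 2 by rewrite mulr2n; ring.
by rewrite mulrn_eq0/= (gt_eqF h0) -EFinM mulrCA mulVf ?mulr1// mulrn_eq0/= gt_eqF.
Qed.

(** The combination [(\int psi) chi - (\int chi) psi] has zero integral, hence is the derivative of
    a test function. So the ratio of [\int F chi] to [\int chi] does not depend on [chi]. Letting
    bumps tend to the indicators of []a, b[] and of the reference interval []0, 1[] shows that [F]
    has the same average on every interval. *)
Theorem du_bois_reymond F : loc_int F ->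
  (forall phi, test_fun phi -> \int[leb]_x (F x * (phi^`())%classic x) = 0) ->
  exists c, {ae leb, forall x, F x = c}.
Proof.
move=> lF HF; have mF := loc_int_measurable lF.
have key chi psi r s : smooth chi -> supp_in r chi -> smooth psi -> supp_in s psi ->
    (\int[leb]_x psi x) * \int[leb]_x (F x * chi x) =
    (\int[leb]_x chi x) * \int[leb]_x (F x * psi x).
  move=> schi rchi spsi ssi.
  have cchi := smooth_continuous schi; have cpsi := smooth_continuous spsi.
  have ichi : leb.-integrable setT (EFin \o chi) by exact: supp_integrable rchi.
  have ipsi : leb.-integrable setT (EFin \o psi) by exact: supp_integrable ssi.
  set I := \int[leb]_x psi x; set J := \int[leb]_x chi x.
  pose h x := I * chi x + - J * psi x.
  have sh : smooth h.
    apply/smoothP => n; apply: CkD; apply: CkM; try exact: CkC.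
      by move/smoothP : schi.
    by move/smoothP : spsi.
  have hs : supp_in (Num.max r s) h.
    by move=> x; rewrite gt_max => /andP[/rchi h1 /ssi h2]; rewrite /h h1 h2 !mulr0 addr0.
  have h0 : \int[leb]_x h x = 0.
    rewrite RintegralD//; [|exact: intgZ..].
    by rewrite !RintegralZl// -/I -/J; ring.
  have iF g t (cg : continuous g) (tg : supp_in t g) := loc_int_mul_supp lF cg tg.
  have [phi tphi phiE] := antiderivative_test_fun sh hs h0.
  have := HF _ tphi; rewrite phiE /h.
  rewrite (_ : (fun x => _) = (fun x => I * (F x * chi x) + - J * (F x * psi x))); last first.
    by apply/funext => x; ring.
  have i1 := iF _ _ cchi rchi; have i2 := iF _ _ cpsi ssi.
  rewrite RintegralD//; [|exact: intgZ..].
  by rewrite !RintegralZl// mulNr => /eqP; rewrite subr_eq0 => /eqP.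
have loc1 : loc_int (fun=> 1 : R).
  move=> r; apply: (@intg_bounded _ _ _ _ _ _ _ 1) => //.
    by rewrite /= lebesgue_measure_itv/=; case: ifP => // _; rewrite -EFinB ltry.
  by move=> x _; rewrite normr1.
have B1 a b : a < b -> \int[leb]_x bump a b k x @[k --> \oo] --> b - a.
  move=> ab.
  have -> : b - a = \int[leb]_(_ in `]a, b[) 1.
    by rewrite Rintegral_cst//= lebesgue_measure_itv/= lte_fin ab -EFinB mul1r.
  have := Rint_bump_cvg ab (loc_int_itv a b loc1) (measurable_cst _).
  by under eq_fun do under eq_Rintegral do rewrite mul1r.
exists (\int[leb]_(x in `]0, 1[) F x).
apply: intvl_avg_ae => // a b ab.
have h1 := Rint_bump_cvg ab (loc_int_itv a b lF) mF.
have h2 := Rint_bump_cvg (@ltr01 R) (loc_int_itv 0 1 lF) mF.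
have h3 := B1 _ _ ab; have := B1 _ _ (@ltr01 R); rewrite subr0 => h4.
have l1 := cvgM h4 h1; have l2 := cvgM h3 h2.
rewrite -[LHS]mul1r [RHS]mulrC; apply: (cvg_unique _ (l1 _)); first exact: Rhausdorff.
apply: (cvg_trans _ (l2 _)); apply: near_eq_cvg; near=> k => /=.
by apply: key; try exact: smooth_bump; exact: bump_supp.
Unshelve. all: by end_near. Qed.

End du_bois_reymond.

(** * Weak compactness *)

Section ultrafilter.
Context {R : realType}.

(** The image of an ultrafilter is an ultrafilter, and a compact segment contains a limit of each of
    them. The same [U] serves uncountably many sequences simultaneously, without extraction. *)
Lemma ultra_cvg (I : Type) (U : set_system I) (s : I -> R) (C : R) : UltraFilter U ->
  (forall n, `|s n| <= C) -> exists2 l, s n @[n --> U] --> l & `|l| <= C.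
Proof.
move=> UU sC.
have UI : UltraFilter (s @ U).
  split; first by apply: fmap_proper_filter; exact: ultra_proper.
  move=> G PG sUG; apply/seteqP; split=> // A GA.
  have [//|UA] := @in_ultra_setVsetC _ U (s @^-1` A) UU.
  have /sUG GnA : (s @ U) (~` A) by [].
  have : G set0 by rewrite -(setICr A); exact: filterI.
  by move/filter_not_empty.
have := @segment_compact R (- C) C; rewrite compact_ultra => /(_ _ UI) [].
  have PU := @ultra_proper _ _ UU.
  by apply: (@filterE _ U) => n /=; rewrite in_itv/= -ler_norml.
move=> l [lC sl]; exists l => //.
by move: lC; rewrite /= in_itv/= -ler_norml.
Qed.

(** If the sequence leaves a neighbourhood of [l] infinitely often, the trace of [\oo] on those
    indices is a proper filter; an ultrafilter above it contradicts the hypothesis. *)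
Lemma cvg_ultraP (s : nat -> R) (l : R) :
  (forall V : set_system nat, UltraFilter V -> \oo `<=` V -> s n @[n --> V] --> l) ->
  s n @[n --> \oo] --> l.
Proof.
move=> H; apply: contrapT => nl.
have [A lA nA] : exists2 A, nbhs l A & ~ (\oo (s @^-1` A)).
  by apply: contrapT => h; apply: nl => A lA; apply: contrapT => nA; apply: h; exists A.
have PW : ProperFilter (within (~` (s @^-1` A)) \oo).
  apply: Build_ProperFilter_ex => B; rewrite /within /= => oB.
  apply: contrapT => /forallNP Bn; apply: nA.
  by apply: filterS oB => n /= h; apply: contrapT => h'; apply: (Bn n); apply: h.
have [V [UV WV]] := ultraFilterLemma PW.
have oV : \oo `<=` V by move=> B oB; apply: WV; apply: filterS oB => n Bn _; exact: Bn.
have V1 := H V UV oV A lA.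
have V2 : V (~` (s @^-1` A)) by apply: WV; exact: withinT.
have PV := @ultra_proper _ _ UV.
have : V set0 by rewrite -(setICr (s @^-1` A)); exact: filterI.
by move/filter_not_empty.
Qed.

End ultrafilter.

(** * Tail estimates from the power [p > 1] *)

Section powR_facts.
Context {R : realType}.
Implicit Types (p t y : R).

Lemma powR_split p y : 1 < p -> 0 <= y -> y `^ p = y * y `^ (p - 1).
Proof.
move=> p1 y0; have [->|yn] := eqVneq y 0.
  by rewrite mul0r powR0// gt_eqF// (lt_trans ltr01).
have pE : p = 1 + (p - 1) by ring.
by rewrite {1}pE (@powRD _ y 1 (p - 1)) ?yn ?implybT// powRr1.
Qed.

(** Above the level [t], the factor [y ^ (p - 1)] is at least [t ^ (p - 1)]. This is the source of
    the uniform integrability of families bounded in [L^p]. *)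
Lemma powR_tail p t y : 1 < p -> 0 < t -> t <= y -> y <= y `^ p / t `^ (p - 1).
Proof.
move=> p1 t0 ty; have y0 : 0 < y by exact: lt_le_trans ty.
rewrite ler_pdivlMr ?powR_gt0// (powR_split p1 (ltW y0)).
rewrite ler_wpM2l ?(ltW y0)//.
by apply: ge0_ler_powR; rewrite ?nnegrE ?subr_ge0 ?(ltW p1) ?(ltW t0) ?(ltW y0).
Qed.

Lemma powR_UI p t y : 1 < p -> 0 < t -> 0 <= y -> y <= t + y `^ p / t `^ (p - 1).
Proof.
move=> p1 t0 y0; have [ty|yt] := leP t y.
  by rewrite (le_trans (powR_tail p1 t0 ty))// lerDr ltW.
by rewrite (le_trans (ltW yt))// lerDl divr_ge0// powR_ge0.
Qed.

Lemma tail_small p B e : 1 < p -> 0 <= B -> 0 < e ->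
  exists2 t, 0 < t & forall t', t <= t' -> B / t' `^ (p - 1) <= e.
Proof.
(* The [+ 1] keeps [c] positive when [B = 0]; then [t] solves [t ^ (p - 1) = c >= B / e]. *)
move=> p1 B0 e0; pose c := B / e + 1.
have c0 : 0 < c by rewrite ltr_wpDl// divr_ge0// ltW.
have q0 : 0 < p - 1 by rewrite subr_gt0.
exists (c `^ (p - 1)^-1); first exact: powR_gt0.
move=> t' tt'; have t'0 : 0 < t' by rewrite (lt_le_trans _ tt')// powR_gt0.
have ct : c <= t' `^ (p - 1).
  have cE : c = (c `^ (p - 1)^-1) `^ (p - 1).
    by rewrite -powRrM mulVf ?powRr1 ?(ltW c0)// lt0r_neq0.
  rewrite [leLHS]cE.
  by apply: ge0_ler_powR; rewrite ?nnegrE ?powR_ge0 ?(ltW q0) ?(ltW t'0).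
rewrite ler_pdivrMr ?powR_gt0// mulrC -ler_pdivrMr//.
by apply: le_trans ct; rewrite lerDl.
Qed.

End powR_facts.

(** * Densities of absolutely continuous additive set functions *)

Section additive_density.
Context d (X : measurableType d) (R : realType).
Context (mu : {sigma_finite_measure set X -> \bar R}) (D : set X).
Hypothesis mD : measurable D.
Hypothesis muD : (mu D < +oo)%E.

(** Countable additivity comes from absolute continuity: the tails of a disjoint union decrease to
    the empty set inside [D], which has finite measure, so [nu] of the tails tends to zero. Then
    [nu] is a charge dominated by [mu]. *)
Lemma density_of_additive (nu : set X -> R) :
  (forall A B, measurable A -> measurable B -> A `&` B = set0 -> nu (A `|` B) = nu A + nu B) ->
  (forall e, 0 < e -> exists2 t, 0 < t &
     forall A, measurable A -> (mu (A `&` D) <= t%:E)%E -> `|nu A| <= e) ->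
  exists u : X -> R, [/\ measurable_fun setT u, mu.-integrable D (EFin \o u) &
    forall A, measurable A -> nu A = \int[mu]_(x in A) u x].
Proof.
move=> nuU nuc.
have nu0 : nu set0 = 0.
  have := nuU set0 set0 measurable0 measurable0 (setI0 _).
  by rewrite setU0 => /(canLR (addrK _)); rewrite subrr.
have nu_null A : measurable A -> mu (A `&` D) = 0%E -> nu A = 0.
  move=> mA A0; apply/eqP; rewrite -normr_le0; apply/ler_addgt0Pl => e e0.
  by rewrite addr0; have [t t0] := nuc e e0; apply; rewrite // A0 lee_fin ltW.
pose n0 := fun A => (nu A)%:E.
have n00 : n0 set0 = 0%E by rewrite /n0 nu0.
have nfin A : measurable A -> n0 A \is a fin_num by [].
have nsig : semi_sigma_additive n0.
  move=> F mF tF mUF.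
  rewrite /n0 (_ : (fun n => _) = (fun n => (\sum_(0 <= i < n) nu (F i))%:E)); last first.
    by apply/funext => n; rewrite sumEFin.
  apply: cvg_EFin; first by near=> n.
  pose tail n := \bigcup_(i in [set k | (n <= k)%N]) F i.
  have mtail n : measurable (tail n) by exact: bigcup_measurable.
  have split n : nu (\bigcup_i F i) = \sum_(0 <= i < n) nu (F i) + nu (tail n).
    elim: n => [|n IH].
      rewrite big_geq// add0r /tail; congr nu; apply: eq_bigcupl.
      by split.
    rewrite big_nat_recr//= IH -addrA; congr (_ + _).
    rewrite -nuU//.
      congr nu; apply/seteqP; split=> x.
        move=> [i /= ni Fx]; move: ni; rewrite leq_eqVlt => /orP[/eqP ->|ni]; [by left|right].
        by exists i.
      by move=> [Fx|[i /= ni Fx]]; [exists n => /=|exists i => //=; exact: ltnW].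
    apply/seteqP; split=> // x [Fnx [i /= ni Fix]].
    have /trivIsetP /(_ n i Logic.I Logic.I) := tF.
    rewrite ltn_eqF// => /(_ isT) h.
    by move: (conj Fnx Fix : (F n `&` F i) x); rewrite h.
  have tail0 : (mu (tail n `&` D) @[n --> \oo] --> 0)%E.
    have := @nonincreasing_cvg_mu _ X R mu (fun n => tail n `&` D).
    have -> : \bigcap_n (tail n `&` D) = set0.
      apply/seteqP; split=> // x h.
      have [[i _ Fix] _] := h 0%N Logic.I.
      have [[j /= ij Fjx] _] := h i.+1 Logic.I.
      have /trivIsetP /(_ i j Logic.I Logic.I) := tF.
      by rewrite ltn_eqF// => /(_ isT) h'; move: (conj Fix Fjx : (F i `&` F j) x); rewrite h'.
    rewrite measure0; apply.
    - by rewrite (le_lt_trans _ muD)// le_measure// inE//; exact: measurableI.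
    - by move=> i; exact: measurableI.
    - exact: measurable0.
    - move=> n m nm; apply/subsetPset => x [[i /= mi Fx] Dx]; split=> //.
      by exists i => //=; exact: leq_trans mi.
  apply/cvgrPdist_le => e e0.
  have [t t0 ht] := nuc e e0.
  have : \forall n \near \oo, (mu (tail n `&` D) <= t%:E)%E.
    move/fine_cvgP : tail0 => [fin /cvgrPdist_le /(_ t t0)].
    apply: filterS2 fin => n fin; rewrite sub0r normrN => h.
    by rewrite -(fineK fin) lee_fin (le_trans (ler_norm _)).
  apply: filterS => n hn; rewrite (split n) addrAC subrr add0r.
  exact: ht.
pose nc : {charge set X -> \bar R} := HB.pack n0 (isCharge.Build _ _ _ n0 n00 nfin nsig).
have dom : nc `<< mu.
  apply/null_content_dominatesP => A mA A0; rewrite /= /n0 nu_null//.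
  apply/eqP; rewrite -measure_le0 -A0 le_measure// inE//; exact: measurableI.
pose u := Radon_Nikodym nc mu.
have iu : mu.-integrable setT u by exact: Radon_Nikodym_integrable.
have uE x : (fine (u x))%:E = u x by rewrite fineK//; exact: Radon_Nikodym_fin_num.
have uE' : EFin \o (fine \o u) = u by exact/funext.
exists (fine \o u); split.
- by apply/measurable_EFinP; rewrite uE'; exact: (measurable_int mu).
- by apply: (integrableS measurableT) => //; rewrite uE'.
- move=> A mA; rewrite /Rintegral.
  under eq_integral do rewrite /= uE.
  by rewrite -Radon_Nikodym_integral.
Unshelve. all: by end_near. Qed.

End additive_density.

(** * Uniform approximation by sums of indicators *)

Section layer_cake.
Context {R : realType}.

Lemma sum_leq_nat (K m : nat) : (m <= K)%N -> (\sum_(j < K) (j < m)%N)%N = m.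
Proof.
elim: K m => [|K IH] m mK; first by rewrite big_ord0; case: m mK.
rewrite big_ord_recr /=; move: mK; rewrite leq_eqVlt => /orP[/eqP ->|].
  rewrite (eq_bigr (fun j : 'I_K => (j < K)%N : nat)); last first.
    by move=> j _; rewrite !(ltn_ord j) (ltn_trans (ltn_ord j)).
  by rewrite IH// ltnSn addn1.
by rewrite ltnS => mK; rewrite IH// ltnNge mK addn0.
Qed.

(** The sum counts the integers between [1] and [N y], so it is the integer part of [N y]; the bound
    on [K] only ensures that none is missed. *)
Lemma layer_cake_approx (N K : nat) (y : R) : 0 <= y -> (0 < N)%N -> N%:R * y <= K%:R ->
  `|y - N%:R^-1 * \sum_(j < K) ((j.+1%:R <= N%:R * y)%R : nat)%:R| <= N%:R^-1.
Proof.
move=> y0 N0 yK; have N0' : 0 < N%:R :> R by rewrite ltr0n.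
pose m := Num.truncn (N%:R * y).
have Ny0 : 0 <= N%:R * y by rewrite mulr_ge0// ltW.
have /andP[my ym] := truncn_itv Ny0.
have -> : \sum_(j < K) ((j.+1%:R <= N%:R * y)%R : nat)%:R = m%:R :> R.
  rewrite -(@sum_leq_nat K m); last first.
    by rewrite -ltnS truncn_lt_nat// (le_lt_trans yK)// ltr_nat.
  rewrite natr_sum; apply: eq_bigr => j _; congr (_%:R); congr nat_of_bool.
  by rewrite truncn_ge_nat.
have -> : y - N%:R^-1 * m%:R = N%:R^-1 * (N%:R * y - m%:R).
  by rewrite mulrBr mulKf ?gt_eqF.
rewrite normrM (@ger0_norm _ N%:R^-1) ?invr_ge0 ?(ltW N0')// ler_piMr ?invr_ge0 ?(ltW N0')//.
rewrite ger0_norm ?subr_ge0// lerBlDl ltW//.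
by rewrite -natr1 addrC in ym; rewrite addrC.
Qed.

End layer_cake.

Lemma cvg_unif_approx (R : realType) (I : Type) (F : set_system I) (s : I -> R) (l : R) :
  Filter F ->
  (forall e, 0 < e -> exists s' : I -> R, exists l' : R, [/\ s' n @[n --> F] --> l',
     forall n, `|s n - s' n| <= e & `|l - l'| <= e]) ->
  s n @[n --> F] --> l.
Proof.
move=> FF H; apply/cvgrPdist_le => e e0.
have e3 : 0 < e / 3 by rewrite divr_gt0.
have [s' [l' [sl' ss' ll']]] := H _ e3.
move/cvgrPdist_le : sl' => /(_ _ e3); apply: filterS => n h.
have -> : l - s n = (l - l') + (l' - s' n) - (s n - s' n) by ring.
rewrite (le_trans (ler_normB _ _))//.
have -> : e = e / 3 + e / 3 + e / 3 by field.
by rewrite lerD// (le_trans (ler_normD _ _))// lerD.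
Qed.

Lemma cvg_norm_le (R : realType) (I : Type) (F : set_system I) (s : I -> R) (l C : R) :
  ProperFilter F -> s n @[n --> F] --> l -> (forall n, `|s n| <= C) -> `|l| <= C.
Proof.
move=> PF sl sC; apply/ler_addgt0Pr => e e0.
have [n hn] : exists n, `|l - s n| <= e.
  by apply: (@filter_ex _ F); move/cvgrPdist_le : sl; exact.
have -> : l = s n + (l - s n) by ring.
by rewrite (le_trans (ler_normD _ _))// lerD.
Qed.

Lemma cvg_ub (R : realType) (I : Type) (F : set_system I) (s : I -> R) (l C : R) :
  ProperFilter F -> s n @[n --> F] --> l -> (forall n, s n <= C) -> l <= C.
Proof.
move=> PF sl sC; apply/ler_addgt0Pr => e e0.
have [n hn] : exists n, `|l - s n| <= e.
  by apply: (@filter_ex _ F); move/cvgrPdist_le : sl; exact.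
have -> : l = s n + (l - s n) by ring.
by rewrite lerD// (le_trans (ler_norm _)).
Qed.

(** * Weak sequential compactness on a finite measure space *)

Section weak_compactness.
Context d (X : measurableType d) (R : realType).
Context (mu : {sigma_finite_measure set X -> \bar R}) (D : set X).
Hypothesis mD : measurable D.
Hypothesis muD : (mu D < +oo)%E.
Notation intg f := (mu.-integrable D (EFin \o f)).
Notation "'II' f" := (\int[mu]_(x in D) f x) (at level 10).

Lemma intg_cst c : intg (fun=> c).
Proof. by apply: (@intg_bounded _ _ _ _ _ _ _ `|c|). Qed.

Definition bdd_meas (C : R) (g : X -> R) := measurable_fun setT g /\ forall x, `|g x| <= C.

Lemma bdd_meas_intgM C f g : intg f -> bdd_meas C g -> intg (fun x => f x * g x).
Proof. by move=> hf [mg gC]; apply: (@intgM _ _ _ _ _ _ _ _ C) => //; exact: measurable_funTS. Qed.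

Lemma norm_II_mul_le C f g : intg f -> bdd_meas C g ->
  `|II (fun x => f x * g x)| <= C * II (fun x => `|f x|).
Proof.
move=> hf gC; rewrite -RintegralZl//; last exact: intg_norm.
apply: norm_Rint_le => //.
- by apply: (@intg_meas _ _ _ mu); exact: (bdd_meas_intgM hf gC).
- exact/intgZ/intg_norm.
- by move=> x _; rewrite normrM mulrC ler_wpM2r//; case: gC.
Qed.

Definition bounded_meas g := exists C, bdd_meas C g.

(* From indicators to bounded test functions, through the layer-cake sums
   N^-1 * sum_j 1_{g >= j/N}, which are uniformly close to g. *)
Lemma cvg_indic_bdd (I : Type) (F : set_system I) (f : I -> X -> R) (u : X -> R) B C g :
  ProperFilter F -> 0 <= C -> (forall n, intg (f n)) -> intg u ->
  (forall n, II (fun x => `|f n x|) <= B) -> II (fun x => `|u x|) <= B ->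
  (forall A, measurable A -> \int[mu]_(x in A `&` D) f n x @[n --> F] --> \int[mu]_(x in A `&` D) u x) ->
  bdd_meas C g -> II (fun x => f n x * g x) @[n --> F] --> II (fun x => u x * g x).
Proof.
move=> PF C0 hf hu fB uB fu [mg gC].
have indE h A : measurable A -> \int[mu]_(x in A `&` D) h x = II (fun x => h x * \1_A x).
  move=> mA; rewrite Rintegral_mkcondl; apply: eq_Rintegral => x _.
  by rewrite patchE indicE; case: ifP; rewrite ?mulr1 ?mulr0.
have fuD : II (fun x => f n x) @[n --> F] --> II (fun x => u x).
  by have := fu setT measurableT; under eq_fun do rewrite setTI; rewrite setTI.
have B0 : 0 <= B by rewrite (le_trans _ uB)// Rintegral_ge0.
(* The admissible test functions form a vector space containing the indicators. The common bound [B]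
   on the [L^1] norms lets uniform approximation enlarge it. *)
pose W h := bounded_meas h /\ II (fun x => f n x * h x) @[n --> F] --> II (fun x => u x * h x).
have WD h k : W h -> W k -> W (fun x => h x + k x).
  move=> [[Ch [mh hC]] Wh] [[Ck [mk kC]] Wk]; split.
    exists (Ch + Ck); split; first exact: measurable_funD.
    by move=> x; rewrite (le_trans (ler_normD _ _))// lerD.
  have E v : intg v -> II (fun x => v x * (h x + k x)) = II (fun x => v x * h x) + II (fun x => v x * k x).
    move=> hv; rewrite -RintegralD//.
    - by apply: eq_Rintegral => x _; rewrite mulrDr.
    - by apply: (bdd_meas_intgM hv (conj mh hC)).
    - by apply: (bdd_meas_intgM hv (conj mk kC)).
  by rewrite E//; under eq_fun do rewrite E//; exact: cvgD.
have WZ h c : W h -> W (fun x => c * h x).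
  move=> [[Ch [mh hC]] Wh]; split.
    exists (`|c| * Ch); split; first exact: measurable_funM.
    by move=> x; rewrite normrM ler_wpM2l.
  have E v : intg v -> II (fun x => v x * (c * h x)) = c * II (fun x => v x * h x).
    move=> hv; rewrite -RintegralZl//; last exact: (bdd_meas_intgM hv (conj mh hC)).
    by apply: eq_Rintegral => x _; rewrite mulrCA.
  by rewrite E//; under eq_fun do rewrite E//; apply: cvgM => //; exact: cvg_cst.
have WI A : measurable A -> W (fun x => \1_A x).
  move=> mA; split.
    by exists 1; split => [|x]; [exact: measurable_indic|rewrite indicE; case: (x \in A); rewrite ?normr1 ?normr0].
  by rewrite -indE//; under eq_fun do rewrite -indE//; exact: fu.
have WS (N K : nat) (A : nat -> set X) : (forall j, measurable (A j)) ->
    W (fun x => N%:R^-1 * \sum_(j < K) \1_(A j) x).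
  move=> mA; apply: (WZ); elim: K => [|K IH].
    under eq_fun do rewrite big_ord0.
    have := WZ _ 0 (WI _ measurable0); congr W; apply/funext => x; by rewrite mul0r.
  by under eq_fun do rewrite big_ord_recr; apply: (WD) => //; exact: WI.
(* The layer-cake sums approximate nonnegative functions, hence the shift by the bound of [g]; the
   constant is subtracted at the end. *)
pose h x := g x + C.
have h0 x : 0 <= h x by rewrite -lerBlDr sub0r; have /lerNnormlW := gC x.
have h2 x : h x <= 2 * C by rewrite mulr_natl mulr2n lerD2r (le_trans (ler_norm _)).
have bh : bounded_meas h.
  exists (2 * C); split; first exact: measurable_funD.
  by move=> x; rewrite ger0_norm.
have Wh : W h.
  split=> //; apply: cvg_unif_approx => e e0.
  pose N := (Num.truncn (B / e)).+1; pose K := (Num.truncn (N%:R * (2 * C))).+1.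
  have NB : N%:R^-1 * B <= e.
    rewrite mulrC ler_pdivrMr ?ltr0n// mulrC -ler_pdivrMr// ltW//.
    exact: truncnS_gt.
  pose A j := [set x | j.+1%:R <= N%:R * h x].
  have mA j : measurable (A j).
    have := @measurable_fun_le _ X R setT (fun=> j.+1%:R) (fun x => N%:R * h x) measurableT.
    rewrite setTI; apply => //.
    by case: bh => ? [mh _]; exact: measurable_funM.
  have [[Ck [mk kC]] Wk] := WS N K A mA.
  set k := (fun x => _) in mk kC Wk.
  have hk x : `|h x - k x| <= N%:R^-1.
    have := @layer_cake_approx R N K (h x) (h0 x) isT.
    rewrite /k; under [in X in _ -> X]eq_bigr do rewrite indicE mem_setE/=.
    apply; rewrite (@le_trans _ _ (N%:R * (2 * C))) ?ler_wpM2l// ltW//.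
    exact: truncnS_gt.
  case: bh => Ch [mh hC].
  have E v : intg v -> II (fun x => `|v x|) <= B ->
      `|II (fun x => v x * h x) - II (fun x => v x * k x)| <= e.
    move=> hv vB; rewrite -RintegralB//; last 2 first.
    - exact: (bdd_meas_intgM hv (conj mh hC)).
    - exact: (bdd_meas_intgM hv (conj mk kC)).
    have -> : II (fun x => v x * h x - v x * k x) = II (fun x => v x * (h x - k x)).
      by apply: eq_Rintegral => x _; rewrite mulrBr.
    apply: (le_trans (@norm_II_mul_le N%:R^-1 _ _ hv _)).
      by split=> //; exact: measurable_funB.
    by rewrite (le_trans _ NB)// ler_wpM2l.
  exists (fun n => II (fun x => f n x * k x)), (II (fun x => u x * k x)); split=> //.
  - by move=> n; exact: E.
  - exact: E.
have [_] := WD _ _ Wh (WZ _ (- C) (WI _ measurableT)).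
have gE x : h x + - C * \1_setT x = g x by rewrite indicT/= mulr1 addrK.
by under eq_fun do under eq_Rintegral do rewrite gE; under eq_Rintegral do rewrite gE.
Qed.

Section Lp_bounded.
Variables (p B : R).
Hypothesis p1 : 1 < p.

Definition Lp_le (f : X -> R) :=
  [/\ measurable_fun setT f, intg (fun x => `|f x| `^ p) & II (fun x => `|f x| `^ p) <= B].

Lemma Lp_le_B0 f : Lp_le f -> 0 <= B.
Proof. by move=> [_ _]; apply: le_trans; apply: Rintegral_ge0 => x _; exact: powR_ge0. Qed.

Lemma Lp_le_intg f : Lp_le f -> intg f.
Proof.
move=> [mf ifp _]; apply: (@intg_le _ _ _ _ _ _ (fun x => 1 + `|f x| `^ p)) => //.
- exact: measurable_funTS.
- by apply: intgD => //; exact: intg_cst.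
- by move=> x _; have := powR_UI p1 ltr01 (normr_ge0 (f x)); rewrite powR1 divr1.
Qed.

(** Uniform integrability, by integrating [powR_UI]: the bound does not depend on [f], and choosing
    first [t] large and then [A] small makes it arbitrarily small. *)
Lemma Lp_le_set f A t : Lp_le f -> measurable A -> 0 < t ->
  \int[mu]_(x in A `&` D) `|f x| <= t * fine (mu (A `&` D)) + B / t `^ (p - 1).
Proof.
move=> hf mA t0; have [mf ifp fB] := hf; have mAD : measurable (A `&` D) by exact: measurableI.
have sAD : A `&` D `<=` D by move=> x [].
have ifpA : mu.-integrable (A `&` D) (EFin \o (fun x => `|f x| `^ p)) by exact: (integrableS mD).
have icA : mu.-integrable (A `&` D) (EFin \o (fun=> t)) by apply: (integrableS mD) => //; exact: intg_cst.
have tp0 : 0 <= (t `^ (p - 1))^-1 by rewrite invr_ge0 powR_ge0.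
apply: (@le_trans _ _ (\int[mu]_(x in A `&` D) (t + (t `^ (p - 1))^-1 * `|f x| `^ p))).
  apply: le_Rintegral => //.
  - by apply: (@intg_norm _ _ _ mu) => //; apply: (integrableS mD) => //; exact: Lp_le_intg.
  - by apply: (@intgD _ _ _ mu) => //; exact: intgZ.
  - by move=> x _; rewrite [_^-1 * _]mulrC; exact: powR_UI.
rewrite RintegralD//; last exact: intgZ.
rewrite Rintegral_cst// RintegralZl// lerD2l mulrC ler_wpM2r// (le_trans _ fB)//.
rewrite Rintegral_mkcondl; apply: le_Rintegral => //.
- rewrite -restrict_EFin; apply/integrable_restrict => //.
  by rewrite setIC.
- by move=> x _; rewrite patchE; case: ifP => // _; exact: powR_ge0.
Qed.

Lemma Lp_le_norm f : Lp_le f -> II (fun x => `|f x|) <= fine (mu D) + B.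
Proof.
by move=> /Lp_le_set /(_ measurableT ltr01); rewrite setTI mul1r powR1 divr1.
Qed.

Lemma ultra_weak (I : Type) (U : set_system I) (f : I -> X -> R) : UltraFilter U ->
  (forall n, Lp_le (f n)) ->
  exists u : X -> R, [/\ measurable_fun setT u, intg u &
    forall C g, 0 <= C -> bdd_meas C g -> II (fun x => f n x * g x) @[n --> U] --> II (fun x => u x * g x)].
Proof.
move=> UU hf; have PU := @ultra_proper _ _ UU.
have [n0 _] : exists n : I, True by have [n _] := @filter_ex _ U PU _ (@filterT _ U _); exists n.
have B0 := Lp_le_B0 (hf n0).
have ifA A n : measurable A -> mu.-integrable (A `&` D) (EFin \o f n).
  by move=> mA; apply: (integrableS mD) (Lp_le_intg (hf n)) => //; exact: measurableI.
have bdA A t n : measurable A -> 0 < t ->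
    `|\int[mu]_(x in A `&` D) f n x| <= t * fine (mu (A `&` D)) + B / t `^ (p - 1).
  move=> mA t0; apply: le_trans (Lp_le_set (hf n) mA t0).
  by apply: le_normr_Rintegral; [exact: measurableI|exact: ifA].
have nu_ex : forall A : set X, exists l : R, measurable A ->
    \int[mu]_(x in A `&` D) f n x @[n --> U] --> l.
  move=> A; have [mA|nmA] := pselect (measurable A); last by exists 0.
  by have [l hl _] := ultra_cvg UU (fun n => bdA A 1 n mA ltr01); exists l.
have [nu nuP] := choice nu_ex.
have nu_le A t : measurable A -> 0 < t -> `|nu A| <= t * fine (mu (A `&` D)) + B / t `^ (p - 1).
  by move=> mA t0; apply: (cvg_norm_le PU (nuP _ mA)) => n; exact: bdA.
have nuU A A' : measurable A -> measurable A' -> A `&` A' = set0 -> nu (A `|` A') = nu A + nu A'.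
  move=> mA mA' AA'; have mU := measurableU _ _ mA mA'.
  apply: (cvg_unique _ (nuP _ mU)); first exact: Rhausdorff.
  under eq_fun do rewrite setIUl.
  rewrite (_ : (fun n => _) = (fun n => \int[mu]_(x in A `&` D) f n x + \int[mu]_(x in A' `&` D) f n x)).
    by apply: cvgD; exact: nuP.
  apply/funext => n; apply: Rintegral_setU; try exact: measurableI.
    by rewrite -setIUl; exact: ifA.
  by apply/disj_setPS => x [[Ax _] [A'x _]]; rewrite -AA'.
(* Half of [e] pays for the tail [B / t ^ (p - 1)], which fixes [t]; the other half pays for
   [t * mu (A]&[D)]. *)
have [] := density_of_additive mD muD nuU.
  move=> e e0; have e2 : 0 < e / 2 by rewrite divr_gt0.
  have [t t0 ht] := tail_small p1 B0 e2.
  exists (e / 2 / t); first by rewrite divr_gt0.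
  move=> A mA muA; rewrite (le_trans (nu_le A t mA t0))// [leRHS](splitr e) lerD ?ht//.
  rewrite mulrC -ler_pdivlMr// -lee_fin fineK// ge0_fin_numE//.
  by rewrite (le_lt_trans muA)// ltry.
move=> u [mu_ iu uE]; exists u; split=> // C g C0 gC.
(* The norm of [u] is put into the maximum directly, so that no lower semicontinuity of the norm is
   invoked. *)
apply: (@cvg_indic_bdd _ _ _ _ (Num.max (fine (mu D) + B) (II (fun x => `|u x|))) C) => //.
- by move=> n; exact: Lp_le_intg.
- by move=> n; rewrite le_max Lp_le_norm.
- by rewrite le_max lexx orbT.
- move=> A mA; rewrite -uE; last exact: measurableI.
  by have := nuP _ (measurableI _ _ mA mD); rewrite -setIA setIid.
Qed.

(** Projection onto [[-k, k]]. It leaves values already in that interval alone, so it turns an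
    almost everywhere bound into one at every point by a change on a null set. *)
Definition clip (k y : R) := Num.max (- k) (Num.min y k).

Lemma clip_le k y : 0 <= k -> `|clip k y| <= k.
Proof. by move=> k0; rewrite ler_norml /clip le_max lexx/= ge_max ge_min lexx orbT andbT ge0_cp. Qed.

Lemma clip_id k y : `|y| <= k -> clip k y = y.
Proof. by rewrite ler_norml /clip => /andP[h1 h2]; rewrite min_l// max_r. Qed.

Lemma measurable_clip k (f : X -> R) : measurable_fun setT f -> measurable_fun setT (fun x => clip k (f x)).
Proof. by move=> mf; apply: measurable_maxr => //; exact: measurable_minr. Qed.

(** Testing against the indicator of [k <= u] shows that the positive part of [u - k] has
    nonpositive integral. *)
Lemma weak_limit_le (I : Type) (U : set_system I) (f : I -> X -> R) u k : ProperFilter U -> 0 <= k ->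
  (forall n, measurable_fun setT (f n)) -> (forall n x, `|f n x| <= k) ->
  measurable_fun setT u -> intg u ->
  (forall C g, 0 <= C -> bdd_meas C g -> II (fun x => f n x * g x) @[n --> U] --> II (fun x => u x * g x)) ->
  {ae mu, forall x, D x -> u x <= k}.
Proof.
move=> PU k0 mf fk mu_ iu fu; pose A := [set x | k <= u x].
have mA : measurable A.
  have := @measurable_fun_le _ X R setT (fun=> k) u measurableT.
  by rewrite setTI; apply.
have bA : bdd_meas 1 (fun x => \1_A x).
  by split=> [|x]; [exact: measurable_indic|rewrite indicE; case: (x \in A); rewrite ?normr1 ?normr0].
have ifn n : intg (f n) by apply: (@intg_bounded _ _ _ _ _ _ _ k) => //; exact: measurable_funTS.
have ikA : intg (fun x => k * \1_A x) by exact: (bdd_meas_intgM (intg_cst k) bA).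
have iuA : intg (fun x => u x * \1_A x) by exact: (bdd_meas_intgM iu bA).
have le1 : II (fun x => u x * \1_A x) <= II (fun x => k * \1_A x).
  apply: (cvg_ub PU (fu 1 _ ler01 bA)) => n.
  apply: le_Rintegral => //; first exact: (bdd_meas_intgM (ifn n) bA).
  by move=> x _; rewrite indicE ler_wpM2r// (le_trans (ler_norm _)).
have H : {ae mu, forall x, D x -> u x * \1_A x - k * \1_A x = 0}.
  apply: Rint0_ae => //.
  - exact: intgB.
  - move=> x Dx; rewrite -mulrBl indicE; have [|] := boolP (x \in A); last by rewrite mulr0.
    by rewrite inE /A/= mulr1 subr_ge0.
  - by rewrite RintegralB// subr_le0.
apply: filterS H => x h Dx; rewrite leNgt; apply/negP => ku.
have := h Dx; rewrite -mulrBl indicE mem_set ?mulr1; last exact: ltW.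
by move/eqP; rewrite subr_eq0 => /eqP uk; move: ku; rewrite uk ltxx.
Qed.

Lemma ultra_weak_bounded (I : Type) (U : set_system I) (f : I -> X -> R) k : UltraFilter U -> 0 <= k ->
  (forall n, Lp_le (f n)) -> (forall n x, `|f n x| <= k) ->
  exists u : X -> R, bdd_meas k u /\
    forall C g, 0 <= C -> bdd_meas C g -> II (fun x => f n x * g x) @[n --> U] --> II (fun x => u x * g x).
Proof.
move=> UU k0 hf fk; have PU := @ultra_proper _ _ UU.
have [u [mu_ iu fu]] := ultra_weak UU hf.
have mf n : measurable_fun setT (f n) by case: (hf n).
have u1 := weak_limit_le PU k0 mf fk mu_ iu fu.
have u2 : {ae mu, forall x, D x -> - u x <= k}.
  apply: (@weak_limit_le _ U (fun n x => - f n x)) => //.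
  - by move=> n; exact: measurableT_comp.
  - by move=> n x; rewrite normrN.
  - exact: measurableT_comp.
  - by rewrite (_ : (fun x => - u x) = (fun x => -1 * u x)); [exact: intgZ|apply/funext => x; rewrite mulN1r].
  - move=> C g C0 gC.
    have E v : intg v -> II (fun x => - v x * g x) = - II (fun x => v x * g x).
      move=> hv; rewrite -mulN1r -RintegralZl//; last exact: (bdd_meas_intgM hv gC).
      by apply: eq_Rintegral => x _; rewrite mulN1r mulNr.
    rewrite E//; under eq_fun do rewrite E ?(Lp_le_intg (hf _))//.
    by apply: cvgN; exact: fu C0 gC.
exists (fun x => clip k (u x)); split.
  by split=> [|x]; [exact: measurable_clip|exact: clip_le].
move=> C g C0 gC; rewrite (_ : II (fun x => clip k (u x) * g x) = II (fun x => u x * g x)).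
  exact: fu C0 gC.
case: gC => mg gC; apply: Rint_ae => //.
- by apply: measurable_funTS; apply: measurable_funM => //; exact: measurable_clip.
- by apply: measurable_funTS; exact: measurable_funM.
- apply: filterS2 u1 u2 => x h1 h2 Dx; rewrite clip_id// ler_norml h1// andbT.
  by rewrite lerNl h2.
Qed.

(** Large values are replaced by [0], not by the threshold, so that [trunc k f] is at each point
    either [f] or [0]; in particular [f] times an odd power of its truncation only sees the
    truncation. The level [k.+1] is positive, as [powR_tail] requires. *)
Definition trunc (k : nat) (f : X -> R) (x : X) := if `|f x| <= k.+1%:R then f x else 0.

Lemma trunc_le k f x : `|trunc k f x| <= k.+1%:R.
Proof. by rewrite /trunc; case: ifP => // _; rewrite normr0. Qed.

Lemma trunc_norm k f x : `|trunc k f x| <= `|f x|.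
Proof. by rewrite /trunc; case: ifP => // _; rewrite normr0. Qed.

Lemma measurable_trunc k (f : X -> R) : measurable_fun setT f -> measurable_fun setT (trunc k f).
Proof.
move=> mf; apply: measurable_fun_ifT => //.
by apply: measurable_fun_ler => //; exact: measurableT_comp.
Qed.

Lemma Lp_le_trunc k f : Lp_le f -> Lp_le (trunc k f).
Proof.
move=> [mf ifp fB]; have mt := measurable_trunc k mf.
have le1 x : `|trunc k f x| `^ p <= `|f x| `^ p.
  by apply: ge0_ler_powR; rewrite ?nnegrE ?trunc_norm// ltW// (lt_trans ltr01).
have it : intg (fun x => `|trunc k f x| `^ p).
  apply: (@intg_le _ _ _ mu D mD (fun x => `|f x| `^ p)) => //.
    apply: measurable_funTS; apply: (measurableT_comp (measurable_powR p)).
    exact: measurableT_comp.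
  by move=> x _; rewrite ger0_norm ?powR_ge0.
split; [exact: mt|exact: it|apply: le_trans fB].
by apply: le_Rintegral => // x _; exact: le1.
Qed.

Lemma trunc_tail k C f g : Lp_le f -> 0 <= C -> bdd_meas C g ->
  `|II (fun x => f x * g x) - II (fun x => trunc k f x * g x)| <= C * (B / k.+1%:R `^ (p - 1)).
Proof.
move=> hf C0 gC; have [mf ifp fB] := hf; have [mg gC'] := gC.
have iF := Lp_le_intg hf; have iT := Lp_le_intg (Lp_le_trunc k hf).
rewrite -RintegralB//; last 2 first.
- exact: (bdd_meas_intgM iF gC).
- exact: (bdd_meas_intgM iT gC).
have -> : C * (B / k.+1%:R `^ (p - 1)) = C / k.+1%:R `^ (p - 1) * B by rewrite mulrA mulrAC.
apply: (@le_trans _ _ (C / k.+1%:R `^ (p - 1) * II (fun x => `|f x| `^ p))); last first.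
  by rewrite ler_wpM2l// divr_ge0 ?powR_ge0.
rewrite -RintegralZl//; apply: norm_Rint_le => //.
- apply: (@intg_meas _ _ _ mu); apply: (@intgB _ _ _ mu) => //.
    exact: (bdd_meas_intgM iF gC).
  exact: (bdd_meas_intgM iT gC).
- exact: intgZ.
- move=> x _; rewrite -mulrBl /trunc; case: ifPn => [_|].
    by rewrite subrr mul0r normr0 mulr_ge0 ?powR_ge0// divr_ge0 ?powR_ge0.
  rewrite -ltNge => kf; rewrite subr0 normrM.
  have /ltW kf' := kf; have := powR_tail p1 (ltr0Sn R k) kf'.
  move=> h; rewrite [leRHS]mulrAC -[C * _ * _]mulrA mulrC ler_pM//.
Qed.

(* The truncations pair with each other along the subsequence; Hilbert space
   orthogonality of u^k - v^k to every f_m^k, hence to the weak limits u^k and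
   v^k themselves, then forces all cluster points to agree. *)
Theorem weak_subsequence (f : nat -> X -> R) : (forall n, Lp_le (f n)) ->
  exists (s : nat -> nat) (u : X -> R), [/\ forall j, (j <= s j)%N,
    measurable_fun setT u, intg u &
    forall C g, 0 <= C -> bdd_meas C g ->
      II (fun x => f (s j) x * g x) @[j --> \oo] --> II (fun x => u x * g x)].
Proof.
move=> hf.
have [U [UU oU]] := ultraFilterLemma (@eventually_filter).
have PU := @ultra_proper _ _ UU.
have B0 := Lp_le_B0 (hf 0%N).
have [u [mu_ iu fu]] := ultra_weak UU hf.
(* Truncation is not weakly continuous: [uk k] is the weak limit of the truncations and need not be
   a truncation of [u]. *)
have huk k := ultra_weak_bounded UU (ler0n R k.+1) (fun n => Lp_le_trunc k (hf n)) (fun n => trunc_le k (f n)).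
have [uk ukP] := choice huk.
have bt k n : bdd_meas k.+1%:R (trunc k (f n)).
  by split=> [|x]; [apply: measurable_trunc; case: (hf n)|exact: trunc_le].
pose a k m n := II (fun x => trunc k (f n) x * trunc k (f m) x).
pose L k m := II (fun x => uk k x * trunc k (f m) x).
have aL k m : a k m n @[n --> U] --> L k m.
  by case: (ukP k) => _ h; exact: (h _ _ (ler0n R k.+1) (bt k m)).
(* Stage [j] imposes only the finitely many conditions with [k, m <= j]; each holds on a member of
   [U], and so does [j <= n], hence some index meets all of them. *)
have s_ex (j : nat) : exists n, (j <= n)%N /\
    forall k m, (k <= j)%N -> (m <= j)%N -> `|L k m - a k m n| <= @harmonic R j.
  apply: (@filter_ex _ U); apply: filterI.
    by apply: oU; exact: nbhs_infty_ge.
  have : U [set n | forall km : 'I_j.+1 * 'I_j.+1, `|L km.1 km.2 - a km.1 km.2 n| <= @harmonic R j].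
    apply: filter_forall => -[k m] /=.
    by have /cvgrPdist_le := aL k m; apply; exact: harmonic_gt0.
  apply: filterS => n h k m kj mj.
  by have := h (Ordinal (kj : (k < j.+1)%N), Ordinal (mj : (m < j.+1)%N)).
have [s sP] := choice s_ex.
exists s, u; split=> //; first by move=> j; case: (sP j).
have asL k m : a k m (s j) @[j --> \oo] --> L k m.
  apply/cvgrPdist_le => e e0; have /cvgrPdist_le /(_ e e0) := @cvg_harmonic R.
  apply: filter_app; near=> j => h; case: (sP j) => _ /(_ k m) h'.
  apply: le_trans (h' _ _) _; [near: j; exact: nbhs_infty_ge..|].
  by rewrite sub0r normrN in h; rewrite (le_trans (ler_norm _)).
(* It remains to compare [u] with the weak limit [v] of the subsequence along an arbitrary
   ultrafilter [V] finer than [\oo]. *)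
move=> C g C0 gC; apply: cvg_ultraP => V UV oV; have PV := @ultra_proper _ _ UV.
have [v [mv iv fv]] := ultra_weak UV (fun j => hf (s j)).
suff -> : II (fun x => u x * g x) = II (fun x => v x * g x) by exact: fv C0 gC.
have uk_le k : `|II (fun x => u x * g x) - II (fun x => uk k x * g x)| <= C * (B / k.+1%:R `^ (p - 1)).
  have [_ h] := ukP k.
  apply: (cvg_norm_le PU (cvgB (fu C g C0 gC) (h C g C0 gC))) => n.
  exact: trunc_tail.
have key k : `|II (fun x => u x * g x) - II (fun x => v x * g x)| <= 2 * C * (B / k.+1%:R `^ (p - 1)).
  have [vk [bvk vkP]] := ultra_weak_bounded UV (ler0n R k.+1)
    (fun n => Lp_le_trunc k (hf (s n))) (fun n => trunc_le k (f (s n))).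
  have [buk ukP'] := ukP k.
  have iuk : intg (uk k).
    by case: buk => m1 b1; apply: (@intg_bounded _ _ _ _ _ _ _ k.+1%:R) => //; exact: measurable_funTS.
  have ivk : intg vk.
    by case: bvk => m1 b1; apply: (@intg_bounded _ _ _ _ _ _ _ k.+1%:R) => //; exact: measurable_funTS.
  pose h x := uk k x - vk x.
  have bh : bdd_meas (k.+1%:R + k.+1%:R) h.
    case: buk bvk => m1 b1 [m2 b2]; split; first exact: measurable_funB.
    by move=> x; rewrite (le_trans (ler_normB _ _))// lerD.
  have hC0 : 0 <= k.+1%:R + k.+1%:R :> R by rewrite addr_ge0.
  have hB w Cw : bdd_meas Cw w ->
      II (fun x => w x * h x) = II (fun x => uk k x * w x) - II (fun x => vk x * w x).
    move=> bw; rewrite -RintegralB; [|by []|exact: (bdd_meas_intgM iuk bw)|exact: (bdd_meas_intgM ivk bw)].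
    by apply: eq_Rintegral => x _; rewrite /h; ring.
  (* Both pairings equal [L k m]: the one with [uk k] by definition, the one with [vk] because
     [a k m (s j)] converges to [L k m] as [j] grows, hence also along [V]. *)
  have h0 m : II (fun x => trunc k (f m) x * h x) = 0.
    rewrite (hB _ _ (bt k m)); apply/eqP; rewrite subr_eq0; apply/eqP.
    have c1 := vkP _ _ (ler0n R k.+1) (bt k m).
    apply: (cvg_unique _ _ c1); first exact: Rhausdorff.
    by move=> A /(asL k m); exact: oV.
  have hu : II (fun x => uk k x * h x) = 0.
    apply: (cvg_unique _ (ukP' _ _ hC0 bh)); first exact: Rhausdorff.
    rewrite (_ : (fun n => _) = cst 0); first exact: cvg_cst.
    by apply/funext => n; exact: h0.
  have hv : II (fun x => vk x * h x) = 0.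
    apply: (cvg_unique _ (vkP _ _ hC0 bh)); first exact: Rhausdorff.
    rewrite (_ : (fun n => _) = cst 0); first exact: cvg_cst.
    by apply/funext => n; exact: h0.
  have hh : {ae mu, forall x, D x -> h x * h x = 0}.
    apply: Rint0_ae => //.
    - apply: (bdd_meas_intgM _ bh); exact: intgB.
    - by move=> x _; rewrite -expr2 sqr_ge0.
    - rewrite (_ : II (fun x => h x * h x) = II (fun x => uk k x * h x) - II (fun x => vk x * h x)).
        by rewrite hu hv subrr.
      rewrite -RintegralB; [|by []|exact: (bdd_meas_intgM iuk bh)|exact: (bdd_meas_intgM ivk bh)].
      by apply: eq_Rintegral => x _; rewrite -mulrBl.
  have E : II (fun x => uk k x * g x) = II (fun x => vk x * g x).
    case: gC => mg _; case: buk bvk => m1 _ [m2 _].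
    apply: Rint_ae => //; try by apply: measurable_funTS; exact: measurable_funM.
    apply: filterS hh => x hx Dx; have := hx Dx => /eqP.
    by rewrite mulf_eq0 orbb /h subr_eq0 => /eqP ->.
  have vk_le : `|II (fun x => v x * g x) - II (fun x => vk x * g x)| <= C * (B / k.+1%:R `^ (p - 1)).
    apply: (cvg_norm_le PV (cvgB (fv C g C0 gC) (vkP C g C0 gC))) => n.
    exact: trunc_tail.
  have -> : II (fun x => u x * g x) - II (fun x => v x * g x) =
     (II (fun x => u x * g x) - II (fun x => uk k x * g x)) -
     (II (fun x => v x * g x) - II (fun x => vk x * g x)) by rewrite E; ring.
  rewrite (le_trans (ler_normB _ _))//.
  by rewrite mulrDl mul1r mulrDl lerD.
apply/eqP; rewrite -subr_eq0 -normr_le0; apply/ler_addgt0Pl => e e0; rewrite addr0.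
have CB0 : 0 <= 2 * C * B by rewrite mulr_ge0// mulr_ge0.
have [t t0 ht] := tail_small p1 CB0 e0.
(* The truncation level is [(Num.truncn t).+1], which exceeds the threshold [t] given by
   [tail_small]. *)
apply: le_trans (key (Num.truncn t)) _; rewrite mulrA; apply: ht.
by rewrite ltW// truncnS_gt.
Unshelve. all: by end_near. Qed.

End Lp_bounded.

End weak_compactness.

(** * First order expansion of harmonic means *)

Section expansion.
Context d (X : measurableType d) (R : realType).
Context (mu : {sigma_finite_measure set X -> \bar R}) (D : set X).
Hypothesis mD : measurable D.
Hypothesis muD1 : mu D = 1%E.
Notation intg f := (mu.-integrable D (EFin \o f)).
Notation "'II' f" := (\int[mu]_(x in D) f x) (at level 10).
Variables (p M alpha beta Cc : R) (f : nat -> X -> R) (u : X -> R) (m : nat -> R).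
Variables (a c : X -> R).
Hypothesis p1 : 1 < p.
Hypothesis fLp : forall n, Lp_le mu D p 1 (f n).
Hypothesis mu_ : measurable_fun setT u.
Hypothesis iu : intg u.
Hypothesis fu : forall C g, 0 <= C -> bdd_meas C g ->
  II (fun x => f n x * g x) @[n --> \oo] --> II (fun x => u x * g x).
Hypothesis m_ge0 : forall n, 0 <= m n.
Hypothesis m_cvg0 : m n @[n --> \oo] --> 0.
Let b n x := m n * f n x.
Hypothesis M0 : 0 <= M.
Hypothesis bM : forall n x, `|b n x| <= M.
Hypothesis alpha0 : 0 < alpha.
Hypothesis ma : measurable_fun setT a.
Hypothesis mc : measurable_fun setT c.
Hypothesis a_itv : forall x, alpha <= a x <= beta.
Hypothesis c_le : forall x, `|c x| <= Cc.
Let A n x := a x + b n x * c x.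
Hypothesis A_itv : forall n x, alpha <= A n x <= beta.

(* The test functions to which weak convergence against bounded functions extends. *)
Definition tight (phi : X -> R) := [/\ measurable_fun setT phi, intg phi,
  forall n, intg (fun x => f n x * phi x), intg (fun x => u x * phi x) &
  forall e, 0 < e -> exists K : R, [/\ 0 <= K,
    forall n, II (fun x => `|f n x * phi x| * (K < `|phi x|)%R%:R) <= e &
    II (fun x => `|u x * phi x| * (K < `|phi x|)%R%:R) <= e]].

Let muD : (mu D < +oo)%E. Proof. by rewrite muD1 ltry. Qed.

Let mf n : measurable_fun setT (f n). Proof. by case: (fLp n). Qed.

Let if_ n : intg (f n). Proof. by apply: (@Lp_le_intg _ _ _ mu D mD muD _ _ p1 _ (fLp n)). Qed.

Let Cc0 : 0 <= Cc.
Proof.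
have [x _] : D !=set0.
  by apply/set0P/eqP => D0; move: muD1; rewrite D0 measure0 => /esym/eqP; rewrite onee_eq0.
exact: le_trans (c_le x).
Qed.

Let mA n : measurable_fun setT (A n).
Proof. by apply: measurable_funD => //; apply: measurable_funM => //; exact: measurable_funM. Qed.

Let a_gt0 x : 0 < a x. Proof. by have /andP[/(lt_le_trans alpha0)] := a_itv x. Qed.
Let A_gt0 n x : 0 < A n x. Proof. by have /andP[/(lt_le_trans alpha0)] := A_itv n x. Qed.

Let inv_le y : alpha <= y -> `|y^-1| <= alpha^-1.
Proof.
move=> ay; have y0 := lt_le_trans alpha0 ay.
by rewrite ger0_norm ?invr_ge0 ?(ltW y0)// lef_pV2.
Qed.

Lemma measurable_inv_fun (h : X -> R) : measurable_fun setT h -> (forall x, 0 < h x) ->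
  measurable_fun setT (fun x => (h x)^-1).
Proof.
move=> mh h0; have -> : (fun x => (h x)^-1) = (fun x => h x `^ (-1)).
  by apply/funext => x; rewrite powR_inv1// ltW.
exact: measurableT_comp (measurable_powR _) mh.
Qed.

Let bdd_inva : bdd_meas alpha^-1 (fun x => (a x)^-1).
Proof.
split; first exact: measurable_inv_fun.
by move=> x; apply: inv_le; have /andP[] := a_itv x.
Qed.

Let bdd_invA n : bdd_meas alpha^-1 (fun x => (A n x)^-1).
Proof.
split; first exact: measurable_inv_fun.
by move=> x; apply: inv_le; have /andP[] := A_itv n x.
Qed.

Lemma bdd_measM C1 C2 (g h : X -> R) : bdd_meas C1 g -> bdd_meas C2 h ->
  bdd_meas (C1 * C2) (fun x => g x * h x).
Proof.
move=> [mg gC] [mh hC]; split; first exact: measurable_funM.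
by move=> x; rewrite normrM ler_pM.
Qed.

(** Split at [|f n| = t]. Below, [|b n| <= m n * t], which vanishes with [m n]; above, [|b n| <= M]
    and the [p]-th moment controls the tail. So [t] is chosen before [n]. *)
Lemma cvg_fb : II (fun x => `|f n x| * `|b n x|) @[n --> \oo] --> 0.
Proof.
have bound n t : 0 < t -> `|II (fun x => `|f n x| * `|b n x|)| <= t * m n * 2 + M / t `^ (p - 1).
  move=> t0; have [_ ifp fB] := fLp n.
  (* The factor [2] in the bound is the sum of the mass of [D] and of the bound on the [p]-th
     moment, both equal to [1]. *)
  have := Lp_le_norm mD muD p1 (fLp n); rewrite muD1/= => f2.
  pose g x := t * m n * `|f n x| + M / t `^ (p - 1) * `|f n x| `^ p.
  have ig1 : intg (fun x => t * m n * `|f n x|) by exact/intgZ/intg_norm.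
  have ig2 : intg (fun x => M / t `^ (p - 1) * `|f n x| `^ p) by exact: intgZ.
  have tm0 : 0 <= t * m n by rewrite mulr_ge0// ltW.
  have Mt0 : 0 <= M / t `^ (p - 1) by rewrite divr_ge0 ?powR_ge0.
  apply: (@le_trans _ _ (II g)).
    apply: norm_Rint_le => //.
    - apply: measurable_funTS; apply: measurable_funM; apply: measurableT_comp => //.
      exact: measurable_funM.
    - exact: (intgD mD ig1 ig2).
    - move=> x _; rewrite normrM !normr_id /g; have [ft|tf] := leP `|f n x| t.
        apply: (@le_trans _ _ (t * m n * `|f n x|)).
          by rewrite /b normrM (ger0_norm (m_ge0 n)) mulrA ler_wpM2r// ler_wpM2r.
        by rewrite lerDl mulr_ge0// powR_ge0.
      apply: (@le_trans _ _ (M / t `^ (p - 1) * `|f n x| `^ p)).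
        have h := powR_tail p1 t0 (ltW tf).
        have -> : M / t `^ (p - 1) * `|f n x| `^ p = `|f n x| `^ p / t `^ (p - 1) * M by ring.
        exact: ler_pM.
      by rewrite lerDr mulr_ge0.
  rewrite /g RintegralD// !RintegralZl//; last exact: intg_norm.
  by rewrite lerD// ?ler_wpM2l// ler_piMr.
apply/cvgrPdist_le => e e0; have e2 : 0 < e / 2 by rewrite divr_gt0.
have [t t0 ht] := tail_small p1 M0 e2.
have e3 : 0 < e / 2 / (t * 2) by rewrite divr_gt0// mulr_gt0.
have /cvgrPdist_le /(_ _ e3) := m_cvg0.
apply: filterS => n; rewrite !sub0r !normrN (ger0_norm (m_ge0 n)) => h.
rewrite (le_trans (bound n t t0))// [leRHS](splitr e) lerD ?ht//.
by rewrite mulrAC mulrC -ler_pdivlMr// mulr_gt0.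
Qed.

Lemma tight_intgM phi n C h : tight phi -> bdd_meas C h -> intg (fun x => f n x * phi x * h x).
Proof. by move=> [_ _ ifp _ _] bh; exact: (bdd_meas_intgM mD (ifp n) bh). Qed.

Lemma measurable_gtK K (phi : X -> R) : measurable_fun setT phi ->
  measurable_fun setT (fun x => (K < `|phi x|)%R%:R : R).
Proof.
move=> mphi.
rewrite (_ : (fun x => _) = (fun x => if K < `|phi x| then 1 else 0)); last first.
  by apply/funext => x; case: (K < _).
apply: measurable_fun_ifT => //.
by apply: measurable_fun_ltr => //; exact: measurableT_comp.
Qed.

(** Cutting [phi] at the level [K] leaves a bounded test function, and tightness makes the discarded
    part small uniformly in [n] and for the limit. The factor [h] is carried for the bounded
    coefficients that multiply [phi] later. *)
Lemma tight_cvg phi C h : tight phi -> 0 <= C -> bdd_meas C h ->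
  II (fun x => f n x * phi x * h x) @[n --> \oo] --> II (fun x => u x * phi x * h x).
Proof.
move=> [mphi iphi ifp iup tphi] C0 bh; have [mh hC] := bh.
apply: cvg_unif_approx => e e0.
have e' : 0 < e / (C + 1) by rewrite divr_gt0// ltr_wpDl.
have [K [K0 fK uK]] := tphi _ e'.
pose phiK x := if `|phi x| <= K then phi x else 0.
have mphiK : measurable_fun setT phiK.
  apply: measurable_fun_ifT => //.
  by apply: measurable_fun_ler => //; exact: measurableT_comp.
have bphiK : bdd_meas K phiK.
  by split=> // x; rewrite /phiK; case: ifP => //; rewrite normr0.
have bK := bdd_measM bphiK bh.
have E v : measurable_fun setT v -> intg v -> intg (fun x => v x * phi x) ->
    II (fun x => `|v x * phi x| * (K < `|phi x|)%R%:R) <= e / (C + 1) ->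
    `|II (fun x => v x * phi x * h x) - II (fun x => v x * (phiK x * h x))| <= e.
  move=> mv iv ivp vK.
  have i1 : intg (fun x => v x * phi x * h x) by exact: (bdd_meas_intgM mD ivp bh).
  have i2 : intg (fun x => v x * (phiK x * h x)) by exact: (bdd_meas_intgM mD iv bK).
  have i3 : intg (fun x => `|v x * phi x| * (K < `|phi x|)%R%:R).
    apply: (@intgM _ _ _ mu D mD _ _ 1) => //; first exact: intg_norm.
      apply: measurable_funTS; exact: measurable_gtK.
    by move=> x _; case: (K < _); rewrite ?normr1 ?normr0.
  rewrite -RintegralB//.
  apply: (@le_trans _ _ (II (fun x => C * (`|v x * phi x| * (K < `|phi x|)%R%:R)))).
    apply: norm_Rint_le => //.
    - by apply: (@intg_meas _ _ _ mu); exact: intgB.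
    - exact: intgZ.
    - move=> x _; rewrite /phiK ltNge; case: ifPn => _ /=.
        by rewrite mulrA subrr normr0 !mulr0.
      by rewrite mul0r mulr0 subr0 mulr1 normrM mulrC ler_wpM2r.
  rewrite RintegralZl// (le_trans (ler_wpM2l C0 vK))//.
  by rewrite mulrCA ler_piMr ?(ltW e0)// ler_pdivrMr ?ltr_wpDl// mul1r lerDl.
exists (fun n => II (fun x => f n x * (phiK x * h x))), (II (fun x => u x * (phiK x * h x))).
split=> //; first by apply: (fu _ bK); rewrite mulr_ge0.
- by move=> n; exact: E.
- exact: E.
Qed.

Lemma tight_fb_intg phi n : tight phi -> intg (fun x => f n x * phi x * b n x).
Proof. by move=> tp; apply: (tight_intgM _ tp) => //; split=> //; exact: measurable_funM. Qed.

(** Where [|phi| <= K] this is [cvg_fb]; elsewhere [|b n| <= M] and tightness applies. *)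
Lemma tight_fb phi : tight phi -> II (fun x => `|f n x * phi x * b n x|) @[n --> \oo] --> 0.
Proof.
move=> tp; have [mphi iphi ifp iup tphi] := tp.
have mb n : measurable_fun setT (b n) by exact: measurable_funM.
apply/cvgrPdist_le => e e0.
have e' : 0 < e / 2 / (M + 1) by rewrite divr_gt0// ?divr_gt0// ltr_wpDl.
have [K [K0 fK _]] := tphi _ e'.
have e'' : 0 < e / 2 / (K + 1) by rewrite divr_gt0// ?divr_gt0// ltr_wpDl.
have /cvgrPdist_le /(_ _ e'') := cvg_fb; apply: filterS => n.
rewrite !sub0r !normrN ger0_norm; last by apply: Rintegral_ge0 => x _; rewrite mulr_ge0.
move=> h.
rewrite ger0_norm; last exact: Rintegral_ge0.
have i1 : intg (fun x => `|f n x| * `|b n x|).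
  apply: (@intgM _ _ _ mu D mD _ _ M) => //; first exact: intg_norm.
    by apply: measurable_funTS; exact: measurableT_comp.
  by move=> x _; rewrite normr_id.
have i2 : intg (fun x => `|f n x * phi x| * (K < `|phi x|)%R%:R).
  apply: (@intgM _ _ _ mu D mD _ _ 1) => //; first exact: intg_norm.
    apply: measurable_funTS; exact: measurable_gtK.
  by move=> x _; case: (K < _); rewrite ?normr1 ?normr0.
apply: (@le_trans _ _ (II (fun x => K * (`|f n x| * `|b n x|) + M * (`|f n x * phi x| * (K < `|phi x|)%R%:R)))).
  apply: le_Rintegral => //.
  - by apply: intg_norm => //; exact: tight_fb_intg.
  - by apply: (@intgD _ _ _ mu) => //; exact: intgZ.
  - move=> x _; rewrite (normrM (f n x * phi x)) (normrM (f n x)).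
    move: (bM n x) (normr_ge0 (b n x)); move: `|b n x| => B BM B0.
    have [pK|Kp] := leP `|phi x| K.
      by rewrite mulr0 mulr0 addr0 [leLHS]mulrAC [leRHS]mulrC ler_wpM2l// mulr_ge0.
    rewrite mulr1 [M * _]mulrC; apply: (@le_trans _ _ (`|f n x| * `|phi x| * M)); first by rewrite ler_wpM2l// mulr_ge0.
    by rewrite lerDr !mulr_ge0.
rewrite RintegralD//; [|exact: intgZ..].
rewrite !RintegralZl// [leRHS](splitr e) lerD//.
  rewrite (le_trans (ler_wpM2l K0 h))// mulrCA ler_piMr ?divr_ge0 ?(ltW e0)//.
  by rewrite ler_pdivrMr ?ltr_wpDl// mul1r lerDl.
rewrite (le_trans (ler_wpM2l M0 (fK n)))// mulrCA ler_piMr ?divr_ge0 ?(ltW e0)//.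
by rewrite ler_pdivrMr ?ltr_wpDl// mul1r lerDl.
Qed.

Lemma invA_split n x : (A n x)^-1 = (a x)^-1 - m n * (f n x * (c x * (a x)^-1 * (A n x)^-1)).
Proof. by rewrite /A /b; field; rewrite (gt_eqF (a_gt0 x)) (gt_eqF (A_gt0 n x)). Qed.

Let ca n : bdd_meas (Cc * alpha^-1 * alpha^-1) (fun x => c x * (a x)^-1 * (A n x)^-1).
Proof. by apply: bdd_measM => //; exact: bdd_measM. Qed.

Let caa : bdd_meas (Cc * alpha^-1 * alpha^-1) (fun x => c x * (a x)^-1 * (a x)^-1).
Proof. by apply: bdd_measM => //; exact: bdd_measM. Qed.

(** The weight still depends on [n], so weak convergence does not apply to it directly. Using
    [invA_split] a second time freezes it at [a]; the price is [f n * phi * b n] times bounded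
    factors, which vanishes by [tight_fb]. *)
Lemma tight_cvg_main phi : tight phi ->
  II (fun x => f n x * phi x * (c x * (a x)^-1 * (A n x)^-1)) @[n --> \oo] -->
  II (fun x => u x * phi x * (c x * (a x)^-1 * (a x)^-1)).
Proof.
move=> tp; have Ca0 : 0 <= Cc * alpha^-1 * alpha^-1 by rewrite !mulr_ge0// invr_ge0 ltW.
have h1 := tight_cvg tp Ca0 caa.
rewrite -[X in _ --> X]subr0.
pose r n x := f n x * phi x * b n x * (c x * (a x)^-1 * (c x * (a x)^-1 * (A n x)^-1)).
have Cr0 : 0 <= Cc * alpha^-1 * (Cc * alpha^-1 * alpha^-1) by rewrite !mulr_ge0// invr_ge0 ltW.
have br n : bdd_meas (Cc * alpha^-1 * (Cc * alpha^-1 * alpha^-1)) (fun x => c x * (a x)^-1 * (c x * (a x)^-1 * (A n x)^-1)).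
  by apply: bdd_measM => //; exact: bdd_measM.
have ir n : intg (r n) by apply: (bdd_meas_intgM mD _ (br n)); exact: tight_fb_intg.
have h2 : II (r n) @[n --> \oo] --> 0.
  apply/norm_cvg0P; apply: (@squeeze_cvgr _ _ _ _ (fun=> 0)
    (fun n => Cc * alpha^-1 * (Cc * alpha^-1 * alpha^-1) * II (fun x => `|f n x * phi x * b n x|))).
  - near=> n; rewrite normr_ge0/=; apply: (norm_II_mul_le mD _ (br n)); exact: tight_fb_intg.
  - exact: cvg_cst.
  - by rewrite -[X in _ --> X](mulr0 (Cc * alpha^-1 * (Cc * alpha^-1 * alpha^-1))); apply: cvgM; [exact: cvg_cst|exact: tight_fb].
rewrite (_ : (fun n => _) = (fun n => II (fun x => f n x * phi x * (c x * (a x)^-1 * (a x)^-1)) - II (r n))).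
  exact: cvgB.
apply/funext => n; rewrite -RintegralB//; last exact: tight_intgM caa.
apply: eq_Rintegral => x _; rewrite /r {1}invA_split /b; ring.
Unshelve. all: by end_near. Qed.

Definition harm n := (II (fun x => (A n x)^-1))^-1.
Definition harm0 := (II (fun x => (a x)^-1))^-1.

Hypothesis tight1 : tight (fun=> 1).

(** [Jn n] is the divided difference of the mean of [1 / A]: multiplied by [m n], it is the mean of
    [1 / a] minus that of [1 / A n]. *)
Definition Jn n := II (fun x => f n x * (c x * (a x)^-1 * (A n x)^-1)).
Definition J0 := II (fun x => u x * (c x * (a x)^-1 * (a x)^-1)).
Definition K0 := harm0 * harm0 * J0.

Lemma Jn_cvg : Jn n @[n --> \oo] --> J0.
Proof.
have := tight_cvg_main tight1; rewrite /Jn /J0.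
under eq_fun do under eq_Rintegral do rewrite mulr1.
by under [in X in _ --> X -> _]eq_Rintegral do rewrite mulr1.
Qed.

Lemma Rint_inv_gt0 (h : X -> R) : measurable_fun setT h -> (forall x, alpha <= h x <= beta) ->
  intg (fun x => (h x)^-1) /\ 0 < II (fun x => (h x)^-1).
Proof.
move=> mh h_itv.
have h0 x : 0 < h x by have /andP[/(lt_le_trans alpha0)] := h_itv x.
have ih : intg (fun x => (h x)^-1).
  apply: (@intg_bounded _ _ _ _ _ _ _ alpha^-1) => //.
    by apply: measurable_funTS; exact: measurable_inv_fun.
  by move=> x _; apply: inv_le; have /andP[] := h_itv x.
split=> //.
have [x _] : D !=set0.
  by apply/set0P/eqP => D0; move: muD1; rewrite D0 measure0 => /esym/eqP; rewrite onee_eq0.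
have b0 : 0 < beta by have /andP[/(lt_le_trans alpha0) ? ?] := h_itv x; apply: lt_le_trans (h0 x) _.
apply: (@lt_le_trans _ _ (II (fun=> beta^-1))).
  rewrite Rintegral_cst//.
  rewrite (_ : fine _ = 1) ?mulr1 ?invr_gt0//; exact: (congr1 fine muD1).
apply: le_Rintegral => //; first exact: intg_cst.
move=> y _; have /andP[_ hb] := h_itv y.
by have := b0; have := h0 y; move=> hy hb0; rewrite (lef_pV2 hb0 hy).
Qed.

Lemma harmE n : harm n - harm0 = m n * (harm n * harm0 * Jn n).
Proof.
have [iA A0] := Rint_inv_gt0 (mA n) (A_itv n).
have [ia a0] := Rint_inv_gt0 ma a_itv.
have ij : intg (fun x => f n x * (c x * (a x)^-1 * (A n x)^-1)) by exact: (bdd_meas_intgM mD (if_ n) (ca n)).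
have E : II (fun x => (A n x)^-1) = II (fun x => (a x)^-1) - m n * Jn n.
  rewrite /Jn -RintegralZl// -RintegralB//; last exact: intgZ.
  by apply: eq_Rintegral => x _; exact: invA_split.
have -> : m n * (harm n * harm0 * Jn n) = harm n * harm0 * (m n * Jn n) by ring.
have -> : m n * Jn n = II (fun x => (a x)^-1) - II (fun x => (A n x)^-1) by rewrite E; ring.
by rewrite /harm /harm0; field; rewrite !gt_eqF.
Qed.

Lemma mJ_cvg0 : m n * Jn n @[n --> \oo] --> 0.
Proof. by rewrite -(mul0r J0); apply: cvgM => //; exact: Jn_cvg. Qed.

Lemma harm_cvg : harm n @[n --> \oo] --> harm0.
Proof.
have [ia a0] := Rint_inv_gt0 ma a_itv.
rewrite /harm0; apply: cvgV; first by rewrite gt_eqF.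
rewrite -[X in _ --> X]subr0.
rewrite (_ : (fun n => _) = (fun n => II (fun x => (a x)^-1) - m n * Jn n)).
  by apply: cvgB; [exact: cvg_cst|exact: mJ_cvg0].
apply/funext => n.
have ij : intg (fun x => f n x * (c x * (a x)^-1 * (A n x)^-1)) by exact: (bdd_meas_intgM mD (if_ n) (ca n)).
rewrite /Jn -RintegralZl// -RintegralB//; last exact: intgZ.
by apply: eq_Rintegral => x _; exact: invA_split.
Qed.

Lemma harmJ_cvg : harm n * harm0 * Jn n @[n --> \oo] --> K0.
Proof.
apply: cvgM; last exact: Jn_cvg.
by apply: cvgM; [exact: harm_cvg|exact: cvg_cst].
Qed.

(** For [m n != 0] the quotient is [s n]; for [m n = 0] it is [0] because [0^-1 = 0]. In both cases
    it is bounded by [|s n|]. *)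
Lemma div_scaled_cvg0 (s : nat -> R) : s n @[n --> \oo] --> 0 ->
  (m n * s n) / m n @[n --> \oo] --> 0.
Proof.
move=> s0; apply/norm_cvg0P; apply: (@squeeze_cvgr _ _ _ _ (fun=> 0) (fun n => `|s n|)).
- near=> n; rewrite normr_ge0/=; have [->|mn] := eqVneq (m n) 0; first by rewrite invr0 mulr0 normr0.
  by rewrite mulrAC divff// mul1r.
- exact: cvg_cst.
- by rewrite -(@normr0 _ R); exact: cvg_norm.
Unshelve. all: by end_near. Qed.

Theorem harm_expansion : (harm n - harm0 - m n * K0) / m n @[n --> \oo] --> 0.
Proof.
rewrite (_ : (fun n => _) = (fun n => m n * (harm n * harm0 * Jn n - K0) / m n)).
  apply: div_scaled_cvg0; rewrite -(subrr K0).
  by apply: cvgB; [exact: harmJ_cvg|exact: cvg_cst].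
by apply/funext => n; rewrite harmE mulrBr.
Qed.

(* [harm n * (A n x)^-1] to first order in [m n]: [K0] is the slope of [harm n], and
   the other term that of [(A n x)^-1]. *)
Definition dv x := (K0 - u x * c x * (harm0 * (a x)^-1)) * (a x)^-1.

Theorem corrector_expansion phi : tight phi ->
  II (fun x => (harm n * (A n x)^-1 - harm0 * (a x)^-1 - m n * dv x) / m n * phi x)
    @[n --> \oo] --> 0.
Proof.
move=> tp; have [mphi iphi ifp iup _] := tp.
pose Q n := II (fun x => f n x * phi x * (c x * (a x)^-1 * (A n x)^-1)).
pose Q0 := II (fun x => u x * phi x * (c x * (a x)^-1 * (a x)^-1)).
have cQ : Q n @[n --> \oo] --> Q0 by exact: tight_cvg_main.
have iQ n : intg (fun x => f n x * phi x * (c x * (a x)^-1 * (A n x)^-1)) by exact: tight_intgM (ca n).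
have iQ0 : intg (fun x => u x * phi x * (c x * (a x)^-1 * (a x)^-1)) by exact: (bdd_meas_intgM mD iup caa).
have iA n : intg (fun x => phi x * (A n x)^-1) by exact: (bdd_meas_intgM mD iphi (bdd_invA n)).
have ia : intg (fun x => phi x * (a x)^-1) by exact: (bdd_meas_intgM mD iphi bdd_inva).
pose S n := II (fun x => phi x * (A n x)^-1); pose S0 := II (fun x => phi x * (a x)^-1).
have SE n : S n = S0 - m n * Q n.
  rewrite /S0 /Q -RintegralZl// -RintegralB//; last exact: intgZ.
  by apply: eq_Rintegral => x _; rewrite {1}invA_split; ring.
have cS : S n @[n --> \oo] --> S0.
  rewrite (_ : S = (fun n => S0 - m n * Q n)); last exact/funext.
  rewrite -[X in _ --> X]subr0; apply: cvgB; first exact: cvg_cst.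
  by rewrite -(mul0r Q0); exact: cvgM.
(* From [harm n * S n - harm0 * S0 = (harm n - harm0) * S n + harm0 * (S n - S0)], both differences
   carry an exact factor [m n]. Here [s n] is what remains once it is taken out, minus its limit. *)
pose s n := harm n * harm0 * Jn n * S n - harm0 * Q n - (K0 * S0 - harm0 * Q0).
have s0 : s n @[n --> \oo] --> 0.
  rewrite -(subrr (K0 * S0 - harm0 * Q0)); apply: cvgB; last exact: cvg_cst.
  apply: cvgB; first by apply: cvgM; [exact: harmJ_cvg|exact: cS].
  by apply: cvgM; [exact: cvg_cst|exact: cQ].
rewrite (_ : (fun n => _) = (fun n => m n * s n / m n)); first exact: div_scaled_cvg0.
apply/funext => n.
pose t x := (harm n * harm0 * Jn n) * (phi x * (A n x)^-1) - harm0 * (f n x * phi x * (c x * (a x)^-1 * (A n x)^-1))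
  - (K0 * (phi x * (a x)^-1) - harm0 * (u x * phi x * (c x * (a x)^-1 * (a x)^-1))).
have it1 : intg (fun x => (harm n * harm0 * Jn n) * (phi x * (A n x)^-1) - harm0 * (f n x * phi x * (c x * (a x)^-1 * (A n x)^-1))).
  by apply: (@intgB _ _ _ mu) => //; exact: intgZ.
have it2 : intg (fun x => K0 * (phi x * (a x)^-1) - harm0 * (u x * phi x * (c x * (a x)^-1 * (a x)^-1))).
  by apply: (@intgB _ _ _ mu) => //; exact: intgZ.
have it : intg t by exact: intgB.
have -> : m n * s n / m n = m n / m n * s n by rewrite mulrAC.
have -> : s n = II t.
  rewrite /t RintegralB// RintegralB//; [|exact: intgZ..].
  by rewrite RintegralB//; [|exact: intgZ..]; rewrite !RintegralZl.
rewrite -RintegralZl//; apply: eq_Rintegral => x _.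
have hE : harm n = harm0 + m n * (harm n * harm0 * Jn n) by rewrite -harmE addrC subrK.
have E2 : (A n x)^-1 - (a x)^-1 = - (m n * (f n x * (c x * (a x)^-1 * (A n x)^-1))).
  by rewrite {1}invA_split; ring.
have -> : harm n * (A n x)^-1 - harm0 * (a x)^-1 - m n * dv x =
   m n * (harm n * harm0 * Jn n * (A n x)^-1
     - harm0 * (f n x * (c x * (a x)^-1 * (A n x)^-1)) - dv x).
  transitivity (harm0 * ((A n x)^-1 - (a x)^-1) +
      m n * (harm n * harm0 * Jn n) * (A n x)^-1 - m n * dv x).
    by rewrite [in LHS]hE; move: (A n x)^-1 (a x)^-1 (harm n * harm0 * Jn n) => ? ? ?; ring.
  rewrite E2; move: (A n x)^-1 (a x)^-1 (harm n * harm0 * Jn n) => ? ? ?; ring.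
rewrite /t /dv; move: (A n x)^-1 (a x)^-1 (harm n * harm0 * Jn n) (m n)^-1 => ? ? ? ?; ring.
Qed.

Lemma corrector_remainder_intg phi n : tight phi ->
  intg (fun x => (harm n * (A n x)^-1 - harm0 * (a x)^-1 - m n * dv x) / m n * phi x).
Proof.
move=> [mphi iphi ifp iup _].
have iQ0 : intg (fun x => u x * phi x * (c x * (a x)^-1 * (a x)^-1)) by exact: (bdd_meas_intgM mD iup caa).
have iA : intg (fun x => phi x * (A n x)^-1) by exact: (bdd_meas_intgM mD iphi (bdd_invA n)).
have ia : intg (fun x => phi x * (a x)^-1) by exact: (bdd_meas_intgM mD iphi bdd_inva).
have i1 := intgB mD (intgZ mD (harm n / m n) iA) (intgZ mD (harm0 / m n) ia).
have i2 := intgB mD (intgZ mD K0 ia) (intgZ mD harm0 iQ0).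
have := intgB mD i1 (intgZ mD (m n / m n) i2).
rewrite (_ : (fun x => _) = (fun x => (harm n * (A n x)^-1 - harm0 * (a x)^-1 - m n * dv x) / m n * phi x))//.
by apply/funext => x; rewrite /dv; move: (A n x)^-1 (a x)^-1 (m n)^-1 => ? ? ?; ring.
Qed.

Let ia : intg (fun x => (a x)^-1).
Proof.
have := bdd_meas_intgM mD (intg_cst mD muD 1) bdd_inva.
by rewrite (_ : (fun x => _) = (fun x => (a x)^-1))//; apply/funext => x; rewrite mul1r.
Qed.

Let iuc : intg (fun x => u x * (c x * (a x)^-1 * (a x)^-1)).
Proof. exact: (bdd_meas_intgM mD iu caa). Qed.

Let harm0E : II (fun x => (a x)^-1) = harm0^-1.
Proof. by rewrite invrK. Qed.

Let harm0_neq0 : harm0 != 0.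
Proof. by rewrite invr_eq0 gt_eqF//; exact: (proj2 (Rint_inv_gt0 ma a_itv)). Qed.

Lemma dv_intg : intg dv.
Proof.
rewrite (_ : dv = fun x => K0 * (a x)^-1 - harm0 * (u x * (c x * (a x)^-1 * (a x)^-1))).
  by apply: intgB => //; exact: intgZ.
by apply/funext => x; rewrite /dv; move: (a x)^-1 => ?; ring.
Qed.

(** The mean of [1 / a] is [1 / harm0], so [K0 = harm0 ^ 2 * J0] is precisely the constant flux for
    which the two terms of [dv] have equal means. *)
Lemma Rint_dv : II dv = 0.
Proof.
rewrite (_ : dv = fun x => K0 * (a x)^-1 - harm0 * (u x * (c x * (a x)^-1 * (a x)^-1))).
  rewrite RintegralB//; [|exact: intgZ..]; rewrite !RintegralZl// harm0E -/J0 /K0.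
  by move: harm0_neq0 => h; field.
by apply/funext => x; rewrite /dv; move: (a x)^-1 => ?; ring.
Qed.

(** Pointwise, [a * dv] is [K0] minus the first integrand: the first order flux is constant, and [D]
    has mass one. *)
Lemma first_order_coefficient :
  II (fun x => u x * (c x * (harm0 * (a x)^-1))) + II (fun x => a x * dv x) = K0.
Proof.
have ucb : bdd_meas (Cc * (`|harm0| * alpha^-1)) (fun x => c x * (harm0 * (a x)^-1)).
  apply: bdd_measM; first by split.
  by apply: bdd_measM.
have iuc1 := bdd_meas_intgM mD iu ucb.
have E x : a x * dv x = K0 - u x * (c x * (harm0 * (a x)^-1)).
  by rewrite /dv; field; rewrite gt_eqF.
under [X in _ + X]eq_Rintegral do rewrite E.
rewrite RintegralB//; last exact: intg_cst.
rewrite addrC subrK Rintegral_cst// (_ : fine _ = 1) ?mulr1//; exact: (congr1 fine muD1).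
Qed.

End expansion.

(** * Mixed norms on a product *)

Section product_cell.
Context d1 d2 (S : measurableType d1) (T : measurableType d2) (R : realType).
Context (leb : {sigma_finite_measure set S -> \bar R}) (P : probability T R) (cell : set S).
Hypothesis measurable_cell : measurable cell.
Hypothesis leb_cell : leb cell = 1%E.
Notation mu := (leb \x P)%E.
Notation D := (cell `*` (setT : set T)).
Notation intg f := (mu.-integrable D (EFin \o f)).
Notation "'II' f" := (\int[mu]_(z in D) f z) (at level 10).
Implicit Types F : S * T -> R.

Lemma leb_cell_lty : (leb cell < +oo)%E. Proof. by rewrite leb_cell ltry. Qed.

Lemma P_lty : (P setT < +oo)%E.
Proof. by rewrite (le_lt_trans (probability_le1 P measurableT))// ltry. Qed.

Lemma prod_sigma_finite : sigma_finite setT (mu : {measure set (S * T)%type -> \bar R}).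
Proof.
have /sigma_finiteP[F [TF ndF Foo]] := sigma_finiteT leb.
exists (fun n => F n `*` setT) => [|n].
  by rewrite -setXTT TF; apply/seteqP; split=> -[x y] /= [] => [[n _ Fx] _|n _ [Fx _]]; [exists n|split=> //; exists n].
have [mF Fn] := Foo n; split; first exact: measurableX.
rewrite /= product_measure1E// [X in (_ * X)%E](_ : _ = 1%E) ?mule1//; exact: probability_setT.
Qed.

(** The product measure together with its sigma-finiteness, the structure under which Radon-Nikodym
    densities are taken. *)
Definition prodm : {sigma_finite_measure set (S * T)%type -> \bar R} :=
  HB.pack (product_measure1 leb P) (Measure_isSigmaFinite.Build _ _ _ mu prod_sigma_finite).

Lemma measurable_D : measurable D.
Proof. by apply: measurableX => //; exact: measurable_cell. Qed.

Lemma mu_D : mu D = 1%E.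
Proof.
rewrite product_measure1E// [X in (X * _)%E](_ : _ = 1%E) ?mul1e//; exact: probability_setT.
Qed.

Lemma mu_D_lty : (mu D < +oo)%E. Proof. by rewrite mu_D ltry. Qed.

Lemma tonelli_cell (h : S * T -> \bar R) : measurable_fun setT h -> (forall z, 0 <= h z)%E ->
  (\int[mu]_(z in D) h z = \int[leb]_(x in cell) \int[P]_w h (x, w))%E.
Proof.
move=> mh h0; rewrite integral_mkcond [RHS]integral_mkcond fubini_tonelli1.
- apply: eq_integral => x _; rewrite /fubini_F patchE; case: ifPn => xc.
    by apply: eq_integral => w _; rewrite patchE mem_set//; split => //; exact: set_mem.
  apply: integral0_eq => w _; rewrite patchE memNset// => -[/= xc' _].
  by move/negP: xc; apply; rewrite inE.
- by apply/(measurable_restrictT _ measurable_D); exact: measurable_funTS.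
- by move=> z; rewrite patchE; case: ifP.
Qed.

Lemma tonelli_cell' (h : S * T -> \bar R) : measurable_fun setT h -> (forall z, 0 <= h z)%E ->
  (\int[mu]_(z in D) h z = \int[P]_w \int[leb]_(x in cell) h (x, w))%E.
Proof.
move=> mh h0; rewrite integral_mkcond fubini_tonelli2.
- apply: eq_integral => w _; rewrite /fubini_G [RHS]integral_mkcond.
  apply: eq_integral => x _; rewrite !patchE; case: ifPn => [|/negP] xD; case: ifPn => [|/negP] xc //.
    by exfalso; apply: xc; rewrite inE; move: xD; rewrite inE => -[].
  by exfalso; apply: xD; rewrite inE; split=> //; exact: set_mem.
- by apply/(measurable_restrictT _ measurable_D); exact: measurable_funTS.
- by move=> z; rewrite patchE; case: ifP.
Qed.

Lemma intg_restr F : intg F -> mu.-integrable setT (EFin \o (F \_ D)).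
Proof. by move=> iF; rewrite -restrict_EFin; apply: (iffLR (integrable_mkcond _ measurable_D)). Qed.

(** Real-valued integrals send an infinite inner integral to [0], so the inner integrals agree with
    the extended ones only for almost every [x], where the section is integrable. *)
Lemma fubini_cell F : intg F -> \int[leb]_(x in cell) \int[P]_w F (x, w) = II F.
Proof.
move=> /intg_restr iG.
rewrite [RHS]Rintegral_mkcond [LHS]Rintegral_mkcond /Rintegral; congr fine.
rewrite -(integral12_prod_meas1 iG).
apply: ae_eq_integral => //.
- rewrite (_ : (fun x => _) = EFin \o (fine \o (fubini_F P (EFin \o (F \_ D))))).
    by apply/measurable_EFinP; apply: measurableT_comp => //; exact: (measurable_fubini_F iG).
  apply/funext => x /=; congr EFin; rewrite patchE /fubini_F /Rintegral; case: ifPn => xc.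
    congr fine; apply: eq_integral => w _; rewrite /= patchE mem_set//; split => //; exact: set_mem.
  rewrite integral0_eq// => w _; rewrite /= patchE memNset// => -[/= xc' _].
  by move/negP: xc; apply; rewrite inE.
- exact: (measurable_fubini_F iG).
have := integrable_ae measurableT (integrable_fubini_F iG).
apply: filterS => x /(_ Logic.I) fx _.
rewrite -[RHS]fineK//; congr EFin; rewrite patchE /fubini_F /Rintegral; case: ifPn => xc.
  congr fine; apply: eq_integral => w _; rewrite /= patchE mem_set//; split => //; exact: set_mem.
rewrite integral0_eq// => w _; rewrite /= patchE memNset// => -[/= xc' _].
by move/negP: xc; apply; rewrite inE.
Qed.

Lemma fubini_cell' F : intg F -> \int[P]_w \int[leb]_(x in cell) F (x, w) = II F.
Proof.
move=> /intg_restr iG.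
rewrite [RHS]Rintegral_mkcond [in LHS]/Rintegral [RHS]/Rintegral; congr fine.
rewrite -(integral21_prod_meas1 iG).
have E w : \int[leb]_(x in cell) F (x, w) = fine (fubini_G leb (EFin \o (F \_ D)) w).
  rewrite Rintegral_mkcond /Rintegral /fubini_G; congr fine; apply: eq_integral => x _.
  rewrite /= !patchE; congr EFin; case: ifPn => [|/negP] xD; case: ifPn => [|/negP] xc //.
    by exfalso; apply: xc; rewrite inE; split=> //; exact: set_mem.
  by exfalso; apply: xD; rewrite inE; move: xc; rewrite inE => -[].
apply: ae_eq_integral => //.
- rewrite (_ : (fun x => _) = EFin \o (fine \o (fubini_G leb (EFin \o (F \_ D))))).
    by apply/measurable_EFinP; apply: measurableT_comp => //; exact: (measurable_fubini_G iG).
  by apply/funext => w /=; congr EFin; exact: (E w).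
- exact: (measurable_fubini_G iG).
have := ae_integrable2 iG.
apply: filterS => w iw _; have fw := integrable_fin_num measurableT iw; rewrite -[RHS]fineK//; congr EFin; exact: (E w).
Qed.

Lemma measurable_xint F : measurable_fun setT F ->
  measurable_fun (setT : set T) (fun w => \int[leb]_(x in cell) F (x, w)).
Proof.
move=> mF; have mG : measurable_fun setT (F \_ D).
  by apply/(measurable_restrictT _ measurable_D); exact: measurable_funTS.
have mEG : measurable_fun setT (EFin \o (F \_ D)) by exact/measurable_EFinP.
have m1 : measurable_fun setT (fubini_G leb (EFin \o (F \_ D))^\+%E).
  by apply: measurable_fun_fubini_tonelli_G => //; exact: measurable_funepos.
have m2 : measurable_fun setT (fubini_G leb (EFin \o (F \_ D))^\-%E).
  by apply: measurable_fun_fubini_tonelli_G => //; exact: measurable_funeneg.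
rewrite (_ : (fun w => _) = fine \o (fubini_G leb (EFin \o (F \_ D))^\+%E \-
    fubini_G leb (EFin \o (F \_ D))^\-%E)%E).
  by apply: measurableT_comp => //; exact: emeasurable_funB.
apply/funext => w /=; rewrite Rintegral_mkcond /Rintegral; congr fine.
rewrite integralE; congr (_ - _)%E; apply: eq_integral => x _.
- rewrite !funeposE/= !patchE; congr (maxe (EFin _) _); case: ifPn => [|/negP] xD; case: ifPn => [|/negP] xc //.
    by exfalso; apply: xc; rewrite inE; split=> //; exact: set_mem.
  by exfalso; apply: xD; rewrite inE; move: xc; rewrite inE => -[].
- rewrite !funenegE/= !patchE; congr (maxe (EFin (- _)) _); case: ifPn => [|/negP] xD; case: ifPn => [|/negP] xc //.
    by exfalso; apply: xc; rewrite inE; split=> //; exact: set_mem.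
  by exfalso; apply: xD; rewrite inE; move: xc; rewrite inE => -[].
Qed.

Lemma measurable_eint F : measurable_fun setT F -> (forall z, 0 <= F z) ->
  measurable_fun (setT : set S) (fun x => \int[P]_w (F (x, w))%:E)%E.
Proof.
move=> mF F0; apply: (@measurable_fun_fubini_tonelli_F _ _ _ _ _ P (EFin \o F)).
- exact/measurable_EFinP.
- by move=> z; rewrite lee_fin.
Qed.

Lemma ae_prod_fst (Q : S -> Prop) : {ae leb, forall x, cell x -> Q x} ->
  {ae mu, forall z, D z -> Q z.1}.
Proof.
move=> [N [mN N0 sN]]; exists (N `*` setT); split.
- exact: measurableX.
- rewrite product_measure1E// [X in (X * _)%E](_ : _ = 0%E) ?mul0e//; exact: N0.
- move=> z /= h; split => //; apply: sN => h'; apply: h => -[zc _]; exact: h'.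
Qed.

Lemma ae_prod_section1 (Q : S * T -> Prop) : {ae mu, forall z, D z -> Q z} ->
  {ae leb, forall x, cell x -> {ae P, forall w, Q (x, w)}}.
Proof.
move=> [N [mN N0 sN]].
have : {ae leb, forall x, setT x -> P (xsection N x) = 0%E}.
  apply/(ae_eq_integral_abs leb measurableT); first exact: measurable_fun_xsection.
  by under eq_integral do rewrite gee0_abs//.
apply: filterS => x /(_ Logic.I) Nx xc; exists (xsection N x); split=> //.
  exact: measurable_xsection.
by move=> w /= h; rewrite /xsection/= inE; apply: sN => h'; apply: h; exact: h'.
Qed.

Lemma ae_prod_section2 (Q : S * T -> Prop) : {ae mu, forall z, D z -> Q z} ->
  {ae P, forall w, {ae leb, forall x, cell x -> Q (x, w)}}.
Proof.
move=> [N [mN N0 sN]].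
have E : (\int[P]_w leb (ysection N w) = 0)%E.
  have mI : measurable_fun setT (EFin \o (\1_N : S * T -> R)).
    by apply/measurable_EFinP; exact: measurable_indic.
  have := @fubini_tonelli2 _ _ _ _ R leb P (EFin \o (\1_N : S * T -> R)) mI.
  rewrite (@indic_fubini_tonelli_GE _ _ _ _ R leb N mN) => <-; last by move=> z; rewrite lee_fin.
  by rewrite integral_indic// setIT.
have : {ae P, forall w, setT w -> leb (ysection N w) = 0%E}.
  apply/(ae_eq_integral_abs P measurableT); first exact: measurable_fun_ysection.
  by under eq_integral do rewrite gee0_abs//.
apply: filterS => w /(_ Logic.I) Nw; exists (ysection N w); split=> //.
  exact: measurable_ysection.
by move=> x /= h; rewrite /ysection/= inE; apply: sN => h'; apply: h => xc; exact: h'.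
Qed.

Lemma intg_of_le F C : measurable_fun setT F -> (forall z, 0 <= F z) ->
  (\int[mu]_(z in D) (F z)%:E <= C%:E)%E -> intg F /\ II F <= C.
Proof.
move=> mF F0 FC; have i0 : (0 <= \int[mu]_(z in D) (F z)%:E)%E by apply: integral_ge0 => z _; rewrite lee_fin.
split.
  apply/integrableP; split; first by apply/measurable_EFinP; exact: measurable_funTS.
  rewrite (_ : (\int[mu]_(z in D) `|(EFin \o F) z|)%E = (\int[mu]_(z in D) (F z)%:E)%E).
    by rewrite (le_lt_trans FC)// ltry.
  by apply: eq_integral => z _; rewrite /= ger0_norm.
by rewrite -lee_fin fineK// ge0_fin_numE// (le_lt_trans FC)// ltry.
Qed.

(* The unit ball of [L^oo(cell; L^p)]. *)
Definition unit_ball (p : R) F := measurable_fun setT F /\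
  {ae leb, forall x, cell x -> (\int[P]_w (`|F (x, w)| `^ p)%:E <= 1)%E}.

Lemma measurable_powF p F : measurable_fun setT F -> measurable_fun setT (fun z => `|F z| `^ p).
Proof. by move=> mF; apply: (measurableT_comp (measurable_powR p)); exact: measurableT_comp. Qed.

(** The supremum in [x] is turned into an integrated bound by an [L^1] weight. The weight [1] gives
    the plain moment bound, an indicator localizes in [x], and a general [s] carries the
    [x]-dependence of the test functions. *)
Lemma weighted_unit_ball p F (s : S -> R) : unit_ball p F ->
  measurable_fun setT s -> (forall x, 0 <= s x) -> leb.-integrable cell (EFin \o s) ->
  intg (fun z => s z.1 * `|F z| `^ p) /\ II (fun z => s z.1 * `|F z| `^ p) <= \int[leb]_(x in cell) s x.
Proof.
move=> [mF F1] ms s0 is_; have mpF := measurable_powF p mF.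
have ms1 : measurable_fun setT (fun z : S * T => s z.1) by exact: measurableT_comp.
apply: intg_of_le.
- exact: measurable_funM.
- by move=> z; rewrite mulr_ge0// powR_ge0.
rewrite tonelli_cell//; first last.
- by move=> z; rewrite lee_fin mulr_ge0// powR_ge0.
- by apply/measurable_EFinP; exact: measurable_funM.
rewrite fineK; last by apply: integrable_fin_num => //; exact: measurable_cell.
have mFx x : measurable_fun (setT : set T) (fun w => (`|F (x, w)| `^ p)%:E).
  apply/measurable_EFinP; apply: (measurableT_comp mpF); exact: measurable_pair1.
have E x : (\int[P]_w (s x * `|F (x, w)| `^ p)%:E = (s x)%:E * \int[P]_w (`|F (x, w)| `^ p)%:E)%E.
  under eq_integral do rewrite EFinM.
  by rewrite ge0_integralZl// ?lee_fin.
apply: ae_ge0_le_integral => //.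
- by move=> x _; apply: integral_ge0 => w _; rewrite lee_fin mulr_ge0// powR_ge0.
- apply: measurable_funTS; apply: (@measurable_eint (fun z => s z.1 * `|F z| `^ p)).
    exact: measurable_funM.
  by move=> z; rewrite mulr_ge0// powR_ge0.
- by move=> x _; rewrite lee_fin.
- by apply: measurable_funTS; exact/measurable_EFinP.
apply: filterS F1 => x h xc; rewrite E -[leRHS]mule1 lee_wpmul2l ?lee_fin//.
exact: h.
Qed.

Lemma unit_ball_Lp_le p F : unit_ball p F -> Lp_le prodm D p 1 F.
Proof.
move=> uF; have i1 : leb.-integrable cell (EFin \o (fun=> 1)).
  apply: (@intg_bounded _ _ _ leb _ measurable_cell _ 1) => //.
    exact: leb_cell_lty.
  by move=> x _; rewrite normr1.
have [] := weighted_unit_ball uF (measurable_cst (1:R)) (fun=> ler01) i1.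
rewrite (_ : (fun z => _) = (fun z => `|F z| `^ p)); last by apply/funext => z; rewrite mul1r.
rewrite Rintegral_cst//.
move=> h1 h2; split=> //; first by case: uF.
by apply: (le_trans h2); rewrite mul1r (_ : fine _ = 1)//; exact: (congr1 fine leb_cell).
Qed.

Lemma bdd_meas_indic (A : set S) : measurable A -> bdd_meas (1:R) (fun z : S * T => \1_A z.1 : R).
Proof.
move=> mA; split.
  apply: (measurableT_comp (f := \1_A : S -> R)); last exact: measurable_fst.
  exact: measurable_indic.
by move=> z; rewrite indicE; case: (_ \in _); rewrite ?normr1 ?normr0.
Qed.

(** Let [E] be the set of [x] where the bound fails, [L] its measure in the cell, and test with the
    function dual to [trunc k u] in [L^p], restricted to [E]. Young's inequality bounds the pairings
    with [f n] by [L / p + I / q], while their limit is [I]; absorbing [I / q] gives [I <= L]. So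
    [Y - 1], positive on [E], has nonpositive integral there, and [E] is null. Truncation makes the
    test function bounded and [I] finite. *)
Lemma unit_ball_trunc p (u : S * T -> R) (f : nat -> S * T -> R) k : 1 < p ->
  (forall n, unit_ball p (f n)) -> measurable_fun setT u -> intg u ->
  (forall C g, 0 <= C -> bdd_meas C g ->
    II (fun z => f n z * g z) @[n --> \oo] --> II (fun z => u z * g z)) ->
  unit_ball p (trunc k u).
Proof.
move=> p1 fB mu_ iu fu; have mt := measurable_trunc k mu_.
have p0 : 0 < p by rewrite (lt_trans _ p1).
have pm1 : 0 < p - 1 by rewrite subr_gt0.
split => //; have mpt := measurable_powF p mt.
pose Y x := \int[P]_w (`|trunc k u (x, w)| `^ p).
have tb z : `|trunc k u z| `^ p <= k.+1%:R `^ p.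
  by apply: ge0_ler_powR; rewrite ?nnegrE ?trunc_le// ltW.
have mtx x : measurable_fun (setT : set T) (fun w => `|trunc k u (x, w)| `^ p).
  by apply: (measurableT_comp mpt); exact: measurable_pair1.
have ix x : P.-integrable setT (EFin \o (fun w => `|trunc k u (x, w)| `^ p)).
  apply: (@intg_bounded _ _ _ P setT measurableT _ (k.+1%:R `^ p)) => //.
    exact: P_lty.
  by move=> w _; rewrite ger0_norm ?powR_ge0.
have mY : measurable_fun setT Y.
  rewrite (_ : Y = fine \o (fun x => \int[P]_w (`|trunc k u (x, w)| `^ p)%:E)%E)//.
  apply: measurableT_comp => //.
  by apply: (@measurable_eint (fun z => `|trunc k u z| `^ p)) => // z; exact: powR_ge0.
pose E := [set x | 1 < Y x].
have mE : measurable E by rewrite -[E]setTI; exact: measurable_fun_ltr.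
have [mI I1] := bdd_meas_indic mE.
pose J (z : S * T) : R := \1_E z.1.
have J01 z : 0 <= J z <= 1 by rewrite /J indicE; case: (_ \in _); rewrite ?lexx ?ler01.
have J0 z : 0 <= J z by have /andP[] := J01 z.
pose g z := Num.sg (trunc k u z) * `|trunc k u z| `^ (p - 1) * J z.
have gC : bdd_meas (k.+1%:R `^ (p - 1)) g.
  split.
    apply: measurable_funM => //; apply: measurable_funM; last exact: measurable_powF.
    rewrite (_ : (fun x => Num.sg _) = (fun x => if 0 < trunc k u x then 1 else if trunc k u x < 0 then -1 else 0)).
      by apply: measurable_fun_ifT => //; [|apply: measurable_fun_ifT => //]; exact: measurable_fun_ltr.
    by apply/funext => x; case: sgrP.
  move=> z; rewrite /g !normrM (ger0_norm (powR_ge0 _ _)) (ger0_norm (J0 z)).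
  have h1 : `|trunc k u z| `^ (p - 1) <= k.+1%:R `^ (p - 1).
    by apply: ge0_ler_powR; rewrite ?nnegrE ?trunc_le// ltW.
  have h2 : `|Num.sg (trunc k u z)| <= 1 by rewrite normr_sg; case: eqP.
  have /andP[_ h3] := J01 z.
  apply: (@le_trans _ _ (1 * (k.+1%:R `^ (p - 1)) * 1)); last by rewrite mulr1 mul1r.
  by rewrite ler_pM ?mulr_ge0 ?powR_ge0// ler_pM ?powR_ge0.
have iJ : leb.-integrable cell (EFin \o (\1_E : S -> R)).
  apply: (@intg_bounded _ _ _ leb cell measurable_cell _ 1).
  - exact: leb_cell_lty.
  - exact: measurable_funTS (measurable_indic _).
  - by move=> x _; have := I1 (x, point).
have ugE z : u z * g z = J z * `|trunc k u z| `^ p.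
  rewrite /g mulrA mulrCA mulrC -[RHS]/(J z * _); congr (_ * _).
  have [uk|uk] := leP `|u z| k.+1%:R; last first.
    by rewrite /trunc leNgt uk /= sgr0 normr0 [RHS]powR0 ?gt_eqF// mul0r.
  by rewrite /trunc uk mulrA -normrEsg [RHS]powR_split//.
pose q := p / (p - 1).
have q0 : 0 < q by rewrite divr_gt0.
have pq : p^-1 + q^-1 = 1.
  by rewrite /q invf_div; field; rewrite gt_eqF.
have ugi : intg (fun z => J z * `|trunc k u z| `^ p).
  rewrite (_ : (fun z => _) = (fun z => u z * g z)); last by apply/funext => z; rewrite ugE.
  exact: (@bdd_meas_intgM _ _ _ prodm D measurable_D _ _ _ iu gC).
pose L := \int[leb]_(x in cell) (\1_E x : R).
pose I := II (fun z => J z * `|trunc k u z| `^ p).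
have bound n : II (fun z => f n z * g z) <= L / p + I / q.
  have [wi wle] := weighted_unit_ball (fB n) (measurable_indic mE) (fun x => ler0n _ _) iJ.
  have [mfn _] := fB n.
  apply: (@le_trans _ _ (II (fun z => p^-1 * (J z * `|f n z| `^ p) + q^-1 * (J z * `|trunc k u z| `^ p)))).
    apply: le_trans (ler_norm _) _; apply: norm_Rint_le.
    - exact: measurable_D.
    - by apply: measurable_funTS; apply: measurable_funM => //; case: gC.
    - by apply: intgD; [exact: measurable_D|apply: intgZ => //; exact: measurable_D
         |apply: intgZ => //; exact: measurable_D].
    - move=> z _; rewrite /g !normrM (ger0_norm (J0 z)) (ger0_norm (powR_ge0 _ _)).
      rewrite [leRHS](_ : _ = (`|f n z| `^ p / p + `|trunc k u z| `^ p / q) * J z); last by ring.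
      rewrite mulrA ler_wpM2r//.
      have h2 : `|Num.sg (trunc k u z)| <= 1 by rewrite normr_sg; case: eqP.
      apply: (@le_trans _ _ (`|f n z| * `|trunc k u z| `^ (p - 1))).
        by rewrite ler_wpM2l// -[leRHS]mul1r ler_wpM2r// powR_ge0.
      have := @conjugate_powR _ _ (`|trunc k u z| `^ (p - 1)) p q (normr_ge0 (f n z)) (powR_ge0 _ _) p0 q0 pq.
      by rewrite -powRrM /q [(p - 1) * _]mulrCA divff ?gt_eqF// mulr1.
  rewrite RintegralD; first last.
  - by apply: intgZ => //; exact: measurable_D.
  - by apply: intgZ => //; exact: measurable_D.
  - exact: measurable_D.
  rewrite !RintegralZl//; try exact: measurable_D.
  by rewrite mulrC [q^-1 * _]mulrC lerD2r ler_wpM2r// invr_ge0 ltW.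
have IL : I <= L.
  have h : I <= L / p + I / q.
    have := fu _ g (powR_ge0 _ _) gC.
    under [in X in _ --> X -> _]eq_Rintegral do rewrite ugE.
    by move=> h; exact: (cvg_ub _ h bound).
  have : I / p <= L / p.
    have -> : I / p = I - I / q by rewrite -[X in X - _]mulr1 -pq mulrDr addrK.
    by rewrite lerBlDr.
  by rewrite ler_pM2r// invr_gt0.
have IE : I = \int[leb]_(x in cell) (\1_E x * Y x).
  rewrite /I -fubini_cell//; apply: eq_Rintegral => x _.
  by rewrite /J/= RintegralZl.
have iEY : leb.-integrable cell (EFin \o (fun x => (\1_E x : R) * Y x)).
  apply: (@intg_bounded _ _ _ leb cell measurable_cell _ (k.+1%:R `^ p)).
  - exact: leb_cell_lty.
  - by apply: measurable_funM; apply: measurable_funTS; [exact: measurable_indic|exact: mY].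
  - move=> x _; rewrite normrM -[leRHS]mul1r; apply: ler_pM => //.
      exact: (I1 (x, point)).
    have Y0 : 0 <= Y x by apply: Rintegral_ge0 => w _; exact: powR_ge0.
    rewrite ger0_norm//; apply: (@le_trans _ _ (\int[P]_w (k.+1%:R `^ p))).
      apply: le_Rintegral => //; apply: (@intg_bounded _ _ _ P setT measurableT _ (k.+1%:R `^ p)) => //.
        exact: P_lty.
      by move=> w _; rewrite ger0_norm ?powR_ge0.
    by rewrite Rintegral_cst// (_ : fine _ = 1) ?mulr1//; exact: (congr1 fine (probability_setT P)).
have iEY1 : leb.-integrable cell (EFin \o (fun x => (\1_E x : R) * Y x - \1_E x)).
  exact: (@intgB _ _ _ leb cell measurable_cell).
have : {ae leb, forall x, cell x -> \1_E x * Y x - \1_E x = 0}.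
  apply: (Rint0_ae measurable_cell iEY1).
    move=> x _; rewrite indicE; have [|] := boolP (x \in E); last by rewrite mul0r subr0.
    by rewrite inE /E/= => /ltW; rewrite mul1r subr_ge0.
  by rewrite RintegralB// -IE subr_le0.
apply: filterS => x h xc; have := h xc; rewrite indicE.
rewrite -[leLHS]fineK; last by apply: integrable_fin_num => //; exact: ix.
rewrite lee_fin -[leLHS]/(Y x); have [|/negP] := boolP (x \in E).
  by move=> _ /eqP; rewrite mul1r subr_eq0 => /eqP ->.
by rewrite inE /E/= => /negP; rewrite -leNgt.
Qed.

(** Outside one null set common to all [k], the truncations satisfy the bound, and [|trunc k u| ^ p]
    increases to [|u| ^ p]. *)
Lemma weak_limit_unit_ball p (u : S * T -> R) (f : nat -> S * T -> R) : 1 < p ->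
  (forall n, unit_ball p (f n)) -> measurable_fun setT u -> intg u ->
  (forall C g, 0 <= C -> bdd_meas C g ->
    II (fun z => f n z * g z) @[n --> \oo] --> II (fun z => u z * g z)) ->
  unit_ball p u.
Proof.
move=> p1 fB mu_ iu fu; split => //.
have p0 : 0 < p by rewrite (lt_trans _ p1).
have : {ae leb, forall x, forall k, cell x -> (\int[P]_w (`|trunc k u (x, w)| `^ p)%:E <= 1)%E}.
  apply/ae_foralln => k; by have [] := unit_ball_trunc k p1 fB mu_ iu fu.
apply: filterS => x h xc.
have mt k : measurable_fun (setT : set T) (fun w => (`|trunc k u (x, w)| `^ p)%:E).
  apply/measurable_EFinP; apply: (measurableT_comp (measurable_powF p (measurable_trunc k mu_))).
  exact: measurable_pair1.
have mono w : {homo (fun k => (`|trunc k u (x, w)| `^ p)%:E) : k k' / (k <= k')%N >-> (k <= k')%E}.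
  move=> k k' kk'; rewrite lee_fin; apply: ge0_ler_powR; rewrite ?nnegrE ?(ltW p0)//.
  rewrite /trunc; have [uk|_] := leP `|u (x, w)| k.+1%:R; last by rewrite normr0.
  by rewrite ifT// (le_trans uk)// ler_nat.
have E w : (`|u (x, w)| `^ p)%:E = limn (fun k => (`|trunc k u (x, w)| `^ p)%:E).
  apply/esym/cvg_lim => //; apply: cvg_near_cst.
  exists (Num.trunc `|u (x, w)|) => // k /= hk; rewrite /trunc ifT//.
  have /andP[_ /ltW] := truncn_itv (normr_ge0 (u (x, w))).
  by move/le_trans; apply; rewrite ler_nat ltnS.
under eq_integral do rewrite E.
have cv := cvg_monotone_convergence (mu := P) measurableT mt
   (fun n w _ => ltac:(rewrite lee_fin; exact: powR_ge0)) (fun w _ => mono w).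
rewrite -(cvg_lim _ cv)//; apply: lime_le; first by apply/cvg_ex; eexists; exact: cv.
by apply: nearW => k; exact: h.
Qed.

Lemma unit_ball_cst1 p : unit_ball p (fun=> 1).
Proof.
split; first exact: measurable_cst.
apply: aeW => x _; under eq_integral do rewrite normr1 powR1.
by rewrite integral_cst// mul1e probability_le1.
Qed.

(* Young's inequality between [delta |F|] and [|psi| / delta]. *)
Lemma mixed_norm_tight p q (f : nat -> S * T -> R) u psi (s : S -> R) :
  0 < p -> 0 < q -> p^-1 + q^-1 = 1 ->
  (forall n, unit_ball p (f n)) -> unit_ball p u -> unit_ball q psi ->
  measurable_fun setT s -> (forall x, 0 <= s x) -> leb.-integrable cell (EFin \o s) ->
  tight prodm D f u (fun z => s z.1 * psi z).
Proof.
move=> p0 q0 pq fB uB psiB ms s0 is_; have [mpsi _] := psiB.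
have ms1 : measurable_fun setT (fun z : S * T => s z.1) by exact: measurableT_comp.
have mphi : measurable_fun setT (fun z : S * T => s z.1 * psi z) by exact: measurable_funM.
have [iH _] := weighted_unit_ball psiB ms s0 is_.
pose H z := s z.1 * `|psi z| `^ q.
have iZ k (h : S * T -> R) : intg h -> intg (fun z => k * h z).
  by move=> ih; apply: intgZ => //; exact: measurable_D.
have iD (h h' : S * T -> R) : intg h -> intg h' -> intg (fun z => h z + h' z).
  by move=> ih; apply: intgD => //; exact: measurable_D.
have q1 : q^-1 <= 1 by rewrite -pq lerDr invr_ge0 ltW.
have p1 : p^-1 <= 1 by rewrite -pq lerDl invr_ge0 ltW.
have young F z delta : 0 < delta -> `|F z * (s z.1 * psi z)| <=
    delta `^ p * (s z.1 * `|F z| `^ p) + delta^-1 `^ q * H z.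
  move=> d0; rewrite /H !normrM (ger0_norm (s0 _)).
  have dF : 0 <= delta * `|F z| by rewrite mulr_ge0// ltW.
  have dp : 0 <= delta^-1 * `|psi z| by rewrite mulr_ge0// invr_ge0 ltW.
  have := conjugate_powR dF dp p0 q0 pq.
  rewrite !powRM ?invr_ge0 ?(ltW d0)// => h.
  have -> : `|F z| * (s z.1 * `|psi z|) = s z.1 * (delta * `|F z| * (delta^-1 * `|psi z|)).
    by field; rewrite gt_eqF.
  rewrite (_ : delta `^ p * _ + _ = s z.1 * (delta `^ p * `|F z| `^ p + delta^-1 `^ q * `|psi z| `^ q)); last by ring.
  rewrite ler_wpM2l//; apply: (le_trans h).
  by rewrite lerD// ler_piMr// mulr_ge0// powR_ge0.
have iF F : unit_ball p F -> intg (fun z => F z * (s z.1 * psi z)).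
  move=> FB; have [iFp _] := weighted_unit_ball FB ms s0 is_.
  have i2 := iD _ _ (iZ (1 `^ p) _ iFp) (iZ (1^-1 `^ q) _ iH).
  apply: (@intg_le _ _ _ mu D measurable_D _ _ _ i2).
    by apply: measurable_funTS; apply: measurable_funM => //; case: FB.
  by move=> z _; exact: young.
pose S0 := \int[leb]_(x in cell) s x.
have S00 : 0 <= S0 by apply: Rintegral_ge0 => x _.
have mK K : measurable_fun setT (fun z : S * T => (K < `|s z.1 * psi z|)%R%:R : R).
  exact: measurable_gtK.
have K01 K z : 0 <= ((K < `|s z.1 * psi z|)%R%:R : R) <= 1 by case: (K < _); rewrite ?lexx ?ler01.
pose tl K := II (fun z => H z * (K < `|s z.1 * psi z|)%R%:R).
have iHK K : intg (fun z => H z * (K < `|s z.1 * psi z|)%R%:R).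
  apply: (@intgM _ _ _ mu D measurable_D _ _ 1) => //.
    exact: measurable_funTS.
  by move=> z _; have /andP[h1 h2] := K01 K z; rewrite ger0_norm.
(* Dominated convergence: [H] is integrable, and at each point the indicator vanishes as soon as the
   level passes [|s * psi|]. *)
have tl0 : tl n%:R @[n --> \oo] --> 0.
  have -> : (0 : R) = II (fun=> 0) by rewrite Rintegral_cst ?mul0r//; exact: measurable_D.
  apply: (@Rint_dct _ _ _ mu D measurable_D _ _ (fun z => `|H z|)).
  - by move=> n; exact: (intg_meas (iHK _)).
  - exact: measurable_cst.
  - apply: aeW => z _; apply: cvg_near_cst.
    exists (Num.trunc `|s z.1 * psi z|).+1 => // k /= hk; rewrite ltNge.
    have /andP[_ /ltW] := truncn_itv (normr_ge0 (s z.1 * psi z)).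
    by move=> /le_trans -> ; rewrite ?mulr0// ler_nat.
  - by apply: intg_norm.
  - move=> n z _; rewrite normrM ler_piMr//.
    by have /andP[h1 h2] := K01 n%:R z; rewrite ger0_norm.
have tail F K delta : unit_ball p F -> 0 < delta ->
    II (fun z => `|F z * (s z.1 * psi z)| * (K < `|s z.1 * psi z|)%R%:R) <=
    delta `^ p * S0 + delta^-1 `^ q * tl K.
  move=> FB d0; have [iFp Fp] := weighted_unit_ball FB ms s0 is_.
  have i1 := iZ (delta `^ p) _ iFp; have i2 := iZ (delta^-1 `^ q) _ (iHK K).
  apply: (@le_trans _ _ (II (fun z => delta `^ p * (s z.1 * `|F z| `^ p) +
      delta^-1 `^ q * (H z * (K < `|s z.1 * psi z|)%R%:R)))).
    apply: le_Rintegral.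
    - exact: measurable_D.
    - apply: (@intgM _ _ _ mu D measurable_D _ _ 1).
      + by apply: intg_norm; exact: iF.
      + exact: measurable_funTS.
      + by move=> z _; have /andP[h1 h2] := K01 K z; rewrite ger0_norm.
    - exact: (iD _ _ i1 i2).
    - move=> z _; have /andP[h1 h2] := K01 K z.
      have h := young F z _ d0; apply: (le_trans (ler_wpM2r h1 h)).
      rewrite mulrDl; apply: lerD; last by rewrite mulrA.
      by rewrite ler_piMr// mulr_ge0 ?powR_ge0// mulr_ge0// powR_ge0.
  rewrite RintegralD//; last exact: measurable_D.
  rewrite !RintegralZl//; try exact: measurable_D.
  by rewrite lerD2r ler_wpM2l// powR_ge0.
split=> //.
- have := iF _ (unit_ball_cst1 p); rewrite (_ : (fun z => _) = fun z => s z.1 * psi z)//.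
  by apply/funext => z; rewrite mul1r.
- by move=> n; exact: (iF _ (fB n)).
- exact: (iF _ uB).
(* The order of choices matters: [delta] makes the term [delta ^ p * S0], common to the whole unit
   ball, at most [e / 2]; only then is the level chosen, to beat the factor [delta^-1 ^ q] in front
   of the tail of the fixed function [H]. *)
move=> e e0; pose delta := (e / 2 / (S0 + 1)) `^ p^-1.
have S01 : 0 < S0 + 1 by rewrite ltr_wpDl.
have e2 : 0 < e / 2 by rewrite divr_gt0.
have d0 : 0 < delta by rewrite powR_gt0// divr_gt0.
have dpE : delta `^ p = e / 2 / (S0 + 1).
  have pn0 : p != 0 by rewrite gt_eqF.
  by rewrite /delta -powRrM mulVf// powRr1// divr_ge0 ?ltW.
have dS : delta `^ p * S0 <= e / 2.
  by rewrite dpE mulrAC ler_pdivrMr// ler_wpM2l ?(ltW e2)// lerDl.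
have q2 : 0 < delta^-1 `^ q by rewrite powR_gt0// invr_gt0.
have e3 : 0 < e / 2 / delta^-1 `^ q by rewrite divr_gt0.
have /cvgrPdist_le /(_ _ e3) [N _ /(_ N (leqnn N))] := tl0.
rewrite /= sub0r normrN => hN.
have hN2 : delta^-1 `^ q * tl N%:R <= e / 2.
  rewrite mulrC -ler_pdivlMr//; exact: le_trans (ler_norm _) hN.
exists N%:R; split; first exact: ler0n.
- by move=> n; apply: (le_trans (tail _ _ _ (fB n) d0)); rewrite [leRHS](splitr e) lerD.
- by apply: (le_trans (tail _ _ _ uB d0)); rewrite [leRHS](splitr e) lerD.
Qed.

Notation N q phi := (fun x : S => Lnorm P q%:E (EFin \o (fun w => phi (x, w)))).

Lemma LnormE q (h : T -> R) : Lnorm P q%:E (EFin \o h) = ((\int[P]_w (`|h w| `^ q)%:E) `^ q^-1)%E.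
Proof. by rewrite unlock/=; congr (_ `^ _)%E; apply: eq_integral => w _. Qed.

Lemma measurable_Lnorm q (phi : S * T -> R) : measurable_fun setT phi ->
  measurable_fun setT (N q phi).
Proof.
move=> mphi; rewrite (_ : N q phi = fun x => ((\int[P]_w (`|phi (x, w)| `^ q)%:E) `^ q^-1)%E); last first.
  by apply/funext => x; exact: LnormE.
apply: (measurableT_comp (measurable_poweR q^-1)).
apply: (@measurable_eint (fun z => `|phi z| `^ q)); first exact: measurable_powF.
by move=> z; exact: powR_ge0.
Qed.

(** From [t <= 1 + t ^ 2] on a cell of finite measure. It admits the test functions of the [L^2]
    statement among those of the weak-* statement. *)
Lemma Lnorm_L2_L1 q (phi : S * T -> R) : measurable_fun setT phi ->
  (\int[leb]_(x in cell) (N q phi x * N q phi x) < +oo)%E ->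
  (\int[leb]_(x in cell) N q phi x < +oo)%E.
Proof.
move=> mphi; have mN := measurable_Lnorm q mphi.
move=> h; apply: (@le_lt_trans _ _ (\int[leb]_(x in cell) (1 + N q phi x * N q phi x))%E).
  apply: ge0_le_integral => //.
  - by move=> x _; exact: Lnorm_ge0.
  - exact: measurable_funTS.
  - by apply: measurable_funTS; apply: emeasurable_funD => //; exact: emeasurable_funM.
  - move=> x _; have := Lnorm_ge0 P q%:E (EFin \o (fun w => phi (x, w))).
    move: (Lnorm P q%:E (EFin \o (fun w => phi (x, w)))) => -[r| |]; [|by move=> _; rewrite mulyy addey|by []].
    rewrite lee_fin -EFinM -EFinD lee_fin => r0.
    have [r1|r1] := leP r 1; first by rewrite (le_trans r1)// lerDl mulr_ge0.
    by rewrite (@le_trans _ _ (r * r))// ?lerDr// ler_peMr// ltW.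
rewrite ge0_integralD//; first last.
- by apply: measurable_funTS; exact: emeasurable_funM.
- by move=> x _; rewrite mule_ge0// Lnorm_ge0.
rewrite [X in (X + _)%E](_ : _ = 1%E); last by rewrite integral_cst// mul1e; exact: leb_cell.
exact: lte_add_pinfty (ltry _) h.
Qed.

(** Take [s = N + 1] and [psi = phi / s]: adding [1] avoids dividing by zero where the section
    vanishes and costs nothing in integrability. The points where [N] is infinite form a null
    set. *)
Lemma unit_ball_factor q (phi : S * T -> R) : 0 < q -> measurable_fun setT phi ->
  (\int[leb]_(x in cell) N q phi x < +oo)%E ->
  exists (s : S -> R) psi, [/\ measurable_fun setT s, forall x, 0 <= s x,
    leb.-integrable cell (EFin \o s), unit_ball q psi & phi = fun z => s z.1 * psi z].
Proof.
move=> q0 mphi hN; have mN := measurable_Lnorm q mphi.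
have N0 x : (0 <= N q phi x)%E by exact: Lnorm_ge0.
have iN : leb.-integrable cell (N q phi).
  apply/integrableP; split; first exact: measurable_funTS.
  by under eq_integral do rewrite gee0_abs//.
pose s x := fine (N q phi x) + 1.
have s0 x : 0 < s x by rewrite ltr_wpDl// fine_ge0.
have ms : measurable_fun setT s.
  by apply: measurable_funD => //; exact: measurableT_comp.
have ms1 : measurable_fun setT (fun z : S * T => (s z.1)^-1).
  rewrite (_ : (fun z => _) = (fun x => x `^ (-1)) \o (fun z : S * T => s z.1)).
    by apply: (measurableT_comp (measurable_powR _)); exact: measurableT_comp.
  by apply/funext => z /=; rewrite powR_inv1// ltW.
have mpsi : measurable_fun setT (fun z : S * T => (s z.1)^-1 * phi z) by exact: measurable_funM.
exists s, (fun z => (s z.1)^-1 * phi z); split => //.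
- by move=> x; rewrite ltW.
- apply: (@intgD _ _ _ leb cell measurable_cell); last first.
    by apply: (@intg_bounded _ _ _ leb _ measurable_cell _ 1) => //; [exact: leb_cell_lty|move=> x _; rewrite normr1].
  apply: (@le_integrable _ _ _ leb _ measurable_cell _ (N q phi)) => //.
    by apply/measurable_EFinP; apply: measurable_funTS; exact: measurableT_comp.
  by move=> x _ /=; move: (Lnorm P q%:E (EFin \o (fun w => phi (x, w)))) => -[r| |]//=; rewrite normr0 leey.
- split => //; have := integrable_ae measurable_cell iN.
  apply: filterS => x h xc; have := h xc => fN.
  have E w : (`|(s x)^-1 * phi (x, w)| `^ q)%:E = (((s x)^-1 `^ q)%:E * (`|phi (x, w)| `^ q)%:E)%E.
    by rewrite normrM powRM// gtr0_norm ?invr_gt0// EFinM.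
  rewrite (@eq_integral _ _ _ P setT (fun w => ((s x)^-1 `^ q)%:E * (`|phi (x, w)| `^ q)%:E)%E); last first.
    by move=> w _; rewrite /= E.
  rewrite ge0_integralZl//; first last.
  + by rewrite lee_fin powR_ge0.
  + by apply/measurable_EFinP; apply: (measurableT_comp (measurable_powF q mphi)); exact: measurable_pair1.
  have -> : (\int[P]_w (`|phi (x, w)| `^ q)%:E = (N q phi x) `^ q)%E.
    by rewrite powR_Lnorm ?gt_eqF//; apply: eq_integral => w _.
  rewrite -(fineK fN) poweR_EFin -EFinM lee_fin -powRM ?invr_ge0 ?fine_ge0 ?(ltW (s0 x))//.
  have -> : 1 = 1 `^ q :> R by rewrite powR1.
  apply: ge0_ler_powR; rewrite ?nnegrE ?(ltW q0)//.
    by rewrite mulr_ge0 ?invr_ge0 ?fine_ge0 ?(ltW (s0 x)).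
  by rewrite mulrC ler_pdivrMr// mul1r lerDl.
- by apply/funext => z; rewrite mulVKf// gt_eqF.
Qed.

Lemma ae_section2_prod F : measurable_fun setT F ->
  {ae P, forall w, {ae leb, forall x, cell x -> F (x, w) = 0}} ->
  {ae mu, forall z, D z -> F z = 0}.
Proof.
move=> mF h; have mEF : measurable_fun setT (fun z => `|F z|%:E).
  by apply/measurable_EFinP; exact: measurableT_comp.
have mx w : measurable_fun (setT : set S) (fun x => `|F (x, w)|%:E).
  by apply: (measurableT_comp mEF); exact: measurable_pair2.
have : (\int[mu]_(z in D) `|(F z)%:E| = 0)%E.
  rewrite [LHS](@tonelli_cell' (fun z => `|F z|%:E))//.
  rewrite [LHS](@ae_eq_integral _ _ _ P setT (cst 0%E))//.
  - by rewrite integral_cst// mul0e.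
  - rewrite (_ : (fun w => _) = fun w => \int[leb]_x ((fun z => `|F z|%:E) \_ D (x, w)))%E.
      apply: measurable_fun_fubini_tonelli_G => //.
        by apply/(measurable_restrictT _ measurable_D); exact: measurable_funTS.
      by move=> z; rewrite patchE; case: ifP.
    apply/funext => w; rewrite integral_mkcond; apply: eq_integral => x _; rewrite !patchE.
    case: ifPn => [|/negP] xD; case: ifPn => [|/negP] xc //.
      by exfalso; apply: xc; rewrite inE; split=> //; exact: set_mem.
    by exfalso; apply: xD; rewrite inE; move: xc; rewrite inE => -[].
  - apply: filterS h => w h _; rewrite (@ae_eq_integral _ _ _ leb cell (cst 0%E))//.
    + by rewrite integral_cst// mul0e.
    + exact: measurable_funTS.
    + by apply: filterS h => x h xc; rewrite h// normr0.
move=> /(ae_eq_integral_abs mu measurable_D); move=> /(_ _)/wrap[].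
  by apply/measurable_EFinP; exact: measurable_funTS.
by apply: filterS => z h' Dz; have := h' Dz => -[].
Qed.

Lemma intg_cst1 : intg (fun=> 1).
Proof.
apply: (@intg_bounded _ _ _ mu D measurable_D _ 1); [exact: mu_D_lty|exact: measurable_cst|].
by move=> x _; rewrite normr1.
Qed.

Lemma II_cst1 : II (fun=> 1) = 1.
Proof.
rewrite Rintegral_cst; last exact: measurable_D.
by rewrite (_ : fine _ = 1) ?mulr1//; exact: (congr1 fine mu_D).
Qed.

Lemma L2_intg F : measurable_fun setT F -> (\int[mu]_(z in D) (F z ^+ 2)%:E < +oo)%E -> intg F.
Proof.
move=> mF F2.
have mF2 : measurable_fun setT (fun z => F z ^+ 2) by exact: measurable_funX.
have i2 : intg (fun z => F z ^+ 2).
  apply/integrableP; split; first by apply/measurable_EFinP; exact: measurable_funTS.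
  apply: le_lt_trans F2; rewrite le_eqVlt; apply/orP; left; apply/eqP.
  by apply: eq_integral => z _; rewrite /= ger0_norm ?sqr_ge0.
apply: (@intg_le _ _ _ mu D measurable_D _ _ _ (intgD measurable_D intg_cst1 i2)).
  exact: measurable_funTS.
move=> z _; rewrite -[X in _ <= _ + X]real_normK ?num_real//; nra.
Qed.

(** [A1] is a version of [A] that is elliptic at every point. Dividing the constant flux by it and
    integrating gives [c * \int 1 / A1 = 1], since [g + 1] has mean one. *)
Lemma flux_harmonic_mean (A A1 g : S * T -> R) (alpha beta c : R) : measurable_fun setT A1 ->
  0 < alpha -> (forall z, alpha <= A1 z <= beta) ->
  {ae mu, forall z, D z -> A z * (g z + 1) = c} ->
  {ae mu, forall z, D z -> A z - A1 z = 0} ->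
  measurable_fun setT g -> intg g -> II g = 0 ->
  c = (II (fun z => (A1 z)^-1))^-1 /\ {ae mu, forall z, D z -> g z + 1 = c / A1 z}.
Proof.
move=> mA1 a0 A1b hD AD mg ig g0.
have A1_gt0 z : 0 < A1 z by have /andP[/(lt_le_trans a0)] := A1b z.
have gE : {ae mu, forall z, D z -> g z + 1 = c / A1 z}.
  apply: filterS2 hD AD => z h1 h2 Dz; rewrite -(h1 Dz).
  have /eqP := h2 Dz; rewrite subr_eq0 => /eqP ->.
  by rewrite mulrC mulKf// gt_eqF.
have minv : measurable_fun setT (fun z => (A1 z)^-1) by exact: measurable_inv_fun.
have iinv : intg (fun z => (A1 z)^-1).
  apply: (@intg_bounded _ _ _ mu _ measurable_D _ alpha^-1).
  - exact: mu_D_lty.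
  - exact: measurable_funTS.
  - move=> z _; rewrite ger0_norm ?invr_ge0 ?(ltW (A1_gt0 _))// lef_pV2 ?posrE//.
    by have /andP[] := A1b z.
have kc : II (fun z => c * (A1 z)^-1) = 1.
  rewrite -(@Rint_ae _ _ _ mu D measurable_D (fun z => g z + 1)).
  - by rewrite RintegralD//; [rewrite II_cst1 g0 add0r|exact: measurable_D|exact: intg_cst1].
  - by apply: measurable_funTS; exact: measurable_funD.
  - by apply: measurable_funTS; exact: measurable_funM.
  - exact: gE.
rewrite RintegralZl// in kc; last exact: measurable_D.
have c0 : c != 0 by apply/eqP => c0; move: kc; rewrite c0 mul0r => /esym/eqP; rewrite oner_eq0.
split=> //; apply: invr_inj; rewrite invrK; apply: (mulfI c0); rewrite kc divff//.
Qed.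

Lemma fubini_ae F G : measurable_fun setT F -> intg G ->
  {ae mu, forall z, D z -> G z = F z} -> \int[leb]_(x in cell) \int[P]_w F (x, w) = II G.
Proof.
move=> mF iG FG; have mFD := measurable_funTS mF.
have iF : intg F by apply: (intg_ae measurable_D iG).
rewrite fubini_cell//; apply/esym; apply: Rint_ae => //; first exact: measurable_D.
exact: intg_meas iG.
Qed.

Lemma ae_intg_section1 F : intg F -> {ae leb, forall x, cell x -> P.-integrable setT (EFin \o (fun w => F (x, w)))}.
Proof.
move=> /intg_restr /ae_integrable1; apply: filterS => x h xc; move: h.
rewrite (_ : (fun w => _) = EFin \o (fun w => F (x, w)))//.
by apply/funext => w /=; rewrite patchE mem_set.
Qed.

Lemma ae_intg_section2 F : intg F -> {ae P, forall w, leb.-integrable cell (EFin \o (fun x => F (x, w)))}.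
Proof.
move=> /intg_restr /ae_integrable2; apply: filterS => w h.
apply: (iffRL (integrable_mkcond _ measurable_cell)); move: h.
rewrite (_ : (fun x => _) = ((EFin \o (fun x => F (x, w))) \_ cell))//.
apply/funext => x /=; rewrite !patchE; case: ifPn => [|/negP] xD; case: ifPn => [|/negP] xc //.
  by exfalso; apply: xc; move: xD; rewrite !inE => -[].
by exfalso; apply: xD; rewrite inE; split=> //; exact: set_mem.
Qed.

Lemma measurable_pint F : measurable_fun setT F ->
  measurable_fun (setT : set S) (fun x => \int[P]_w F (x, w)).
Proof.
move=> mF; have mEF : measurable_fun setT (EFin \o F) by exact/measurable_EFinP.
have m1 : measurable_fun setT (fubini_F P (EFin \o F)^\+%E).
  by apply: measurable_fun_fubini_tonelli_F => //; exact: measurable_funepos.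
have m2 : measurable_fun setT (fubini_F P (EFin \o F)^\-%E).
  by apply: measurable_fun_fubini_tonelli_F => //; exact: measurable_funeneg.
rewrite (_ : (fun x => _) = fine \o (fubini_F P (EFin \o F)^\+%E \- fubini_F P (EFin \o F)^\-%E)%E).
  by apply: measurableT_comp => //; exact: emeasurable_funB.
apply/funext => x /=; rewrite /Rintegral integralE; congr (fine (_ - _)%E); apply: eq_integral => w _.
- by rewrite !funeposE.
- by rewrite !funenegE.
Qed.

Lemma Lnorm_leP (q : R) (h : T -> R) C : 0 < q -> 0 <= C -> measurable_fun setT h ->
  (Lnorm P q%:E (EFin \o h) <= C%:E)%E <-> (\int[P]_w (`|h w| `^ q)%:E <= (C `^ q)%:E)%E.
Proof.
move=> q0 C0 mh; have I0 : (0 <= \int[P]_w (`|h w| `^ q)%:E)%E.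
  by apply: integral_ge0 => w _; rewrite lee_fin powR_ge0.
have IE : (\int[P]_w (`|h w| `^ q)%:E = (Lnorm P q%:E (EFin \o h)) `^ q)%E.
  by rewrite powR_Lnorm ?gt_eqF//; apply: eq_integral => w _.
have N0 := Lnorm_ge0 P q%:E (EFin \o h).
split=> [|].
  rewrite IE; move: (Lnorm P q%:E (EFin \o h)) N0 => [r| |]//.
  rewrite poweR_EFin !lee_fin => r0 rC.
  by apply: ge0_ler_powR => //; exact: ltW.
rewrite LnormE; move: (\int[P]_w _)%E I0 => [r| |]//.
rewrite poweR_EFin !lee_fin => r0 rC.
have -> : C = (C `^ q) `^ q^-1 by rewrite -powRrM mulfV ?gt_eqF// powRr1.
by apply: ge0_ler_powR; rewrite ?nnegrE ?powR_ge0// invr_ge0 ltW.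
Qed.

(** Based on [s + t <= 2 * max s t], which gives [(s + t) ^ q <= 2 ^ q * (s ^ q + t ^ q)] for every
    [q > 0], convex or not. *)
Lemma powR_affine_le q (h v : T -> R) k1 k2 : 0 < q -> 0 <= k1 -> 0 <= k2 ->
  measurable_fun setT h -> measurable_fun setT v ->
  (forall w, `|h w| <= k1 + k2 * `|v w|) -> (\int[P]_w (`|v w| `^ q)%:E <= 1)%E ->
  (\int[P]_w (`|h w| `^ q)%:E <= (2 `^ q * (k1 `^ q + k2 `^ q))%:E)%E.
Proof.
move=> q0 k10 k20 mh mv hv v1.
have mvq : measurable_fun setT (fun w => `|v w| `^ q).
  by apply: (measurableT_comp (measurable_powR q)); exact: measurableT_comp.
have mhq : measurable_fun setT (fun w => `|h w| `^ q).
  by apply: (measurableT_comp (measurable_powR q)); exact: measurableT_comp.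
have mr : measurable_fun setT (fun w => k1 `^ q + k2 `^ q * `|v w| `^ q).
  by apply: measurable_funD => //; exact: measurable_funM.
apply: (@le_trans _ _ (\int[P]_w ((2 `^ q)%:E * (k1 `^ q + k2 `^ q * `|v w| `^ q)%:E))%E).
  apply: ge0_le_integral => //.
  - exact/measurable_EFinP.
  - by apply: emeasurable_funM => //; exact/measurable_EFinP.
  - move=> w _; rewrite -EFinM lee_fin.
    have kv : 0 <= k2 * `|v w| by rewrite mulr_ge0.
    apply: (@le_trans _ _ ((2 * Num.max k1 (k2 * `|v w|)) `^ q)).
      apply: ge0_ler_powR; rewrite ?nnegrE ?(ltW q0)//.
        by rewrite mulr_ge0// le_max k10.
      rewrite (le_trans (hv w))// mulr_natl mulr2n lerD// le_max lexx ?orbT//.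
    rewrite powRM ?le_max ?k10// ler_wpM2l ?powR_ge0// -powRM//.
    by case: (leP k1 (k2 * `|v w|)) => _; rewrite ?lerDl ?lerDr powR_ge0.
have c0 (k : R) : (0 <= (k `^ q)%:E)%E by rewrite lee_fin powR_ge0.
have n1 w : setT w -> (0 <= (k1 `^ q + k2 `^ q * `|v w| `^ q)%:E)%E.
  by move=> _; rewrite lee_fin addr_ge0 ?mulr_ge0 ?powR_ge0.
have n2 w : setT w -> (0 <= (k2 `^ q)%:E * (`|v w| `^ q)%:E)%E.
  by move=> _; rewrite mule_ge0.
have mE1 : measurable_fun setT (fun w => (k1 `^ q + k2 `^ q * `|v w| `^ q)%:E) by exact/measurable_EFinP.
have mE2 : measurable_fun setT (fun w => (`|v w| `^ q)%:E) by exact/measurable_EFinP.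
have mE3 : measurable_fun setT (fun w => (k2 `^ q)%:E * (`|v w| `^ q)%:E)%E by exact: emeasurable_funM.
rewrite ge0_integralZl// EFinM; apply: lee_wpmul2l => //.
under eq_integral do rewrite EFinD EFinM.
rewrite ge0_integralD// integral_cst// [X in (_ * X + _)%E](_ : _ = 1%E); last exact: probability_setT.
rewrite mule1 EFinD leeD2l// ge0_integralZl//.
by rewrite -[leRHS]mule1 lee_wpmul2l// lee_fin powR_ge0.
Qed.

End product_cell.

(** * Ergodicity and stationarity *)

Section ergodic.
Context d (T : measurableType d) (R : realType) (P : probability T R).

Lemma ae_false : {ae P, forall w : T, False} -> False.
Proof.
move=> [N [mN N0 sN]]; have : (P setT <= P N)%E.
  by apply: le_measure; rewrite ?inE// => w _; apply: sN => /= h; exact: h.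
by rewrite probability_setT N0 lee_fin ler10.
Qed.

Lemma ae_pullback (tau : T -> T) (Q : T -> Prop) : measurable_fun setT tau ->
  (forall A, measurable A -> P (tau @^-1` A) = P A) ->
  {ae P, forall w, Q w} -> {ae P, forall w, Q (tau w)}.
Proof.
move=> mt Pt [N [mN N0 sN]]; exists (tau @^-1` N); split.
- by rewrite -[X in measurable X]setTI; exact: mt.
- by rewrite Pt.
- by move=> w /= h; apply: sN => /= h'; apply: h; exact: h'.
Qed.

Context (tau : int -> T -> T) (Htau : ergodic_action P tau).

Lemma ae_tau k (Q : T -> Prop) : {ae P, forall w, Q w} -> {ae P, forall w, Q (tau k w)}.
Proof. by have [h1 h2 _ _ _] := Htau; apply: ae_pullback => // A; exact: h2. Qed.

Lemma ae_forall_int (Q : int -> T -> Prop) :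
  (forall k, {ae P, forall w, Q k w}) -> {ae P, forall w, forall k, Q k w}.
Proof.
move=> h; have : {ae P, forall w, forall n : nat, forall k, unpickle n = Some k -> Q k w}.
  apply/ae_foralln => n; case: (unpickle n) => [k|]; last exact: aeW.
  by apply: filterS (h k) => w hw _ [<-].
by apply: filterS => w hw k; apply: (hw (pickle k)); exact: pickleK.
Qed.

(** Ergodicity is stated for strictly invariant sets, while [B] is invariant only up to null sets.
    The intersection of all its translates is strictly invariant and differs from [B] by a null
    set. *)
Lemma ergodic_dichotomy (B : set T) : measurable B ->
  (forall k, {ae P, forall w, B w -> B (tau k w)}) ->
  {ae P, forall w, B w} \/ {ae P, forall w, ~ B w}.
Proof.
move=> mB inv; have [mt Pt t0 tD erg] := Htau.
pose B' := \bigcap_(k in [set: int]) tau k @^-1` B.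
have mB' : measurable B'.
  have -> : B' = \bigcap_n (if unpickle n is Some k then tau k @^-1` B else setT).
    apply/seteqP; split=> [w h n _|w h k _]; first by case: unpickle => // k; exact: h.
    by have := h (pickle k) Logic.I; rewrite pickleK.
  apply: bigcapT_measurable => n; case: unpickle => // k.
  by rewrite -[X in measurable X]setTI; exact: mt.
have B'B w : B' w -> B w by move=> /(_ 0 Logic.I); rewrite /= t0.
have B'inv k : tau k @^-1` B' = B'.
  apply/seteqP; split=> w /= h l _ /=.
    by have := h (l - k) Logic.I; rewrite /= -tD subrK.
  by rewrite -tD; exact: (h _ Logic.I).
have [P0|P1] := erg _ mB' B'inv; [right|left].
  have nB' : {ae P, forall w, ~ B' w}.
    by exists B'; split=> // w /= /contrapT.
  apply: filterS2 nB' (ae_forall_int inv) => w nB' h Bw; apply: nB' => k _ /=.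
  exact: h.
exists (~` B'); split.
- exact: measurableC.
- by rewrite probability_setC// P1 subee.
- by move=> w /= h h'; apply: h; exact: B'B.
Qed.

(** The constant is the essential supremum of [C], written as an infimum. Every level below it fails
    to bound [C] almost surely, so the dichotomy puts [C] almost surely above that level. *)
Lemma ergodic_ae_constant (C : T -> R) : measurable_fun setT C ->
  (forall k, {ae P, forall w, C (tau k w) = C w}) ->
  exists c, {ae P, forall w, C w = c}.
Proof.
move=> mC inv; pose A t := {ae P, forall w, C w <= t}.
have dich t : A t \/ {ae P, forall w, t < C w}.
  have mB : measurable [set w | C w <= t].
    by rewrite -[X in measurable X]setTI; exact: measurable_fun_ler.
  have [|h|h] := ergodic_dichotomy mB; [|by left|right].
    by move=> k; apply: filterS (inv k) => w /= ->.
  by apply: filterS h => w /= /negP; rewrite -ltNge.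
have [n An] : exists n : nat, A n%:R.
  apply: contrapT => /forallNP h; apply: ae_false.
  have : {ae P, forall w, forall n : nat, n%:R < C w}.
    by apply/ae_foralln => n; have [/h|] := dich n%:R.
  apply: filterS => w /(_ (Num.trunc `|C w|).+1).
  have /andP[_ h1] := truncn_itv (normr_ge0 (C w)).
  by move=> h2; have := lt_trans h1 h2; rewrite ltNge ler_norm.
have [k Nk] : exists k : nat, ~ A (- k%:R).
  apply: contrapT => /forallNP h; apply: ae_false.
  have : {ae P, forall w, forall n : nat, C w <= - n%:R}.
    by apply/ae_foralln => k; apply: contrapT; exact: h.
  apply: filterS => w /(_ (Num.trunc `|C w|).+1).
  have /andP[_ h1] := truncn_itv (normr_ge0 (C w)).
  rewrite lerNr => h2; have := lt_le_trans h1 h2.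
  by rewrite ltNge -normrN ler_norm.
have Aup t t' : t <= t' -> A t -> A t'.
  by move=> tt'; apply: filterS => w /le_trans; exact.
have infA : has_inf [set t | A t].
  split; first by exists n%:R.
  by exists (- k%:R) => t /= At; rewrite leNgt; apply/negP => /ltW /Aup /(_ At).
exists (inf [set t | A t]); set c := inf _.
have h1 : {ae P, forall w, forall j : nat, C w <= c + j.+1%:R^-1}.
  apply/ae_foralln => j; have j0 : 0 < j.+1%:R^-1 :> R by rewrite invr_gt0.
  by have [t At /ltW tc] := inf_adherent j0 infA; exact: Aup tc At.
have h2 : {ae P, forall w, forall j : nat, c - j.+1%:R^-1 < C w}.
  apply/ae_foralln => j; have [Aj|//] := dich (c - j.+1%:R^-1).
  have := ge_inf (proj2 infA) Aj; rewrite -/c lerBrDr gerDl leNgt invr_gt0.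
  by rewrite ltr0n.
have small (y : R) : (forall j : nat, y <= j.+1%:R^-1) -> y <= 0.
  move=> h; rewrite leNgt; apply/negP => y0.
  have [j _ /(_ j (leqnn j))] := near_infty_natSinv_lt (PosNum y0).
  by rewrite /= ltNge h.
apply: filterS2 h1 h2 => w h1 h2; apply/eqP; rewrite eq_le; apply/andP; split.
- by rewrite -subr_le0; apply: small => j; rewrite lerBlDl.
- by rewrite -subr_le0; apply: small => j; rewrite lerBlDr -lerBlDl ltW.
Qed.

End ergodic.

(** * Translations of Lebesgue measure and the covering by unit cells *)

Section translation.
Context {R : realType}.
Notation leb := (@lebesgue_measure R).

Lemma measurable_shift (a : R) : measurable_fun (setT : set (measurableTypeR R))
  (fun x : measurableTypeR R => x + a : measurableTypeR R).
Proof. exact: measurable_funD. Qed.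

Lemma lebesgue_measure_shift (a : R) (A : set (measurableTypeR R)) : measurable A ->
  leb ((fun x => x + a) @^-1` A) = leb A.
Proof.
move=> mA; rewrite (@lebesgue_measure_unique R
  (pushforward leb (fun x : measurableTypeR R => x + a : measurableTypeR R)) _ A)//; first exact: measurable_shift.
move=> _ X [[b c] /= _ <-]; rewrite /pushforward lebesgue_measure_itv/=.
have -> : (fun x => x + a) @^-1` `]b, c]%classic = `]b - a, c - a]%classic.
  by apply/seteqP; split=> x /=; rewrite !in_itv/= ltrBlDr lerBrDr.
rewrite lebesgue_measure_itv/= !lte_fin ltrD2r; case: ifP => // _.
by rewrite -!EFinB; congr EFin; ring.
Qed.

Lemma ae_shift (a : R) (Q : R -> Prop) :
  {ae leb, forall x, Q x} -> {ae leb, forall x, Q (x + a)}.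
Proof.
move=> [N [mN N0 sN]]; exists ((fun x => x + a) @^-1` N); split.
- by rewrite -[X in measurable X]setTI; exact: measurable_shift.
- by rewrite lebesgue_measure_shift.
- by move=> w /= h; apply: sN => /= h'; apply: h; exact: h'.
Qed.

Lemma ge0_integral_shift (a : R) (f : measurableTypeR R -> \bar R) : measurable_fun setT f ->
  (forall x, 0 <= f x)%E -> (\int[leb]_x f (x + a)%R = \int[leb]_x f x)%E.
Proof.
move=> mf f0; rewrite -(@ge0_integral_pushforward _ _ _ _ R _ (measurable_shift a) leb setT f)//.
apply: (eq_measure_integral leb); first exact: measurable_shift.
by move=> *; exact: lebesgue_measure_shift.
Qed.

Lemma ae_false_leb : {ae leb, forall x : R, False} -> False.
Proof.
move=> [N [mN N0 sN]]; have : (leb `[0%R, 1%R]%classic <= leb N)%E.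
  by apply: le_measure; rewrite ?inE// => w _; apply: sN => /= h; exact: h.
by rewrite lebesgue_measure_itv/= lte_fin ltr01 N0 oppr0 adde0 lee_fin ler10.
Qed.

Lemma cell_floor (y : R) : cell (y - (Num.floor (y + 2^-1))%:~R).
Proof.
rewrite /cell/= in_itv/=; have /andP[h1 h2] := floor_itv (y + 2^-1).
by rewrite intrD in h2; apply/andP; split; lra.
Qed.

Lemma ae_cells (Q : R -> Prop) :
  (forall k : int, {ae leb, forall x, cell x -> Q (x + k%:~R)}) -> {ae leb, forall x, Q x}.
Proof.
move=> h; have : {ae leb, forall x, forall n : nat, forall k : int, unpickle n = Some k ->
    cell (x - k%:~R) -> Q x}.
  apply/ae_foralln => n; case: (unpickle n) => [k|]; last exact: aeW.
  by apply: (@filterS _ _ (ae_filter_ringOfSetsType leb) _ _ _ (ae_shift (- k%:~R) (h k))) => x hx _ [<-]; rewrite subrK in hx.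
apply: (@filterS _ _ (ae_filter_ringOfSetsType leb)) => x /(_ (pickle (Num.floor (x + 2^-1)))) /(_ _ (pickleK _)); apply.
exact: cell_floor.
Qed.

End translation.

(** * Stationary fields and their constant fluxes *)

Section stationary_fields.
Context d (T : measurableType d) (R : realType) (P : probability T R).
Context (tau : int -> T -> T) (Htau : ergodic_action P tau).
Notation leb := (@lebesgue_measure R).
Notation mu := (leb \x P)%E.
Notation D := ((cell : set R) `*` (setT : set T)).

Lemma measurable_cell : measurable (cell : set (measurableTypeR R)).
Proof. exact: measurable_itv. Qed.

Lemma leb_cell : leb cell = 1%E.
Proof.
rewrite /cell lebesgue_measure_itv/= lte_fin ifT; last by lra.
by rewrite -EFinB; congr EFin; field.
Qed.

(** On the translate of the cell by [k], the field at [w] is the field on the cell at [tau k w].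
    Each [tau k] preserves null sets, and there are countably many [k]. *)
Lemma ae_stationary (Q : R -> T -> Prop) :
  (forall x k w, Q x (tau k w) -> Q (x + k%:~R) w) ->
  {ae mu, forall z, D z -> Q z.1 z.2} -> {ae P, forall w, {ae leb, forall x, Q x w}}.
Proof.
move=> Qk /ae_prod_section2 h.
have := ae_forall_int (fun k => ae_tau Htau k h).
apply: filterS => w hw; apply: ae_cells => k.
apply: (@filterS _ _ (ae_filter_ringOfSetsType leb) _ _ _ (hw k)) => x hx xc.
by apply: Qk; exact: hx.
Qed.

Lemma ae_leb_proper (a b : R) : {ae leb, forall x : R, a = b} -> a = b.
Proof.
move=> h; apply: contrapT => ab; apply: (@ae_false_leb R).
exact: (@filterS _ _ (ae_filter_ringOfSetsType leb) _ _ _ h).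
Qed.

Lemma Rint_cell_cst (f : R -> R) c : measurable_fun setT f ->
  {ae leb, forall x, f x = c} -> \int[leb]_(x in cell) f x = c.
Proof.
move=> mf fc; rewrite (@Rint_ae _ _ _ leb cell measurable_cell _ (fun=> c)).
- rewrite Rintegral_cst; last exact: measurable_cell.
  by rewrite (_ : fine _ = 1) ?mulr1//; exact: (congr1 fine leb_cell).
- exact: measurable_funTS.
- exact: measurable_cst.
- exact: (@filterS _ _ (ae_filter_ringOfSetsType leb) _ _ _ fc).
Qed.

Lemma jmeas_section (F : R -> T -> R) w : jmeas F -> measurable_fun setT (fun x => F x w).
Proof. by move=> mF; exact: (measurableT_comp (f := fun z : R * T => F z.1 z.2) mF (measurable_pair2 w)). Qed.

(** The constant attached to [w] is recovered as an integral over the cell, which makes it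
    measurable in [w]. Stationarity makes it invariant under the action. *)
Lemma stationary_flux_constant (F : R -> T -> R) : jmeas F -> stationary tau F ->
  {ae P, forall w, exists c, {ae leb, forall x, F x w = c}} ->
  exists c, {ae P, forall w, {ae leb, forall x, F x w = c}}.
Proof.
move=> mF sF h; pose C w := \int[leb]_(x in cell) F x w.
have mC : measurable_fun setT C.
  exact: (measurable_xint leb measurable_cell mF).
have FC : {ae P, forall w, {ae leb, forall x, F x w = C w}}.
  apply: filterS h => w [c hc].
  by rewrite /C (Rint_cell_cst (jmeas_section w mF) hc).
have Cinv k : {ae P, forall w, C (tau k w) = C w}.
  apply: filterS2 FC (ae_tau Htau k FC) => w h1 h2.
  apply: ae_leb_proper.
  apply: (@filterS2 _ _ (ae_filter_ringOfSetsType leb) _ _ _ _ (ae_shift k%:~R h1) h2) => x.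
  by rewrite sF => -> ->.
have [c hc] := ergodic_ae_constant Htau mC Cinv; exists c.
by apply: filterS2 FC hc => w + Cw; rewrite Cw.
Qed.

Lemma ae_cst_prod (F : R -> T -> R) c : jmeas F ->
  {ae P, forall w, {ae leb, forall x, F x w = c}} ->
  {ae mu, forall z, D z -> F z.1 z.2 = c}.
Proof.
move=> mF h.
have mFc : measurable_fun setT (fun z : measurableTypeR R * T => F z.1 z.2 - c).
  exact: measurable_funB.
have := @ae_section2_prod _ _ _ _ R leb P cell measurable_cell _ mFc.
move=> /(_ _)/wrap[].
  apply: filterS h => w h; apply: (@filterS _ _ (ae_filter_ringOfSetsType leb) _ _ _ h) => x -> _ /=.
  by rewrite subrr.
by apply: filterS => z h' Dz; apply/eqP; rewrite -subr_eq0; apply/eqP; exact: h'.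
Qed.

Lemma loc_int_cells (f : R -> R) : measurable_fun setT f ->
  (forall k : int, leb.-integrable cell (EFin \o (fun x => f (x + k%:~R)))) -> loc_int f.
Proof.
(* As [n > |r|], the cells centred at the integers from [-n] to [n] cover [[-r, r]]; there are
   [(n + n).+1] of them, whence the shift of the index by [n]. *)
move=> mf fk r; pose n := (Num.trunc `|r|).+1.
pose g (k : int) (x : R) := f x * \1_(cell : set (measurableTypeR R)) (x - k%:~R).
have mc : measurable_fun setT (\1_(cell : set (measurableTypeR R)) : _ -> R).
  exact: measurable_indic measurable_cell.
have mg k : measurable_fun setT (g k).
  apply: measurable_funM => //.
  by apply: (measurableT_comp mc); exact: (@measurable_shift R (- k%:~R)).
have ig k : leb.-integrable setT (EFin \o g k).
  apply/integrableP; split; first by apply/measurable_EFinP; exact: (mg k).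
  rewrite -(@ge0_integral_shift R k%:~R (fun x => `|(g k x)%:E|)%E); first last.
  - by move=> x; exact: abse_ge0.
  - by apply: measurableT_comp => //; apply/measurable_EFinP; exact: (mg k).
  have /integrableP[_] := fk k; apply: le_lt_trans.
  rewrite [leRHS]integral_mkcond; apply: ge0_le_integral => //.
  - apply: measurableT_comp => //; apply/measurable_EFinP.
    by apply: (measurableT_comp (mg k)); exact: measurable_shift.
  - apply/(measurable_restrictT _ measurable_cell); apply: measurable_funTS.
    apply: measurableT_comp => //; apply/measurable_EFinP.
    by apply: (measurableT_comp mf); exact: measurable_shift.
  - move=> x _; rewrite /g addrK patchE indicE /=; case: ifP => _.
      by rewrite mulr1.
    by rewrite mulr0 normr0.
have isum : leb.-integrable setT (EFin \o (fun x => \sum_(i < (n + n).+1) `|g (i%:Z - n%:Z) x|)).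
  elim: ((n + n).+1) => [|m IH].
    rewrite (_ : _ \o _ = fun=> 0%E); first exact: integrable0.
    by apply/funext => x /=; rewrite big_ord0.
  rewrite (_ : _ \o _ = EFin \o (fun x => \sum_(i < m) `|g (i%:Z - n%:Z) x| + `|g (m%:Z - n%:Z) x|)).
    by apply: intgD => //; exact: intg_norm.
  by apply/funext => x /=; rewrite big_ord_recr.
have i2 : leb.-integrable `[-r, r] (EFin \o (fun x => \sum_(i < (n + n).+1) `|g (i%:Z - n%:Z) x|)).
  exact: (integrableS measurableT _ _ isum).
apply: (intg_le _ _ i2) => //; first exact: measurable_funTS.
move=> x /=; rewrite in_itv/= => /andP[xr1 xr2].
pose k := Num.floor (x + 2^-1).
have rn : r < n%:R.
  have /andP[_ h] := truncn_itv (normr_ge0 r); exact: le_lt_trans (ler_norm r) h.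
have n1 : 1 <= n%:R :> R by rewrite ler1n.
have /andP[k1 k2] := floor_itv (x + 2^-1); rewrite -/k intrD in k1 k2.
have kn1 : - n%:Z <= k.
  by rewrite -ltzD1 -(ltr_int R) intrD mulrNz -pmulrn; lra.
have kn2 : k <= n%:Z.
  by rewrite -ltzD1 -(ltr_int R) intrD -pmulrn; lra.
have [i iE] : exists i : nat, k + n%:Z = i%:Z.
  have : 0 <= k + n%:Z by rewrite -lerBlDr sub0r.
  by case: (k + n%:Z) => // i _; exists i.
have ilt : (i < (n + n).+1)%N by rewrite ltnS -lez_nat -iE PoszD lerD2r.
rewrite (bigD1 (Ordinal ilt))//= (_ : i%:Z - n%:Z = k); last by rewrite -iE addrK.
rewrite {1}/g (_ : \1_cell _ = 1); last first.
  by rewrite indicE mem_set//; exact: cell_floor.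
by rewrite mulr1 lerDl sumr_ge0.
Qed.

(** The point [x - k] is the representative of [x] in the half-open cell [[-1/2, 1/2[], so the
    extension agrees with [u] on the closed cell except at its right endpoint. *)
Definition stationary_ext (u : R * T -> R) : R -> T -> R := fun x w =>
  let k := Num.floor (x + 2^-1) in u (x - k%:~R, tau k w).

Lemma stationary_ext_stationary u : stationary tau (stationary_ext u).
Proof.
move=> x k w; have [_ _ _ tD _] := Htau; rewrite /stationary_ext/=.
have -> : Num.floor (x + k%:~R + 2^-1) = Num.floor (x + 2^-1) + k.
  by rewrite addrAC floorDrz ?intrKfloor// intr_int.
by rewrite tD intrD; congr (u (_, _)); ring.
Qed.

Lemma stationary_ext_cell u x w : cell x -> x != 2^-1 -> stationary_ext u x w = u (x, w).
Proof.
rewrite /cell/= in_itv/= => /andP[x1 x2] xn; have [_ _ t0 _ _] := Htau.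
have x3 : x < 2^-1 by rewrite lt_neqAle xn.
rewrite /stationary_ext (@floor_def _ _ 0); first by rewrite subr0 t0.
by rewrite add0r; apply/andP; split; lra.
Qed.

Lemma stationary_ext_ae u : {ae mu, forall z, D z -> stationary_ext u z.1 z.2 = u z}.
Proof.
have h : {ae leb, forall x : R, cell x -> x != 2^-1}.
  exists [set 2^-1]; split; [exact: measurable_set1|exact: lebesgue_measure_set1|].
  by move=> x /= /not_implyP[_ /negP]; rewrite negbK => /eqP.
apply: filterS (@ae_prod_fst _ _ _ _ R leb P cell _ h) => -[x w] /= h' Dz.
by apply: stationary_ext_cell; [case: Dz|exact: h'].
Qed.

Lemma jmeas_stationary_ext u : measurable_fun setT u -> jmeas (stationary_ext u).
Proof.
move=> mu_; have [mt _ _ _ _] := Htau; rewrite /jmeas.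
pose E n := if unpickle n is Some k then
  [set z : R * T | Num.floor (z.1 + 2^-1) = (k : int)] else set0.
have fl (z : R * T) k : (Num.floor (z.1 + 2^-1) = k) <-> (k%:~R <= z.1 + 2^-1 < (k + 1)%:~R).
  by rewrite -floor_eq; split=> [->|/eqP].
have mE n : measurable (E n).
  rewrite /E; case: unpickle => [k|]; last exact: measurable0.
  rewrite (_ : [set z | _] = [set z : R * T | k%:~R <= z.1 + 2^-1] `&` [set z : R * T | z.1 + 2^-1 < (k + 1)%:~R]).
    apply: measurableI.
      rewrite -[X in measurable X]setTI; apply: measurable_fun_ler => //.
      by apply: measurable_funD => //; exact: measurable_fst.
    rewrite -[X in measurable X]setTI; apply: measurable_fun_ltr => //.
    by apply: measurable_funD => //; exact: measurable_fst.
  by apply/seteqP; split=> z /=; rewrite fl => /andP.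
have -> : [set: R * T] = \bigcup_n E n.
  apply/seteqP; split=> [z _|z _]; last exact: Logic.I.
  by exists (pickle (Num.floor (z.1 + 2^-1))); [exact: Logic.I|rewrite /E pickleK].
apply/measurable_fun_bigcup => // n.
rewrite /E; case: unpickle => [k|]; last exact: measurable_fun_set0.
have mk : measurable_fun setT (fun z : R * T => u (z.1 - k%:~R, tau k z.2)).
  apply: (measurableT_comp mu_); apply/measurable_fun_pairP; split => /=.
    by apply: measurable_funB => //; exact: measurable_fst.
  by apply: (measurableT_comp (mt k)); exact: measurable_snd.
have : measurable_fun [set z : R * T | Num.floor (z.1 + 2^-1) = k] (fun z : R * T => u (z.1 - k%:~R, tau k z.2)).
  exact: measurable_funTS.
apply: eq_measurable_fun.
by move=> z; rewrite inE/= => zk; rewrite /stationary_ext zk.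
Qed.

Lemma flux_loc_int (A A1 g : R -> R) alpha beta : measurable_fun setT A -> measurable_fun setT A1 ->
  0 < alpha -> (forall x, alpha <= A1 x <= beta) -> {ae leb, forall x, A x = A1 x} ->
  loc_int g -> loc_int (fun x => A x * (g x + 1)).
Proof.
move=> mA mA1 a0 A1b AA1 lg r.
have mg := loc_int_measurable lg.
have i1 : leb.-integrable `[-r, r] (EFin \o (fun x => g x + 1)).
  apply: intgD => //; apply: (@intg_bounded _ _ _ leb _ _ _ 1) => //.
    by rewrite /= lebesgue_measure_itv/=; case: ifP => // _; rewrite -EFinB ltry.
  by move=> x _; rewrite normr1.
have i2 : leb.-integrable `[-r, r] (EFin \o (fun x => (g x + 1) * A1 x)).
  apply: (@intgM _ _ _ leb _ _ _ _ beta) => //; first exact: measurable_funTS.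
  move=> x _; have /andP[h1 h2] := A1b x.
  by rewrite ger0_norm// (le_trans (ltW a0)).
apply: (intg_ae _ i2) => //.
  by apply: measurable_funTS; apply: measurable_funM => //; exact: measurable_funD.
by apply: (@filterS _ _ (ae_filter_ringOfSetsType leb) _ _ _ AA1) => x -> _; rewrite mulrC.
Qed.

Lemma periodic_flux (A A1 g0 : R -> R) alpha beta : measurable_fun setT A -> measurable_fun setT A1 ->
  0 < alpha -> (forall x, alpha <= A1 x <= beta) -> {ae leb, forall x, A x = A1 x} ->
  per_corrector_deriv A g0 ->
  let k := (\int[leb]_(x in cell) (A1 x)^-1)^-1 in
  {ae leb, forall x, g0 x + 1 = k / A1 x} /\ astar_per A g0 = k.
Proof.
move=> mA mA1 a0 A1b AA1 [mg pg lg g00 weak] k.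
have [c hc] := du_bois_reymond (flux_loc_int mA mA1 a0 A1b AA1 lg) weak.
have A1_gt0 x : 0 < A1 x by have /andP[/(lt_le_trans a0)] := A1b x.
have gE : {ae leb, forall x, g0 x + 1 = c / A1 x}.
  apply: (@filterS2 _ _ (ae_filter_ringOfSetsType leb) _ _ _ _ hc AA1) => x <- ->.
  by rewrite mulrC mulKf// gt_eqF.
have ig1 := loc_int_itv (-(2^-1)) 2^-1 lg.
have i1 : leb.-integrable cell (EFin \o (fun=> 1 : R)).
  apply: (@intg_bounded _ _ _ leb _ measurable_cell _ 1) => //.
    by rewrite (le_lt_trans (y := 1%E)) ?ltry// -leb_cell.
  by move=> x _; rewrite normr1.
have minv : measurable_fun setT (fun x => (A1 x)^-1) by exact: measurable_inv_fun.
have kc : \int[leb]_(x in cell) (c / A1 x) = 1.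
  rewrite -(@Rint_ae _ _ _ leb cell measurable_cell (fun x => g0 x + 1)).
  - rewrite RintegralD//; last exact: measurable_cell.
    rewrite [X in X + _]g00 add0r; apply: Rint_cell_cst; first exact: measurable_cst.
    exact: aeW.
  - by apply: measurable_funTS; exact: measurable_funD.
  - by apply: measurable_funTS; exact: measurable_funM.
  - by apply: (@filterS _ _ (ae_filter_ringOfSetsType leb) _ _ _ gE) => x ->.
have iinv : leb.-integrable cell (EFin \o (fun x => (A1 x)^-1)).
  apply: (@intg_bounded _ _ _ leb _ measurable_cell _ alpha^-1) => //.
  - by rewrite (le_lt_trans (y := 1%E)) ?ltry// -leb_cell.
  - exact: measurable_funTS.
  - move=> x _; rewrite ger0_norm ?invr_ge0 ?(ltW (A1_gt0 _))// lef_pV2 ?posrE//.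
    by have /andP[] := A1b x.
rewrite RintegralZl// in kc; last exact: measurable_cell.
have c0 : c != 0 by apply/eqP => c0; move: kc; rewrite c0 mul0r => /esym/eqP; rewrite oner_eq0.
have ck : c = k by apply: invr_inj; rewrite invrK; apply: (mulfI c0); rewrite kc divff.
rewrite -ck; split=> //.
rewrite /astar_per /Xint; apply: Rint_cell_cst => //.
by apply: measurable_funM => //; exact: measurable_funD.
Qed.

Lemma stochastic_flux (A A1 g : R -> T -> R) alpha beta : jmeas A -> jmeas A1 ->
  stationary tau A -> 0 < alpha -> (forall x w, alpha <= A1 x w <= beta) ->
  {ae P, forall w, {ae leb, forall x, A x w = A1 x w}} ->
  stoch_corrector_deriv P tau A g ->
  let k := (\int[mu]_(z in D) (A1 z.1 z.2)^-1)^-1 in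
  {ae mu, forall z, D z -> g z.1 z.2 + 1 = k / A1 z.1 z.2} /\ astar_stoch P A g = k.
Proof.
move=> mA mA1 sA a0 A1b AA1 [L2g sg weak Eg0] k; have [mg g2] := L2g.
have mg1 : jmeas (fun x w => g x w + 1) by exact: measurable_funD.
have mF : jmeas (fun x w => A x w * (g x w + 1)) by exact: measurable_funM.
have sF : stationary tau (fun x w => A x w * (g x w + 1)).
  by move=> x j w; rewrite sA sg.
have [c hc] : exists c, {ae P, forall w, {ae leb, forall x, A x w * (g x w + 1) = c}}.
  apply: stationary_flux_constant => //.
  apply: filterS2 weak AA1 => w [lg wk] AA1w.
  apply: (du_bois_reymond (flux_loc_int _ _ a0 (A1b^~ w) AA1w lg) wk).
  - exact: (jmeas_section w mA).
  - exact: (jmeas_section w mA1).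
have hD := ae_cst_prod mF hc.
have AD : {ae mu, forall z, D z -> A z.1 z.2 - A1 z.1 z.2 = 0}.
  apply: (@ae_cst_prod (fun x w => A x w - A1 x w)); first exact: measurable_funB.
  apply: filterS AA1 => w h; apply: (@filterS _ _ (ae_filter_ringOfSetsType leb) _ _ _ h) => x ->.
  by rewrite subrr.
have ig := @L2_intg _ _ (measurableTypeR R) T R leb P cell measurable_cell leb_cell (fun z => g z.1 z.2) mg g2.
have II0 := fubini_cell' measurable_cell ig.
have [ck gE] := @flux_harmonic_mean _ _ (measurableTypeR R) T R leb P cell measurable_cell leb_cell
  (fun z => A z.1 z.2) (fun z => A1 z.1 z.2) (fun z => g z.1 z.2) alpha beta c mA1 a0
  (fun z => A1b z.1 z.2) hD AD mg ig (etrans (esym II0) Eg0).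
rewrite /k -ck; split=> //; rewrite /astar_stoch /Eint.
rewrite (@Rint_ae _ _ _ P setT measurableT _ (fun=> c)).
- rewrite Rintegral_cst// (_ : fine _ = 1) ?mulr1//; exact: (congr1 fine (probability_setT P)).
- exact: (measurable_xint leb measurable_cell mF).
- exact: measurable_cst.
- by apply: filterS hc => w h _; exact: (Rint_cell_cst (jmeas_section w mF) h).
Qed.

End stationary_fields.
Arguments measurable_cell {R}.
Arguments leb_cell {R}.

(** * The expansion on the product space *)

Section product_expansion.
Context d1 d2 (S : measurableType d1) (T : measurableType d2) (R : realType).
Context (leb : {sigma_finite_measure set S -> \bar R}) (P : probability T R) (cell : set S).
Hypothesis measurable_cell : measurable cell.
Hypothesis leb_cell : leb cell = 1%E.
Notation mu := (leb \x P)%E.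
Notation PM := (prodm leb P).
Notation D := (cell `*` (setT : set T)).
Notation intg f := (mu.-integrable D (EFin \o f)).
Notation "'II' f" := (\int[mu]_(z in D) f z) (at level 10).
Notation ub := (unit_ball leb P cell).
Variables (p M alpha beta Cc : R) (f : nat -> S * T -> R) (u : S * T -> R) (m : nat -> R).
Variables (a c : S -> R).
Hypothesis p1 : 1 < p.
Hypothesis fB : forall n, ub p (f n).
Hypothesis mu_ : measurable_fun setT u.
Hypothesis iu : intg u.
Hypothesis fu : forall C g, 0 <= C -> bdd_meas C g ->
  II (fun z => f n z * g z) @[n --> \oo] --> II (fun z => u z * g z).
Hypothesis m_ge0 : forall n, 0 <= m n.
Hypothesis m_cvg0 : m n @[n --> \oo] --> 0.
Hypothesis M0 : 0 <= M.
Hypothesis bM : forall n z, `|m n * f n z| <= M.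
Hypothesis alpha0 : 0 < alpha.
Hypothesis ma : measurable_fun setT a.
Hypothesis mc : measurable_fun setT c.
Hypothesis a_itv : forall x, alpha <= a x <= beta.
Hypothesis c_le : forall x, `|c x| <= Cc.
Let az (z : S * T) := a z.1.
Let cz (z : S * T) := c z.1.
Hypothesis A_itv : forall n z, alpha <= az z + m n * f n z * cz z <= beta.

Definition effective n := harm PM D f m az cz n.
Definition effective0 := harm0 PM D az.
Definition effective_slope := K0 PM D u az cz.
Definition corrector_slope := dv PM D u az cz.

Let q := p / (p - 1).
Let p0 : 0 < p. Proof. exact: lt_trans p1. Qed.
Let pm0 : 0 < p - 1. Proof. by rewrite subr_gt0. Qed.
Let q0 : 0 < q. Proof. by rewrite divr_gt0. Qed.
Let pq : p^-1 + q^-1 = 1.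
Proof. by rewrite /q invf_div; field; rewrite gt_eqF. Qed.

Lemma limit_unit_ball : ub p u.
Proof. exact: (weak_limit_unit_ball measurable_cell leb_cell p1 fB mu_ iu fu). Qed.

Let mD := measurable_D (T := T) measurable_cell.
Let muD : PM D = 1%E. Proof. by apply: mu_D. Qed.
Let fLp n : Lp_le PM D p 1 (f n).
Proof. exact: (unit_ball_Lp_le measurable_cell leb_cell (fB n)). Qed.
Let maz : measurable_fun setT az.
Proof. by apply: (measurableT_comp ma); exact: measurable_fst. Qed.
Let mcz : measurable_fun setT cz.
Proof. by apply: (measurableT_comp mc); exact: measurable_fst. Qed.

Lemma tight_mixed (phi : S * T -> R) : measurable_fun setT phi ->
  (\int[leb]_(x in cell) Lnorm P q%:E (EFin \o (fun w => phi (x, w))) < +oo)%E ->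
  tight PM D f u phi.
Proof.
move=> mphi hphi.
have [s [psi [ms s0 is_ psiB ->]]] := unit_ball_factor measurable_cell leb_cell q0 mphi hphi.
exact: (mixed_norm_tight measurable_cell p0 q0 pq fB limit_unit_ball psiB ms s0 is_).
Qed.

Lemma tight_cst1 : tight PM D f u (fun=> 1).
Proof.
have i1 : leb.-integrable cell (EFin \o (fun=> 1)).
  apply: (@intg_bounded _ _ _ leb _ measurable_cell _ 1) => //.
    exact: (leb_cell_lty leb_cell).
  by move=> x _; rewrite normr1.
have := mixed_norm_tight measurable_cell p0 q0 pq fB limit_unit_ball (unit_ball_cst1 leb P cell q)
  (measurable_cst (1 : R)) (fun=> ler01) i1.
by rewrite (_ : (fun z => _) = fun=> 1)//; apply/funext => z; rewrite mulr1.
Qed.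

(** [F n] stands for the original rescaled field and [f n] for its version bounded at every point.
    The conclusion is about iterated integrals of the former, which see it only up to null sets. *)
Lemma pairing_cvg phi (F : nat -> S * T -> R) : tight PM D f u phi ->
  (forall n, measurable_fun setT (F n)) ->
  (forall n, {ae mu, forall z, D z -> f n z = F n z}) ->
  \int[leb]_(x in cell) \int[P]_w (F n (x, w) * phi (x, w)) @[n --> \oo] -->
  \int[leb]_(x in cell) \int[P]_w (u (x, w) * phi (x, w)).
Proof.
move=> tphi mF Ff; have [mphi iphi ifp iup _] := tphi.
have b1 : bdd_meas (1 : R) (fun _ : S * T => 1 : R) by split=> [|z]; [exact: measurable_cst|rewrite normr1].
have := tight_cvg mD muD p1 fLp mu_ iu fu tphi ler01 b1.
rewrite (@fubini_cell _ _ _ _ _ leb P cell measurable_cell (fun z => u z * phi z) iup).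
under [in X in _ --> X -> _]eq_Rintegral do rewrite mulr1.
rewrite (_ : (fun n => \int[leb]_(x in cell) _) = fun n => \int[PM]_(z in D) (f n z * phi z * 1))//.
apply/funext => n; under [RHS]eq_Rintegral do rewrite mulr1.
apply: (@fubini_ae _ _ _ _ _ leb P cell measurable_cell (fun z => F n z * phi z) (fun z => f n z * phi z)).
- exact: measurable_funM.
- exact: ifp.
- by apply: filterS (Ff n) => z h Dz; rewrite h.
Qed.

Lemma effective_cvg : (effective n - effective0 - m n * effective_slope) / m n @[n --> \oo] --> 0.
Proof.
exact: (harm_expansion mD muD p1 fLp mu_ iu fu m_ge0 m_cvg0 M0 bM alpha0 maz mcz
  (fun z => a_itv z.1) (fun z => c_le z.1) A_itv tight_cst1).
Qed.

Lemma corrector_cvg phi (F : nat -> S * T -> R) : tight PM D f u phi ->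
  (forall n, measurable_fun setT (F n)) ->
  (forall n, m n != 0 -> {ae mu, forall z, D z -> F n z =
    effective n * (az z + m n * f n z * cz z)^-1 - effective0 * (az z)^-1 - m n * corrector_slope z}) ->
  \int[leb]_(x in cell) \int[P]_w (F n (x, w) / m n * phi (x, w)) @[n --> \oo] --> 0.
Proof.
move=> tphi mF hF; have [mphi _ _ _ _] := tphi.
have := corrector_expansion mD muD p1 fLp mu_ iu fu m_ge0 m_cvg0 M0 bM alpha0 maz mcz
  (fun z => a_itv z.1) (fun z => c_le z.1) A_itv tight_cst1 tphi.
have irem n := corrector_remainder_intg mD fLp alpha0 maz mcz
  (fun z => a_itv z.1) (fun z => c_le z.1) A_itv n tphi.
apply: cvg_trans; apply: near_eq_cvg; apply: nearW => n.
apply/esym; apply: (@fubini_ae _ _ _ _ _ leb P cell measurable_cell (fun z => F n z / m n * phi z)).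
- by apply: measurable_funM => //; exact: measurable_funM.
- exact: irem.
- have [mn0|mn0] := eqVneq (m n) 0.
    by apply: aeW => z _; rewrite mn0 invr0 !mulr0 !mul0r.
  by apply: filterS (hF n mn0) => z h Dz; rewrite h.
Qed.

Lemma corrector_slope_intg : intg corrector_slope.
Proof.
exact: (dv_intg mD muD iu alpha0 maz mcz (fun z => a_itv z.1) (fun z => c_le z.1)).
Qed.

Lemma corrector_slope_mean : \int[P]_w \int[leb]_(x in cell) corrector_slope (x, w) = 0.
Proof.
rewrite (fubini_cell' measurable_cell corrector_slope_intg).
exact: (Rint_dv mD muD iu alpha0 maz mcz (fun z => a_itv z.1) (fun z => c_le z.1)).
Qed.

Lemma effective0E : effective0 = (\int[leb]_(x in cell) (a x)^-1)^-1.
Proof.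
have a_gt0 x : 0 < a x by have /andP[/(lt_le_trans alpha0)] := a_itv x.
have iinv : intg (fun z => (az z)^-1).
  apply: (@intg_bounded _ _ _ mu D mD _ alpha^-1).
  - by apply: mu_D_lty.
  - by apply: measurable_funTS; apply: measurable_inv_fun => // z; exact: a_gt0.
  - move=> z _; rewrite ger0_norm ?invr_ge0 ?(ltW (a_gt0 _))// lef_pV2 ?posrE ?(a_gt0 z.1)//.
    by have /andP[] := a_itv z.1.
congr (_^-1); rewrite -[LHS](fubini_cell measurable_cell iinv); apply: eq_Rintegral => x _.
rewrite -[LHS]/(\int[P]_w (a x)^-1) Rintegral_cst// (_ : fine _ = 1) ?mulr1//.
exact: (congr1 fine (probability_setT P)).
Qed.

Lemma measurable_corrector_slope : measurable_fun setT corrector_slope.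
Proof.
have minv : measurable_fun setT (fun z => (az z)^-1).
  by apply: measurable_inv_fun => // z; have /andP[/(lt_le_trans alpha0)] := a_itv z.1.
rewrite /corrector_slope /dv; apply: measurable_funM => //.
apply: measurable_funB => //; apply: measurable_funM; first exact: measurable_funM.
exact: measurable_funM.
Qed.

(** This splits the derivative of the harmonic mean into the two first order terms of the expansion:
    the direct effect of the perturbation, and that of the corrector it induces. *)
Lemma effective_slopeE :
  \int[leb]_(x in cell) (\int[P]_w u (x, w) * c x * (effective0 / a x)) +
  \int[leb]_(x in cell) (a x * \int[P]_w corrector_slope (x, w)) = effective_slope.
Proof.
apply: (etrans _ (first_order_coefficient mD muD iu alpha0 maz mcz (fun z => a_itv z.1) (fun z => c_le z.1))).
have a_gt0 x : 0 < a x by have /andP[/(lt_le_trans alpha0)] := a_itv x.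
have mH : measurable_fun setT (fun z => cz z * (effective0 / az z)).
  apply: measurable_funM => //; apply: measurable_funM => //.
  by apply: measurable_inv_fun => // z; exact: a_gt0.
congr (_ + _).
- have iuH : intg (fun z => u z * (cz z * (effective0 / az z))).
    apply: (@intgM _ _ _ mu D mD _ _ (Cc * (`|effective0| / alpha))) => //.
      exact: measurable_funTS.
    move=> z _; rewrite normrM ler_pM//; first exact: c_le.
    rewrite normrM ler_wpM2l// ger0_norm ?invr_ge0 ?(ltW (a_gt0 _))//.
    by rewrite lef_pV2 ?posrE ?(a_gt0 z.1)//; have /andP[] := a_itv z.1.
  rewrite -[RHS](fubini_cell measurable_cell iuH).
  have mpu := measurable_pint P mu_.
  apply: (@Rint_ae _ _ _ leb cell measurable_cell).
  + apply: measurable_funTS; apply: measurable_funM; first exact: measurable_funM.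
    by apply: measurable_funM => //; exact: measurable_inv_fun.
  + apply: measurable_funTS; apply: (@measurable_pint _ _ S T R P (fun z => u z * (cz z * (effective0 / az z)))).
    exact: measurable_funM.
  + apply: filterS (ae_intg_section1 measurable_cell iu) => x iux xc.
    rewrite -mulrA -[RHS]/(\int[P]_w (u (x, w) * (c x * (effective0 / a x)))).
    by rewrite RintegralZr//; exact: iux.
- have idv := corrector_slope_intg.
  have iadv : intg (fun z => az z * corrector_slope z).
    have := @intgM _ _ _ mu D mD _ az beta idv.
    rewrite (_ : (fun x => corrector_slope x * az x) = (fun z => az z * corrector_slope z)).
      apply; first exact: measurable_funTS.
      move=> z _; have /andP[h1 h2] := a_itv z.1.
      by rewrite ger0_norm// (le_trans (ltW alpha0)).
    by apply/funext => z; rewrite mulrC.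
  have mdv := measurable_corrector_slope.
  rewrite -[RHS](fubini_cell measurable_cell iadv).
  have mpdv := measurable_pint P mdv.
  apply: (@Rint_ae _ _ _ leb cell measurable_cell).
  + by apply: measurable_funTS; exact: measurable_funM.
  + apply: measurable_funTS; apply: (@measurable_pint _ _ S T R P (fun z => az z * corrector_slope z)).
    exact: measurable_funM.
  + apply: filterS (ae_intg_section1 measurable_cell idv) => x idx xc.
    rewrite -[RHS]/(\int[P]_w (a x * corrector_slope (x, w))).
    by rewrite RintegralZl//; exact: idx.
Qed.

End product_expansion.

(** * Homogenization *)

Section coefficients.
Context (R : realType) (aper cper : R -> R) (M alpha beta : R).
Notation leb := (@lebesgue_measure R).
Hypothesis maper : measurable_fun setT aper.
Hypothesis mcper : measurable_fun setT cper.
Hypothesis paper : periodic1 aper.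
Hypothesis pcper : periodic1 cper.
Hypothesis M0 : 0 < M.
Hypothesis alpha0 : 0 < alpha.
Hypothesis alphabeta : alpha <= beta.
Hypothesis coef_ae : {ae leb, forall x, (alpha <= aper x <= beta) /\
  (forall s, -M <= s <= M -> alpha <= aper x + s * cper x <= beta)}.

(* Off the null set where the ellipticity bounds fail, the coefficients are
   replaced by constants, so that the bounds hold everywhere. *)
Definition elliptic x := [&& alpha <= aper x <= beta, alpha <= aper x + M * cper x <= beta &
  alpha <= aper x - M * cper x <= beta].
Definition amod x := if elliptic x then aper x else alpha.
Definition cmod x := if elliptic x then cper x else 0.

Lemma coef_mod_ae : {ae leb, forall x, aper x = amod x /\ cper x = cmod x}.
Proof.
apply: (@filterS _ _ (ae_filter_ringOfSetsType leb) _ _ _ coef_ae) => x [h1 h2].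
have h3 : alpha <= aper x + M * cper x <= beta by apply: h2; rewrite lexx andbT (le_trans _ (ltW M0))// oppr_le0 ltW.
have h4 : alpha <= aper x - M * cper x <= beta by rewrite -mulNr; apply: h2; rewrite lexx/= (le_trans _ (ltW M0))// oppr_le0 ltW.
by rewrite /amod /cmod /elliptic h1 h3 h4.
Qed.

Lemma amod_itv x : alpha <= amod x <= beta.
Proof. by rewrite /amod; case: ifP => [/and3P[]//|_]; rewrite lexx. Qed.

(** The expression is affine in [s], and [s] is the combination of [M] and [-M] with weights
    [(M + s) / (2 M)] and [(M - s) / (2 M)]. This is why [elliptic] tests only the two extreme
    values besides [0], which keeps it measurable. *)
Lemma amod_perturbed_itv x s : `|s| <= M -> alpha <= amod x + s * cmod x <= beta.
Proof.
rewrite ler_norml => /andP[s1 s2]; rewrite /amod /cmod; case: ifP => [|_]; last by rewrite mulr0 addr0 lexx.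
move=> /and3P[_ /andP[h1 h2] /andP[h3 h4]].
have M2 : 0 < 2 * M by rewrite mulr_gt0.
have p1 : 0 <= M + s by lra.
have p2 : 0 <= M - s by lra.
apply/andP; split; rewrite -subr_ge0 -(pmulr_rge0 _ M2).
  have -> : 2 * M * (aper x + s * cper x - alpha) =
    (M + s) * (aper x + M * cper x - alpha) + (M - s) * (aper x - M * cper x - alpha) by ring.
  by rewrite addr_ge0// mulr_ge0// subr_ge0.
have -> : 2 * M * (beta - (aper x + s * cper x)) =
  (M + s) * (beta - (aper x + M * cper x)) + (M - s) * (beta - (aper x - M * cper x)) by ring.
by rewrite addr_ge0// mulr_ge0// subr_ge0.
Qed.

(** Since [aper >= 0] and both [aper + M * cper] and [aper - M * cper] are at most [beta], so is
    [M * |cper|]. *)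
Lemma cmod_le x : `|cmod x| <= beta / M.
Proof.
rewrite /cmod; case: ifP => [|_]; last by rewrite normr0 divr_ge0 ?(ltW M0)// (le_trans (ltW alpha0)).
move=> /and3P[/andP[h0 _] /andP[h1 h2] /andP[h3 h4]].
rewrite ler_pdivlMr// -[X in _ * X]gtr0_norm// -normrM ler_norml mulrC.
have a_ge0 : 0 <= aper x by exact: le_trans (ltW alpha0) h0.
by rewrite lerNl; apply/andP; split; [apply: le_trans h4|apply: le_trans h2]; rewrite lerDr.
Qed.

Lemma measurable_elliptic : measurable_fun setT elliptic.
Proof.
have mM : measurable_fun setT (fun x => M * cper x) by exact: measurable_funM.
have h (f : R -> R) : measurable_fun setT f -> measurable_fun setT (fun x => alpha <= f x <= beta).
  by move=> mf; apply: measurable_and; exact: measurable_fun_ler.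
apply: measurable_and; first exact: h.
by apply: measurable_and; apply: h; [exact: measurable_funD|exact: measurable_funB].
Qed.

Lemma measurable_amod : measurable_fun setT amod.
Proof. by apply: measurable_fun_ifT => //; exact: measurable_elliptic. Qed.

Lemma measurable_cmod : measurable_fun setT cmod.
Proof. by apply: measurable_fun_ifT => //; exact: measurable_elliptic. Qed.

Lemma periodic1_int (f : R -> R) x (k : int) : periodic1 f -> f (x + k%:~R) = f x.
Proof.
move=> pf; have nat_case y (n : nat) : f (y + n%:R) = f y.
  by elim: n => [|n IH]; rewrite ?addr0// -natr1 addrA pf.
case: k => n; first exact: nat_case.
by rewrite NegzE mulrNz -(nat_case (x - n.+1%:~R) n.+1) subrK.
Qed.

Lemma elliptic_int x (k : int) : elliptic (x + k%:~R) = elliptic x.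
Proof. by rewrite /elliptic !periodic1_int. Qed.

Lemma amod_int x (k : int) : amod (x + k%:~R) = amod x.
Proof. by rewrite /amod elliptic_int periodic1_int. Qed.

Lemma cmod_int x (k : int) : cmod (x + k%:~R) = cmod x.
Proof. by rewrite /cmod elliptic_int periodic1_int. Qed.

End coefficients.

Lemma clip_norm_le (R : realType) (k y : R) : 0 <= k -> `|clip k y| <= `|y|.
Proof.
move=> k0; have [yk|/ltW yk] := leP `|y| k; first by rewrite clip_id.
exact: le_trans (clip_le _ k0) yk.
Qed.

(** * The norm of [L^oo(cell; L^p)] and its unit ball *)

Section mixed_norms.
Context d (T : measurableType d) (R : realType) (P : probability T R) (p : R).
Hypothesis p0 : 0 < p.
Notation leb := (@lebesgue_measure R).
Notation ub := (@unit_ball _ _ (measurableTypeR R) T R leb P cell p).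
Implicit Type F : R -> T -> R.

Lemma LooLp_leP F C : 0 <= C -> (LooLp P p F <= C%:E)%E <->
  {ae leb, forall x, cell x -> (LpO P p F x <= C%:E)%E}.
Proof.
move=> C0; split=> [/ess_supP|] h.
  apply: (@filterS _ _ (ae_filter_ringOfSetsType leb) _ _ _ h) => x + xc.
  by rewrite asboolT.
apply/ess_supP; apply: (@filterS _ _ (ae_filter_ringOfSetsType leb) _ _ _ h) => x hx.
by case: asboolP => [/hx//|_]; rewrite lee_fin.
Qed.

Lemma LooLp_ge0 F : (0 <= LooLp P p F)%E.
Proof.
apply: ess_sup_gee.
  apply: (@lt_le_trans _ _ (leb cell)); first by rewrite leb_cell.
  by apply: le_measure; rewrite ?inE//; exact: measurable_cell.
by apply: aeW => x; case: asboolP => // _; exact: Lnorm_ge0.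
Qed.

Lemma measurable_section_jmeas F x : jmeas F -> measurable_fun setT (F x).
Proof. by move=> mF; exact: (measurableT_comp (f := fun z : R * T => F z.1 z.2) mF (measurable_pair1 x)). Qed.

Lemma LooLp_le_bound F C : 0 <= C -> jmeas F -> Linf_cell_le P F C -> (LooLp P p F <= C%:E)%E.
Proof.
move=> C0 mF hF; apply/LooLp_leP => //.
have hF' : {ae (leb \x P)%E, forall z, (cell `*` setT) z -> `|F z.1 z.2| <= C}.
  by move: hF => [N [mN N0 sN]]; exists N; split=> // z /= h; apply: sN => h'; apply: h => -[+ _]; exact: h'.
have := ae_prod_section1 hF'.
move=> h; apply: (@filterS _ _ (ae_filter_ringOfSetsType leb) _ _ _ h) => x hx xc.
apply/Lnorm_leP => //; first exact: measurable_section_jmeas.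
apply: (@le_trans _ _ (\int[P]_w (C `^ p)%:E)%E); last first.
  by rewrite integral_cst// [X in (_ * X)%E](_ : _ = 1%E) ?mule1//; exact: probability_setT.
apply: ae_ge0_le_integral => //.
- apply/measurable_EFinP; apply: (measurableT_comp (measurable_powR p)).
  by apply: measurableT_comp => //; exact: measurable_section_jmeas.
- by move=> w _; rewrite lee_fin powR_ge0.
- apply: filterS (hx xc) => w hw _; rewrite lee_fin.
  by apply: ge0_ler_powR; rewrite ?nnegrE// ltW.
Qed.

Lemma LooLp_fin_num F C : 0 <= C -> jmeas F -> Linf_cell_le P F C -> LooLp P p F \is a fin_num.
Proof.
move=> C0 mF hF; rewrite ge0_fin_numE; last exact: LooLp_ge0.
by rewrite (le_lt_trans (LooLp_le_bound C0 mF hF))// ltry.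
Qed.

(** Clipping does not increase the modulus, so the norm bound survives it, while [|clip M F| <= M]
    now holds everywhere. If the norm is zero, the quotient is the zero function. *)
Lemma rescaled_unit_ball F M : 0 <= M -> jmeas F -> LooLp P p F \is a fin_num ->
  ub (fun z => clip M (F z.1 z.2) / m_of P p F).
Proof.
move=> M0 mF fin; set m := m_of P p F.
have m0 : 0 <= m by apply: fine_ge0; exact: LooLp_ge0.
have mclip : measurable_fun setT (fun z : R * T => clip M (F z.1 z.2)) by exact: measurable_clip.
split; first exact: measurable_funM.
have /LooLp_leP : (LooLp P p F <= m%:E)%E by rewrite /m /m_of fineK.
move=> /(_ m0) h; apply: (@filterS _ _ (ae_filter_ringOfSetsType leb) _ _ _ h) => x hx xc.
have mFx : measurable_fun setT (F x) by exact: measurable_section_jmeas.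
have mFp : measurable_fun setT (fun w => (`|F x w| `^ p)%:E).
  apply/measurable_EFinP; apply: (measurableT_comp (measurable_powR p)).
  exact: measurableT_comp.
have /Lnorm_leP h2 := hx xc; have {}h2 := h2 p0 m0 mFx.
have mi0 : 0 <= m^-1 by rewrite invr_ge0.
apply: (@le_trans _ _ (\int[P]_w ((m^-1 `^ p)%:E * (`|F x w| `^ p)%:E))%E).
  apply: ge0_le_integral => //.
  - apply/measurable_EFinP; apply: (measurableT_comp (measurable_powR p)).
    apply: measurableT_comp => //; apply: measurable_funM => //.
    exact: measurable_clip.
  - exact: emeasurable_funM.
  - move=> w _; rewrite -EFinM lee_fin -powRM//.
    apply: ge0_ler_powR; rewrite ?nnegrE ?mulr_ge0// ?(ltW p0)//.
    by rewrite normrM mulrC (ger0_norm mi0) ler_wpM2l// clip_norm_le.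
rewrite ge0_integralZl//; last by rewrite lee_fin powR_ge0.
apply: (@le_trans _ _ ((m^-1 `^ p)%:E * (m `^ p)%:E)%E).
  by rewrite lee_wpmul2l// lee_fin powR_ge0.
rewrite -EFinM lee_fin -powRM//; have [->|mn0] := eqVneq m 0.
  by rewrite mulr0 powR0 ?gt_eqF.
by rewrite mulVf// powR1.
Qed.

Lemma unit_ball_LooLp F : ub (fun z => F z.1 z.2) -> (LooLp P p F <= 1%:E)%E.
Proof.
move=> [mF h]; apply/LooLp_leP => //.
apply: (@filterS _ _ (ae_filter_ringOfSetsType leb) _ _ _ h) => x hx xc.
apply/Lnorm_leP => //; first exact: measurable_section_jmeas.
by rewrite powR1; exact: hx.
Qed.

(** Meant for the first order corrector, which is affine in [b0] with bounded coefficients: its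
    [L^p] norm is even bounded uniformly in [x]. *)
Lemma in_L2Lq_affine F H k1 k2 : 0 <= k1 -> 0 <= k2 -> jmeas H -> ub (fun z => F z.1 z.2) ->
  (forall x w, `|H x w| <= k1 + k2 * `|F x w|) -> in_L2Lq P p H.
Proof.
move=> k10 k20 mH [mF h] HF; split => //.
pose B := (2 `^ p * (k1 `^ p + k2 `^ p)) `^ p^-1.
have B0 : 0 <= B by exact: powR_ge0.
have BE : B `^ p = 2 `^ p * (k1 `^ p + k2 `^ p).
  by rewrite -powRrM mulVf ?gt_eqF// powRr1// mulr_ge0 ?addr_ge0 ?powR_ge0.
have N_le : {ae leb, forall x, cell x -> (LpO P p H x <= B%:E)%E}.
  apply: (@filterS _ _ (ae_filter_ringOfSetsType leb) _ _ _ h) => x hx xc.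
  have mHx := measurable_section_jmeas x mH; have mFx := measurable_section_jmeas x mF.
  apply/Lnorm_leP => //; rewrite BE.
  exact: (powR_affine_le p0 k10 k20 mHx mFx (HF x) (hx xc)).
have mN := @measurable_Lnorm _ _ (measurableTypeR R) T R P p (fun z => H z.1 z.2) mH.
apply: (@le_lt_trans _ _ (\int[leb]_(x in cell) (B * B)%:E)%E); last first.
  rewrite integral_cst; last exact: measurable_cell.
  by rewrite [X in (_ * X)%E](_ : _ = 1%E) ?mule1 ?ltry//; exact: leb_cell.
apply: ae_ge0_le_integral.
- exact: measurable_cell.
- by move=> x _; rewrite mule_ge0//; exact: Lnorm_ge0.
- by apply: measurable_funTS; exact: (emeasurable_funM mN mN).
- by move=> x _; rewrite lee_fin mulr_ge0.
- exact: measurable_cst.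
- apply: (@filterS _ _ (ae_filter_ringOfSetsType leb) _ _ _ N_le) => x hx xc.
  by rewrite EFinM; apply: lee_pmul; rewrite ?hx//; exact: Lnorm_ge0.
Qed.

End mixed_norms.

(** * The expansion for a weakly convergent sequence of fields *)

Section expansion_along_sequence.
Context d (T : measurableType d) (R : realType) (P : probability T R).
Context (tau : int -> T -> T) (Htau : ergodic_action P tau).
Variables (aper cper : R -> R) (b g : nat -> R -> T -> R) (g0 : R -> R) (b0 : R -> T -> R).
Variables (M alpha beta p : R).
Notation leb := (@lebesgue_measure R).
Notation mu := (leb \x P)%E.
Notation D := ((cell : set R) `*` (setT : set T)).
Notation ub := (@unit_ball _ _ (measurableTypeR R) T R leb P cell p).
Hypothesis maper : measurable_fun setT aper.
Hypothesis mcper : measurable_fun setT cper.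
Hypothesis paper : periodic1 aper.
Hypothesis pcper : periodic1 cper.
Hypothesis M0 : 0 < M.
Hypothesis alpha0 : 0 < alpha.
Hypothesis alphabeta : alpha <= beta.
Hypothesis coef_ae : {ae leb, forall x, (alpha <= aper x <= beta) /\
  (forall s, -M <= s <= M -> alpha <= aper x + s * cper x <= beta)}.
Hypothesis p1 : 1 < p.
Hypothesis mb : forall n, jmeas (b n).
Hypothesis sb : forall n, stationary tau (b n).
Hypothesis bM : forall n, Linf_cell_le P (b n) M.
Let m n := m_of P p (b n).
Hypothesis m_cvg0 : m n @[n --> \oo] --> 0.
Hypothesis gP : forall n, stoch_corrector_deriv P tau (a_eta aper cper (b n)) (g n).
Hypothesis g0P : per_corrector_deriv aper g0.
Let f n (z : measurableTypeR R * T) := clip M (b n z.1 z.2) / m n.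
Let u (z : measurableTypeR R * T) := b0 z.1 z.2.
Hypothesis mb0 : jmeas b0.
Hypothesis sb0 : stationary tau b0.
Hypothesis iu : mu.-integrable D (EFin \o u).
Hypothesis fu : forall C h, 0 <= C -> bdd_meas C h ->
  \int[mu]_(z in D) (f n z * h z) @[n --> \oo] --> \int[mu]_(z in D) (u z * h z).

Let a := amod aper cper M alpha beta.
Let c := cmod aper cper M alpha beta.
Let q := p / (p - 1).

Let p0 : 0 < p. Proof. exact: lt_trans p1. Qed.
Let M_ge0 : 0 <= M. Proof. exact: ltW. Qed.

Let ma : measurable_fun setT a. Proof. exact: measurable_amod. Qed.
Let mc : measurable_fun setT c. Proof. exact: measurable_cmod. Qed.
Let a_itv x : alpha <= a x <= beta. Proof. exact: amod_itv. Qed.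
Let c_le x : `|c x| <= beta / M. Proof. exact: cmod_le. Qed.
Let ac_ae : {ae leb, forall x, aper x = a x /\ cper x = c x}.
Proof. exact: coef_mod_ae. Qed.
Let a_gt0 x : 0 < a x. Proof. by have /andP[/(lt_le_trans alpha0)] := a_itv x. Qed.

Let LooLp_fin n : LooLp P p (b n) \is a fin_num.
Proof.
exact: (LooLp_fin_num p0 M_ge0 (mb n) (@bM n)).
Qed.

Let fB n : ub (f n).
Proof. exact: (rescaled_unit_ball p0 M_ge0 (mb n) (LooLp_fin n)). Qed.

Let m_ge0 n : 0 <= m n.
Proof. by apply: fine_ge0; exact: LooLp_ge0. Qed.

Let mf_norm n z : `|m n * f n z| <= M.
Proof.
rewrite /f mulrCA; have [->|mn0] := eqVneq (m n) 0; first by rewrite mul0r mulr0 normr0.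
by rewrite divff// mulr1 clip_le.
Qed.

Let A_itv n z : alpha <= a z.1 + m n * f n z * c z.1 <= beta.
Proof. exact: amod_perturbed_itv. Qed.

Let ub0 : ub u.
Proof. exact: (limit_unit_ball measurable_cell leb_cell p1 fB mb0 iu fu). Qed.

Let b_ae n : {ae P, forall w, {ae leb, forall x, `|b n x w| <= M}}.
Proof.
apply: (ae_stationary Htau (Q := fun x w => `|b n x w| <= M)).
  by move=> x k w; rewrite sb.
have [N [mN N0 sN]] := @bM n; exists N; split=> // z /= h; apply: sN => h'.
by apply: h => -[zc _]; exact: h'.
Qed.

Let A1 n x w := a x + clip M (b n x w) * c x.
Let mA1 n : jmeas (A1 n).
Proof.
apply: measurable_funD; first by apply: (measurableT_comp ma); exact: measurable_fst.
apply: measurable_funM; first by apply: measurable_clip; exact: mb.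
by apply: (measurableT_comp mc); exact: measurable_fst.
Qed.

Let mA n : jmeas (a_eta aper cper (b n)).
Proof.
apply: measurable_funD; first by apply: (measurableT_comp maper); exact: measurable_fst.
apply: measurable_funM; first exact: mb.
by apply: (measurableT_comp mcper); exact: measurable_fst.
Qed.

Let sA n : stationary tau (a_eta aper cper (b n)).
Proof. by move=> x k w; rewrite /a_eta sb !periodic1_int. Qed.

Let flux n : let k := (\int[mu]_(z in D) (A1 n z.1 z.2)^-1)^-1 in
  {ae mu, forall z, D z -> g n z.1 z.2 + 1 = k / A1 n z.1 z.2} /\
  astar_stoch P (a_eta aper cper (b n)) (g n) = k.
Proof.
apply: (stochastic_flux Htau (@mA n) (@mA1 n) (@sA n) alpha0 _ _ (@gP n)).
  by move=> x w; apply: amod_perturbed_itv => //; exact: clip_le.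
apply: filterS (@b_ae n) => w h.
apply: (@filterS2 _ _ (ae_filter_ringOfSetsType leb) _ _ _ _ h ac_ae) => x h1 [h2 h3].
by rewrite /a_eta /A1 clip_id// h2 h3.
Qed.

Let f_clip n z : m n != 0 -> m n * f n z = clip M (b n z.1 z.2).
Proof. by move=> mn0; rewrite /f mulrCA divff// mulr1. Qed.

Notation eff := (effective leb P cell f m a c).
Notation eff0 := (effective0 leb P cell a).
Notation slope := (effective_slope leb P cell u a c).
Notation dv z := (corrector_slope leb P cell u a c z).

Let effE n : m n != 0 -> (\int[mu]_(z in D) (A1 n z.1 z.2)^-1)^-1 = eff n.
Proof.
move=> mn0; congr (_^-1); apply: eq_Rintegral => z _.
by rewrite /= f_clip.
Qed.

Let per_flux : {ae leb, forall x, g0 x + 1 = eff0 / a x} /\ astar_per aper g0 = eff0.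
Proof.
rewrite (@effective0E _ _ (measurableTypeR R) T R leb P cell measurable_cell leb_cell alpha beta a alpha0 ma a_itv).
apply: (periodic_flux maper ma alpha0 a_itv _ g0P).
by apply: (@filterS _ _ (ae_filter_ringOfSetsType leb) _ _ _ ac_ae) => x [].
Qed.

Let ae_fst (Q : R -> Prop) : {ae leb, forall x, Q x} -> {ae mu, forall z, D z -> Q z.1}.
Proof.
move=> h; apply: (@ae_prod_fst _ _ (measurableTypeR R) T R leb P cell Q).
by apply: (@filterS _ _ (ae_filter_ringOfSetsType leb) _ _ _ h) => x + _.
Qed.

Let tight_phi phi : jmeas phi ->
  (\int[leb]_(x in cell) LpO P q phi x < +oo)%E ->
  tight (prodm leb P) D f u (fun z => phi z.1 z.2).
Proof.
move=> mphi hphi.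
exact: (@tight_mixed _ _ (measurableTypeR R) T R leb P cell measurable_cell leb_cell p f u p1 fB mb0 iu fu (fun z => phi z.1 z.2) mphi hphi).
Qed.

Lemma weak_star_pairing phi : in_L1Lq P q phi ->
  pairing P (fun x w => b n x w / m n) phi @[n --> \oo] --> pairing P b0 phi.
Proof.
move=> [mphi hphi].
apply: (@pairing_cvg _ _ (measurableTypeR R) T R leb P cell measurable_cell leb_cell p f u p1 fB mb0 iu fu
  (fun z => phi z.1 z.2) (fun n z => b n z.1 z.2 / m n) (tight_phi mphi hphi)).
  by move=> n; apply: measurable_funM => //; exact: mb.
move=> n; have [N [mN N0 sN]] := @bM n; exists N; split=> // z /= h; apply: sN => h'.
by apply: h => -[zc _]; rewrite /f clip_id//; exact: h'.
Qed.

Lemma corrector_pairing phi : in_L2Lq P q phi ->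
  pairing P (fun x w => (g n x w - g0 x - m n * dv (x, w)) / m n) phi @[n --> \oo] --> 0.
Proof.
move=> [mphi hphi].
have mdv : measurable_fun setT (fun z => dv z).
  exact: (@measurable_corrector_slope _ _ (measurableTypeR R) T R leb P cell alpha beta u a c mb0 alpha0 ma mc a_itv).
have hphi1 := @Lnorm_L2_L1 _ _ (measurableTypeR R) T R leb P cell measurable_cell leb_cell q (fun z => phi z.1 z.2) mphi hphi.
apply: (@corrector_cvg _ _ (measurableTypeR R) T R leb P cell measurable_cell leb_cell p M alpha beta (beta / M) f u m a c
  p1 fB mb0 iu fu m_ge0 m_cvg0 M_ge0 mf_norm alpha0 ma mc a_itv c_le A_itv (fun z => phi z.1 z.2)
  (fun n z => g n z.1 z.2 - g0 z.1 - m n * dv z) (tight_phi mphi hphi1)).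
  move=> n; apply: measurable_funB; last exact: measurable_funM.
  apply: measurable_funB; first by have [[]] := gP n.
  by have [mg0 _ _ _ _] := g0P; apply: (measurableT_comp mg0); exact: measurable_fst.
move=> n mn0; have [h1 _] := flux n; have [/ae_fst h2 _] := per_flux.
apply: (@filterS2 _ _ (ae_filter_ringOfSetsType mu) _ _ _ _ h1 h2) => z h3 h4 Dz.
have := h3 Dz; have := h4 Dz; rewrite effE// f_clip// => e1 e2; congr (_ - _).
by rewrite -[eff0 * _]e1 -[eff n * _]e2; ring.
Qed.

Lemma effective_pairing :
  (astar_stoch P (a_eta aper cper (b n)) (g n) - astar_per aper g0
     - m n * Xint cell (fun x => Eint P (b0 x) * cper x * (g0 x + 1))
     - m n * Xint cell (fun x => aper x * Eint P (fun w => dv (x, w)))) / m n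
    @[n --> \oo] --> 0.
Proof.
have mdv : measurable_fun setT (fun z => dv z).
  exact: (@measurable_corrector_slope _ _ (measurableTypeR R) T R leb P cell alpha beta u a c mb0 alpha0 ma mc a_itv).
have := @effective_cvg _ _ (measurableTypeR R) T R leb P cell measurable_cell leb_cell p M alpha beta (beta / M) f u m a c
  p1 fB mb0 iu fu m_ge0 m_cvg0 M_ge0 mf_norm alpha0 ma mc a_itv c_le A_itv.
have slopeE := @effective_slopeE _ _ (measurableTypeR R) T R leb P cell measurable_cell leb_cell alpha beta (beta / M) u a c
  mb0 iu alpha0 ma mc a_itv c_le.
have [perE astar0] := per_flux.
have mg0 : measurable_fun setT g0 by have [] := g0P.
have mpu := @measurable_pint _ _ (measurableTypeR R) T R P u mb0.
have mpdv := @measurable_pint _ _ (measurableTypeR R) T R P (fun z => dv z) mdv.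
have minv : measurable_fun setT (fun x => eff0 / a x).
  by apply: measurable_funM => //; exact: measurable_inv_fun.
have X1 : Xint cell (fun x => Eint P (b0 x) * cper x * (g0 x + 1)) =
    \int[leb]_(x in cell) (\int[P]_w u (x, w) * c x * (eff0 / a x)).
  apply: (@Rint_ae _ _ _ leb cell measurable_cell).
  - apply: measurable_funTS; apply: measurable_funM; last exact: measurable_funD.
    by apply: measurable_funM => //; exact: mpu.
  - apply: measurable_funTS; apply: measurable_funM; last exact: minv.
    by apply: measurable_funM => //; exact: mpu.
  - apply: (@filterS2 _ _ (ae_filter_ringOfSetsType leb) _ _ _ _ perE ac_ae) => x -> [_ ->] _.
    by [].
have X2 : Xint cell (fun x => aper x * Eint P (fun w => dv (x, w))) =
    \int[leb]_(x in cell) (a x * \int[P]_w dv (x, w)).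
  apply: (@Rint_ae _ _ _ leb cell measurable_cell).
  - by apply: measurable_funTS; apply: measurable_funM => //; exact: mpdv.
  - by apply: measurable_funTS; apply: measurable_funM => //; exact: mpdv.
  - by apply: (@filterS _ _ (ae_filter_ringOfSetsType leb) _ _ _ ac_ae) => x [-> _].
rewrite X1 X2 astar0.
apply: cvg_trans; apply: near_eq_cvg; apply: nearW => n /=.
have [mn0|mn0] := eqVneq (m n) 0; first by rewrite mn0 invr0 !mulr0.
by have [_ ->] := flux n; rewrite effE// -slopeE; congr (_ / _); ring.
Qed.

Lemma limit_LooLp : (LooLp P p b0 < +oo)%E.
Proof. exact: le_lt_trans (unit_ball_LooLp p0 ub0) (ltry _). Qed.

Let inva_le x : `|(a x)^-1| <= alpha^-1.
Proof.
rewrite ger0_norm ?invr_ge0 ?(ltW (a_gt0 x))// lef_pV2 ?posrE ?(a_gt0 x)//.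
by have /andP[] := a_itv x.
Qed.

Let minva : measurable_fun setT (fun x => (a x)^-1).
Proof. exact: measurable_inv_fun. Qed.

Let coefG x := c x * (eff0 / a x).
Let coefG_le x : `|coefG x| <= beta / M * (`|eff0| / alpha).
Proof. by rewrite /coefG normrM ler_pM ?c_le// normrM ler_wpM2l. Qed.

Let mcoefG : measurable_fun setT coefG.
Proof. by apply: measurable_funM => //; exact: measurable_funM. Qed.

Let dvE x w : dv (x, w) = (slope - b0 x w * coefG x) * (a x)^-1.
Proof. by rewrite /coefG mulrA. Qed.

Let loc_int_b0 : {ae P, forall w, loc_int (b0^~ w)}.
Proof.
have h := ae_intg_section2 measurable_cell iu.
apply: filterS (ae_forall_int (fun k => ae_tau Htau k h)) => w hw.
apply: loc_int_cells; first exact: (jmeas_section w mb0).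
move=> k; have := hw k; rewrite (_ : (fun x => u (x, tau k w)) = (fun x => b0 (x + k%:~R) w))//.
by apply/funext => x; rewrite sb0.
Qed.

(** Almost everywhere [aper * dv + b0 * cper * (g0 + 1)] is the constant [slope], because
    [g0 + 1 = eff0 / a]. The weak equation then says that a constant integrates to zero against the
    derivative of a test function. *)
Lemma corrector_slope_v0 : v0_deriv P tau p aper cper g0 b0 (fun x w => dv (x, w)).
Proof.
have beta0 : 0 <= beta by apply: le_trans alphabeta; exact: ltW.
have al0 : 0 <= alpha^-1 by rewrite invr_ge0 ltW.
have mdv : jmeas (fun x w => dv (x, w)).
  have := @measurable_corrector_slope _ _ (measurableTypeR R) T R leb P cell alpha beta u a c mb0 alpha0 ma mc a_itv.
  by rewrite /jmeas (_ : (fun z : R * T => _) = (fun z => dv z))//; apply/funext => -[].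
split.
- apply: (in_L2Lq_affine p0 (k1 := `|slope| * alpha^-1)
      (k2 := beta / M * (`|eff0| / alpha) * alpha^-1) _ _ mdv ub0).
  + by rewrite mulr_ge0.
  + by rewrite !mulr_ge0// invr_ge0 ltW.
  + move=> x w; rewrite dvE normrM.
    have -> : `|slope| / alpha + beta / M * (`|eff0| / alpha) / alpha * `|b0 x w| =
      (`|slope| + `|b0 x w| * (beta / M * (`|eff0| / alpha))) * alpha^-1 by ring.
    by rewrite ler_pM// (le_trans (ler_normB _ _))// lerD2l normrM ler_wpM2l.
- move=> x k w; rewrite !dvE /coefG /a /c !amod_int// !cmod_int// sb0//.
- have loc1 k : loc_int (fun=> k : R).
    move=> r; apply: (@intg_bounded _ _ _ _ _ _ _ `|k|) => //.
    by rewrite /= lebesgue_measure_itv/=; case: ifP => // _; rewrite -EFinB ltry.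
  apply: filterS loc_int_b0 => w lb.
  have mbw := jmeas_section w mb0.
  have mGw : measurable_fun setT (fun x => b0 x w * coefG x) by exact: measurable_funM.
  have lG : loc_int (fun x => b0 x w * coefG x).
    move=> r; apply: (@intgM _ _ _ leb _ _ _ _ _ (lb r)) => //; exact: measurable_funTS.
  have lKG : loc_int (fun x => slope - b0 x w * coefG x).
    by move=> r; apply: (intgB _ (loc1 slope r) (lG r)).
  split.
    move=> r; rewrite (_ : (fun x => dv (x, w)) = (fun x => (slope - b0 x w * coefG x) * (a x)^-1)).
      by apply: (@intgM _ _ _ leb _ _ _ _ _ (lKG r)) => //; exact: measurable_funTS.
    by apply/funext => x; exact: dvE.
  move=> phi tphi; have [cphi [t tsupp]] := test_fun_derive tphi.
  have mphi' : measurable_fun setT (phi^`())%classic by exact: continuous_measurable_fun.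
  have mdw := jmeas_section w mdv.
  have [mg0 _ _ _ _] := g0P; have [perE _] := per_flux.
  have iK := loc_int_mul_supp (loc1 slope) cphi tsupp.
  have iG := loc_int_mul_supp lG cphi tsupp.
  have -> : Xint setT (fun x => aper x * dv (x, w) * (phi^`())%classic x) =
      \int[leb]_x (slope * (phi^`())%classic x - b0 x w * coefG x * (phi^`())%classic x).
    apply: (@Rint_ae _ _ _ leb setT measurableT).
    + by apply: measurable_funM => //; exact: measurable_funM.
    + by apply: measurable_funB; exact: measurable_funM.
    + apply: (@filterS _ _ (ae_filter_ringOfSetsType leb) _ _ _ ac_ae) => x [-> _] _.
      by rewrite dvE mulrCA divff ?gt_eqF// mulr1 mulrBl.
  have -> : Xint setT (fun x => b0 x w * cper x * (g0 x + 1) * (phi^`())%classic x) =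
      \int[leb]_x (b0 x w * coefG x * (phi^`())%classic x).
    apply: (@Rint_ae _ _ _ leb setT measurableT).
    + apply: measurable_funM => //; apply: measurable_funM; last exact: measurable_funD.
      exact: measurable_funM.
    + exact: measurable_funM.
    + apply: (@filterS2 _ _ (ae_filter_ringOfSetsType leb) _ _ _ _ perE ac_ae) => x -> [_ ->] _.
      by rewrite /coefG !mulrA.
  have i0 : \int[leb]_x (slope * (phi^`())%classic x) = 0.
    rewrite RintegralZl//; first by rewrite Rint_test_fun_derive// mulr0.
    have := loc_int_mul_supp (loc1 1) cphi tsupp.
    by rewrite (_ : (fun x => 1 * _) = (phi^`())%classic)//; apply/funext => x; rewrite mul1r.
  by rewrite RintegralB// i0 sub0r.
- exact: (@corrector_slope_mean _ _ (measurableTypeR R) T R leb P cell measurable_cell leb_cell alpha beta (beta / M) u a c iu alpha0 ma mc a_itv c_le).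
Qed.

End expansion_along_sequence.

Theorem theorem18 (R : realType) (d : measure_display) (T : measurableType d)
  (P : probability T R) (tau : int -> T -> T)
  (aper cper : R -> R) (b : R -> R -> T -> R)
  (M alpha beta p : R)
  (gw : R -> R -> T -> R) (g0 : R -> R) :
  ergodic_action P tau ->
  measurable_fun setT aper -> measurable_fun setT cper ->
  periodic1 aper -> periodic1 cper ->
  (forall eta, 0 < eta -> jmeas (b eta) /\ stationary tau (b eta)) ->
  0 < M ->
  (forall eta, 0 < eta ->
     Linf_cell_le P (b eta) M) ->
  0 < alpha -> alpha <= beta ->
  (\forall x \ae lebesgue_measure,
     (alpha <= aper x <= beta) /\
     (forall s, -M <= s <= M -> alpha <= aper x + s * cper x <= beta)) ->
  1 < p ->
  (LooLp P p (b eta) @[eta --> 0^'+] --> 0%E) ->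
  (forall eta, 0 < eta ->
     stoch_corrector_deriv P tau (a_eta aper cper (b eta)) (gw eta)) ->
  per_corrector_deriv aper g0 ->
  let q := p / (p - 1) in
  exists (eta : nat -> R) (b0 dv : R -> T -> R),
    let m := fun n => m_of P p (b (eta n)) in
    ((forall n, 0 < eta n) /\ eta n @[n --> \oo] --> 0) /\
    [/\
        (* b_eta / m_eta -> b0 weakly-* in L^oo(cell; L^p(Omega)) *)
        [/\ jmeas b0, stationary tau b0, (LooLp P p b0 < +oo)%E &
            forall phi, in_L1Lq P q phi ->
              pairing P (fun x w => b (eta n) x w / m n) phi @[n --> \oo]
                --> pairing P b0 phi],
        v0_deriv P tau p aper cper g0 b0 dv,
        (* w^eta' = w^0' + m_eta v^0' + o(m_eta) weakly in L^2(cell; L^p) *)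
        (forall phi, in_L2Lq P q phi ->
           pairing P (fun x w => (gw (eta n) x w - g0 x - m n * dv x w) / m n) phi
             @[n --> \oo] --> 0) &
        (* a*_eta = a*_per + m_eta (...) + m_eta (...) + o(m_eta) *)
        (astar_stoch P (a_eta aper cper (b (eta n))) (gw (eta n))
           - astar_per aper g0
           - m n * Xint cell (fun x => Eint P (b0 x) * cper x * (g0 x + 1))
           - m n * Xint cell (fun x => aper x * Eint P (dv x))) / m n
          @[n --> \oo] --> 0].
Proof.
move=> Htau maper mcper paper pcper bP M0 bM alpha0 alphabeta coef_ae p1 LooLp0 gP g0P q.
have p0 : 0 < p by rewrite (lt_trans _ p1).
have M_ge0 : 0 <= M by exact: ltW.
pose e (n : nat) : R := n.+1%:R^-1.
have e0 n : 0 < e n by rewrite invr_gt0.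
pose f n (z : measurableTypeR R * T) := clip M (b (e n) z.1 z.2) / m_of P p (b (e n)).
have fB n : @unit_ball _ _ (measurableTypeR R) T R (@lebesgue_measure R) P cell p (f n).
  have [mb _] := bP _ (e0 n).
  exact: (rescaled_unit_ball p0 M_ge0 mb (LooLp_fin_num p0 M_ge0 mb (bM _ (e0 n)))).
have mD := @measurable_D _ _ (measurableTypeR R) T cell measurable_cell.
have muD := @mu_D_lty _ _ (measurableTypeR R) T R (@lebesgue_measure R) P cell measurable_cell leb_cell.
have [s [u0 [sj mu0 iu0 fu0]]] := @weak_subsequence _ _ _ (prodm (@lebesgue_measure R) P) _ mD muD p 1 p1 f
  (fun n => unit_ball_Lp_le measurable_cell leb_cell (fB n)).
pose eta n := e (s n).
have eta0 n : 0 < eta n by exact: e0.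
(* The extraction is only known to satisfy [j <= s j]; this already gives [eta n <= n.+1%:R^-1]. *)
have eta_cvg : eta n @[n --> \oo] --> 0.
  apply: (squeeze_cvgr _ (cvg_cst 0) (@cvg_harmonic R)); apply: nearW => n.
  by rewrite (ltW (eta0 n))/= lef_pV2 ?posrE// ler_nat ltnS.
(* The weak limit [u0] is determined only on the cell. Replacing it by its stationary extension
   changes it there on a null set only, and gives a field for which the equation on the whole line
   makes sense. *)
pose b0 := stationary_ext tau u0.
have mb0 : jmeas b0 by exact: (jmeas_stationary_ext Htau mu0).
have sb0 : stationary tau b0 by exact: (stationary_ext_stationary Htau).
have ub_ae := stationary_ext_ae (P := P) Htau u0.
have iu : ((@lebesgue_measure R) \x P)%E.-integrable (cell `*` setT) (EFin \o (fun z => b0 z.1 z.2)).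
  apply: (@intg_ae _ _ _ (prodm (@lebesgue_measure R) P) _ mD _ _ iu0); first exact: measurable_funTS.
  by apply: (@filterS _ _ (ae_filter_ringOfSetsType (prodm (@lebesgue_measure R) P)) _ _ _ ub_ae) => z h Dz; exact/esym/h.
have fu C h : 0 <= C -> bdd_meas C h ->
    \int[((@lebesgue_measure R) \x P)%E]_(z in cell `*` setT) (f (s n) z * h z) @[n --> \oo] -->
    \int[((@lebesgue_measure R) \x P)%E]_(z in cell `*` setT) (b0 z.1 z.2 * h z).
  move=> C0 bh; have := fu0 C h C0 bh; have [mh _] := bh.
  rewrite (@Rint_ae _ _ _ (prodm (@lebesgue_measure R) P) _ mD (fun z => u0 z * h z) (fun z => b0 z.1 z.2 * h z))//.
  - by apply: measurable_funTS; exact: measurable_funM.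
  - by apply: measurable_funTS; exact: measurable_funM.
  - by apply: (@filterS _ _ (ae_filter_ringOfSetsType (prodm (@lebesgue_measure R) P)) _ _ _ ub_ae) => z hz Dz; congr (_ * _); exact/esym/hz.
have m_cvg0 : m_of P p (b (eta n)) @[n --> \oo] --> 0.
  apply: fine_cvg; exact: (iffLR (cvge_at_rightP (fun x => LooLp P p (b x)) 0 0) LooLp0 eta (conj eta0 eta_cvg)).
have mb n := proj1 (bP _ (eta0 n)); have sb n := proj2 (bP _ (eta0 n)).
have bM' n := bM _ (eta0 n); have gP' n := gP _ (eta0 n).
pose dv (x : R) (w : T) := corrector_slope (@lebesgue_measure R) P cell (fun z : measurableTypeR R * T => b0 z.1 z.2)
  (amod aper cper M alpha beta) (cmod aper cper M alpha beta) (x, w).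
exists eta, b0, dv => m; split; first by split.
split.
- split; [exact: mb0|exact: sb0|exact: (limit_LooLp M0 p1 mb bM' mb0 iu fu)|].
  exact: (weak_star_pairing M0 p1 mb bM' mb0 iu fu).
- exact: (corrector_slope_v0 Htau maper mcper paper pcper M0 alpha0 alphabeta coef_ae p1 mb bM' g0P mb0 sb0 iu fu).
- exact: (corrector_pairing Htau maper mcper paper pcper M0 alpha0 alphabeta coef_ae p1 mb sb bM' m_cvg0 gP' g0P mb0 iu fu).
- exact: (effective_pairing Htau maper mcper paper pcper M0 alpha0 alphabeta coef_ae p1 mb sb bM' m_cvg0 gP' g0P mb0 iu fu).
Qed.
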